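(* Let $(\mathcal K_n)_{n\ge1}$ be a sequence of finite collections of kernels, and let $\Gamma\ge1$, $\Upsilon>0$ be constants not depending on $n$ such that for all $n\ge 1$ and all $k,k'\in\mathcal K_n$: $\sup_{x}\int k(x,y)^2d\mu(y)\vee\sup_{x,y}|k(x,y)|\le \Gamma n$ and $$\big(\Gamma(1+\|s\|_\infty)\big)\vee\sup_{k\in\mathcal K_n}\|s_k\|^2\le\Upsilon,\qquad P(\chi_k^2)\le\Upsilon n P\Theta_k,\qquad \|s_k-s_{k'}\|_\infty\le\Upsilon\vee\big(\sqrt{\Upsilon n}\,\|s_k-s_{k'}\|\big),$$ $$\mathbb E[A_k(X,Y)^2]\le\Upsilon P\Theta_k,\qquad \sup_{x\in\mathbb X}\mathbb E[A_k(X,x)^2]\le\Upsilon n,\qquad v_k^2\le\Upsilon\vee\sqrt{\Upsilon P\Theta_k}.$$ Assume that there are positive constants $c_s,c_R,c$ and nonnegative deterministic sequences $\varepsilon^{(1)}_n,\varepsilon^{(2)}_n,\varepsilon^{(3)}_n$ tending to $0$ such that for all $n\ge1$ there exist $k_{0,n},k_{1,n}\in\mathcal K_n$ with $$\|s-s_{k_{0,n}}\|^2+\frac{P\Theta_{k_{0,n}}}{n}\le c_s\,\varepsilon^{(1)}_n\Big(\|s-s_{k_{1,n}}\|^2+\frac{P\Theta_{k_{1,n}}}{n}\Big),$$ $$\frac{(\log(|\mathcal K_n|\vee n))^3}{n}\le c_R\,\varepsilon^{(2)}_n\Big(\|s-s_{k_{0,n}}\|^2+\frac{P\Theta_{k_{0,n}}}{n}\Big),\qquad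 \|s-s_{k_{1,n}}\|^2\le c\,\varepsilon^{(3)}_n\frac{P\Theta_{k_{1,n}}}{n}.$$ Suppose that there exist $\delta\ge\delta'>0$, absolute constants $c_1,c_2>0$, a constant $C_1>0$ depending only on $\delta,\delta',\Upsilon$, and nonnegative reals $(r_n)_{n\ge1}$ with $r_n\le c_1\log(|\mathcal K_n|\vee n)$, such that for all $n\ge1$, with probability larger than $1-c_2n^{-2}$, for all $k\in\mathcal K_n$, $$\frac{2P\chi_k-P\Theta_k}{n}-\delta\frac{P\Theta_k}{n}-C_1\frac{r_n\log(|\mathcal K_n|\vee n)^2}{n}\le\mathrm{pen}(k)\le\frac{2P\chi_k-P\Theta_k}{n}-\delta'\frac{P\Theta_k}{n}+C_1\frac{r_n\log(|\mathcal K_n|\vee n)^2}{n}.$$ Let $\hat k_n$ be any minimizer over $\mathcal K_n$ of $P_n\gamma(\hat s_k)+\mathrm{pen}(k)$. Then there exist an absolute constant $c_3>0$, a constant $C_2>0$ depending only on $\delta,\delta',\Upsilon,c,c_s,c_R$, and deterministic real sequences $\eta_n\to0$, $\eta'_n\to0$ and $\rho_n\to0$ ($\rho_n\ge 0$) such that for all $n$ large enough, with probability larger than $1-c_3/n^2$, $$P\Theta_{\hat k_n}\ge\Big(\frac{\delta'}{\delta}+C_2\eta_n\Big)P\Theta_{k_{1,n}}$$ and $$\|s-\hat s_{\hat k_n}\|^2\ge\Big(\frac{\delta'}{\delta}+C_2\eta'_n\Big)\|s-\hat s_{k_{1,n}}\|^2,\qquad \inf_{k\in\mathcal K_n}\|s-\hat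 s_k\|^2\le \|s-\hat s_{k_{0,n}}\|^2\le\rho_n\Big(\frac{\delta'}{\delta}+C_2\eta'_n\Big)\|s-\hat s_{k_{1,n}}\|^2.$$
   Context: Let $(\mathbb X,\mathcal X,\mu)$ be a measure space and let $X,Y,X_1,X_2,\dots$ be i.i.d. $\mathbb X$-valued random variables with common distribution $P$ having a uniformly bounded density $s$ with respect to $\mu$ (so $s\in L^2(\mu)$). The regime is $n\to\infty$; for each $n$ the observations are $X_1,\dots,X_n$. $\|\cdot\|$ is the norm of $L^2(\mu)$, $\|\cdot\|_\infty$ the supremum norm, $a\vee b=\max(a,b)$, and $|A|$ is the cardinality of $A$. For a real function $t$, $P_nt=\frac1n\sum_{i=1}^nt(X_i)$ and $Pt=\int t\,s\,d\mu=\mathbb E[t(X)]$. A kernel is a symmetric (measurable) function $k:\mathbb X^2\to\mathbb R$ with $\sup_x\int k(x,y)^2d\mu(y)\vee\sup_{x,y}|k(x,y)|<\infty$. For a kernel $k$: - $\hat s_k(x)=\frac1n\sum_{i=1}^nk(X_i,x)$ is the associated estimator of $s$; - $s_k(x)=\int k(y,x)s(y)d\mu(y)=\mathbb E[k(X,x)]$; - $\chi_k(x)=k(x,x)$; - $A_k(x,y)=\int k(x,z)k(z,y)d\mu(z)$ and $\Theta_k(x)=A_k(x,x)$; - $\mathbb B_k$ is the set of functions of the form $t(x)=\int a(z)k(z,x)d\mu(z)$ with $a\in L^2(\mu)$, $\|a\|\le1$, and $v_k^2=\sup_{t\in\mathbb B_k}Pt^2$. The least-squares contrast is $\gamma(t)=\|t\|^2-2t$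 for $t\in L^2(\mu)$. The penalty $\mathrm{pen}:\mathcal K_n\to\mathbb R$ may depend on the data. An absolute constant is a positive number not depending on any of the quantities in the problem. *)

(* Defs.v *)
From HB Require Import structures.
From mathcomp Require Import all_boot all_order all_algebra finmap.
From mathcomp Require Import all_classical all_reals all_analysis.
From mathcomp Require Import measurable_realfun.

Set Implicit Arguments.
Unset Strict Implicit.
Unset Printing Implicit Defensive.
Import Order.TTheory GRing.Theory Num.Theory.
Import numFieldNormedType.Exports.

Local Open Scope classical_set_scope.
Local Open Scope ring_scope.

Section Kernels.
Context d (X : measurableType d) (R : realType).
Variable mu : {measure set X -> \bar R}.
Variable s : X -> R.
Implicit Types (t f : X -> R) (k : X * X -> R) (n : nat) (xs : nat -> X).

Definition in_L2 f : Prop := measurable_fun setT f /\ finite_norm mu 2%:E f.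

(* Real-valued norm, meaningful for functions in L^2(mu); fine sends +oo to 0,
   so finiteness has to be known where it is used. *)
Definition l2norm f : R := fine ('N[mu]_2%:E[EFin \o f]).

Definition supnorm f : \bar R := ereal_sup [set (`|f x|)%:E | x in setT].

Definition bounded_density : Prop :=
  [/\ measurable_fun setT s, (forall x, 0 <= s x),
      (\int[mu]_x (s x)%:E = 1)%E & (supnorm s < +oo)%E].

Definition Pint t : R := \int[mu]_x (t x * s x).

(* The observations X_1, ..., X_n are xs 0, ..., xs (n - 1). *)
Definition Pn n xs t : R := n%:R^-1 * \sum_(i < n) t (xs i).

Definition kernel_bound k : \bar R :=
  maxe (ereal_sup [set (\int[mu]_y (k (x, y) ^+ 2)%:E)%E | x in setT])
       (ereal_sup [set (`|k z|)%:E | z in setT]).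

Definition is_kernel k : Prop :=
  [/\ (forall x y, k (x, y) = k (y, x)), measurable_fun setT k
    & (kernel_bound k < +oo)%E].

Definition shat n xs k : X -> R :=
  fun x => n%:R^-1 * \sum_(i < n) k (xs i, x).

(* s_k, A_k and B_k (below) are smooth k, Aker k and Bset k; v_k^2 is vsq k. *)
Definition smooth k : X -> R := fun x => \int[mu]_y (k (y, x) * s y).

Definition chi k : X -> R := fun x => k (x, x).

Definition Aker k : X * X -> R :=
  fun z => \int[mu]_w (k (z.1, w) * k (w, z.2)).

Definition Theta k : X -> R := fun x => Aker k (x, x).

Definition Bset k : set (X -> R) :=
  [set t | exists a : X -> R,
    [/\ in_L2 a, l2norm a <= 1 & t = fun x => \int[mu]_z (a z * k (z, x))]].

Definition vsq k : \bar R :=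
  ereal_sup [set (\int[mu]_x (t x ^+ 2 * s x)%:E)%E | t in Bset k].

Definition contrast t : X -> R := fun x => l2norm t ^+ 2 - 2 * t x.

End Kernels.

Section Probability.
Context d (Omega : measurableType d) d' (X : measurableType d') (R : realType).
Variable Pr : probability Omega R.

Definition independent_family (Z : nat -> Omega -> X) : Prop :=
  forall (J : {fset nat}) (B : nat -> set X),
    (forall i, i \in J -> measurable (B i)) ->
    Pr (\bigcap_(i in [set` J]) (Z i @^-1` B i)) =
      (\prod_(i <- J) Pr (Z i @^-1` B i))%E.

Definition has_density (mu : {measure set X -> \bar R}) (s : X -> R)
    (Z : Omega -> X) : Prop :=
  forall B, measurable B -> Pr (Z @^-1` B) = (\int[mu]_(x in B) (s x)%:E)%E.

(* The family X, Y, X_1, X_2, ... *)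
Definition full_family (X0 Y0 : Omega -> X) (Xs : nat -> Omega -> X) :
    nat -> Omega -> X :=
  fun i => match i with 0 => X0 | 1 => Y0 | j.+2 => Xs j end.

Definition iid_density (mu : {measure set X -> \bar R}) (s : X -> R)
    (X0 Y0 : Omega -> X) (Xs : nat -> Omega -> X) : Prop :=
  [/\ (forall i, measurable_fun setT (full_family X0 Y0 Xs i)),
      independent_family (full_family X0 Y0 Xs)
    & forall i, has_density mu s (full_family X0 Y0 Xs i)].

(* E need not be measurable (it may involve an arbitrary minimizer or
   penalty); for measurable E this is just p <= Pr E. *)
Definition with_prob_ge (p : R) (E : set Omega) : Prop :=
  exists A : set Omega, [/\ measurable A, A `<=` E & (p%:E <= Pr A)%E].

End Probability.

Definition logcard (R : realType) (T : choiceType) (A : {fset T}) (n : nat) : R :=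
  ln (maxn #|` A| n)%:R.

(* For a general measure mu, measurability of A_k has to be assumed for
   E[A_k(X,Y)^2] and P Theta_k to make sense; here is why it holds for free in
   the sigma-finite case. *)
Lemma measurable_Aker_sigma_finite d (X : measurableType d) (R : realType)
    (mu : {sigma_finite_measure set X -> \bar R}) (k : X * X -> R) :
  measurable_fun setT k -> measurable_fun setT (Aker mu k).
Proof.
move=> mk.
pose F : X * X * X -> \bar R :=
  fun u => (k (u.1.1, u.2) * k (u.2, u.1.2))%:E.
have m1 : measurable_fun setT (fun u : X * X * X => u.1.1).
  exact: (measurableT_comp measurable_fst measurable_fst).
have m2 : measurable_fun setT (fun u : X * X * X => u.1.2).
  exact: (measurableT_comp measurable_snd measurable_fst).
have m3 : measurable_fun setT (fun u : X * X * X => u.2).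
  exact: measurable_snd.
have m13 := measurable_fun_pair m1 m3.
have m32 := measurable_fun_pair m3 m2.
have mF : measurable_fun setT F.
  apply/measurable_EFinP; apply: measurable_funM.
  - exact: (measurableT_comp mk m13).
  - exact: (measurableT_comp mk m32).
rewrite /Aker /Rintegral.
apply: measurableT_comp => //.
have -> : (fun z : X * X => \int[mu]_w (k (z.1, w) * k (w, z.2))%:E)%E =
    (fubini_F mu (F^\+)%E \- fubini_F mu (F^\-)%E)%E.
  apply/funext => z; rewrite /fubini_F /= integralE.
  by congr (_ - _)%E; apply: eq_integral => w _; rewrite ?funeposE ?funenegE.
apply: emeasurable_funB; apply: measurable_fun_fubini_tonelli_F => //.
- exact: measurable_funepos.
- exact: measurable_funeneg.
Qed.

(* Main.v *)
(* Conditioning on the past observations, exponential supermartingales give three deviation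
   bounds: Bernstein's inequality for sums of i.i.d. variables; a bound for the norm
   (\int (sum_i g(X_i, y))^2 dP(y))^(1/2), obtained by controlling the exponential moments of
   the increments of a smoothed norm; and Freedman's inequality for the martingale
   sum_(i < j) g(X_i, X_j), whose increments and conditional variances are truncated at
   levels provided by the first two. With L = log(|K_n| \/ n), degenerate second-order
   U-statistics of a kernel k or of A_k then deviate by at most
   theta * P Theta_k + C L^3 / theta^3, for every theta in (0, 1] simultaneously.

   Hence n * loss(k) is n ||s - s_k||^2 + P Theta_k and, up to a term which does not depend
   on k, n times the penalized criterion lies between n ||s - s_k||^2 - delta P Theta_k and
   n ||s - s_k||^2 - delta' P Theta_k, in both cases up to
   theta * (n ||s - s_k||^2 + P Theta_k) + C L^3 / theta^3. Comparing khat_n with k_(1,n),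
   whose bias is negligible, forces
   delta P Theta_khat >= (delta' - o(1)) P Theta_(k_(1,n)). All the
   error terms are of order theta * P Theta_(k_(1,n)) once theta is the fourth root of the
   vanishing rate q_n for which L^3 <= q_n P Theta_(k_(1,n)). *)

From HB Require Import structures.
From mathcomp Require Import all_boot all_order all_algebra finmap.
From mathcomp Require Import all_classical all_reals all_analysis.
From mathcomp Require Import measurable_realfun.
From mathcomp Require Import ring lra.
Require Import Defs.

Set Implicit Arguments.
Unset Strict Implicit.
Unset Printing Implicit Defensive.
Import Order.TTheory GRing.Theory Num.Theory.
Import numFieldNormedType.Exports.

Local Open Scope classical_set_scope.
Local Open Scope ring_scope.

(** * Bounded measurable functions *)

(** No conditional expectation is ever formed. [hist j] is a coarser sigma-algebra on the same
    [Omega], and independence makes the joint law of the history and [Z j] a product, so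
    conditioning means integrating the new point against [P] with the history frozen. All functions
    in the deviation bounds are bounded, so integrability is an issue only for [mu].

    Exact algebra shapes the statistics. In the loss, the linear terms recombine into inner products
    with the bias s - s_k, whose variance is what v_k^2 controls. In the criterion, a linear term in
    s_k is left which is not small for a single kernel; only its difference between the selected
    kernel and k_(1,n) is estimated, and P chi_k cancels against the penalty.

    The error L^3 / theta^3 has two sources: the U-statistics contribute L^(3/2) before the
    arithmetic-geometric inequality squares it, and the mixed term of the bias is split twice, which
    costs theta^(-3). Requiring L^3 / theta^3 <= theta P Theta_(k_(1,n)) then explains the fourth
    root. *)

Definition bdd_mfun d (T : measurableType d) (R : realType) (f : T -> R) : Prop :=
  measurable_fun setT f /\ exists M, forall x, `|f x| <= M.

Section BoundedMeasurable.
Context d (T : measurableType d) (R : realType).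
Implicit Types f g : T -> R.

Lemma bdd_mfun_cst c : bdd_mfun (fun _ : T => c : R).
Proof. by split; [exact: measurable_cst | exists `|c|]. Qed.

Lemma bdd_mfunD f g : bdd_mfun f -> bdd_mfun g -> bdd_mfun (fun x => f x + g x).
Proof.
move=> [mf [M fM]] [mg [N gN]]; split; first exact: measurable_funD.
by exists (M + N) => x; rewrite (le_trans (ler_normD _ _))// lerD.
Qed.

Lemma bdd_mfunN f : bdd_mfun f -> bdd_mfun (fun x => - f x).
Proof.
move=> [mf [M fM]]; split; first exact: measurable_funN.
by exists M => x; rewrite normrN.
Qed.

Lemma bdd_mfunB f g : bdd_mfun f -> bdd_mfun g -> bdd_mfun (fun x => f x - g x).
Proof. by move=> bf bg; apply: bdd_mfunD => //; exact: bdd_mfunN. Qed.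

Lemma bdd_mfunM f g : bdd_mfun f -> bdd_mfun g -> bdd_mfun (fun x => f x * g x).
Proof.
move=> [mf [M fM]] [mg [N gN]]; split; first exact: measurable_funM.
by exists (M * N) => x; rewrite normrM ler_pM.
Qed.

Lemma bdd_mfunX f n : bdd_mfun f -> bdd_mfun (fun x => f x ^+ n).
Proof.
move=> [mf [M fM]]; split; first exact: measurable_funX.
exists (M ^+ n) => x; rewrite normrX lerXn2r ?nnegrE//.
exact: le_trans (fM x).
Qed.

Lemma bdd_mfunZ c f : bdd_mfun f -> bdd_mfun (fun x => c * f x).
Proof. by move=> bf; apply: bdd_mfunM => //; exact: bdd_mfun_cst. Qed.

Lemma bdd_mfun_sum I (r : seq I) (P : pred I) (f : I -> T -> R) :
  (forall i, P i -> bdd_mfun (f i)) -> bdd_mfun (fun x => \sum_(i <- r | P i) f i x).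
Proof.
move=> bf; elim: r => [|i r IH].
  have -> : (fun x => \sum_(i <- [::] | P i) f i x) = (fun=> 0).
    by apply/funext => x; rewrite big_nil.
  exact: bdd_mfun_cst.
have -> : (fun x => \sum_(j <- i :: r | P j) f j x) = (fun x => if P i
    then f i x + \sum_(j <- r | P j) f j x else \sum_(j <- r | P j) f j x).
  by apply/funext => x; rewrite big_cons.
by have [Pi|//] := boolP (P i); apply: bdd_mfunD => //; exact: bf.
Qed.

Lemma bdd_mfun_expR f : bdd_mfun f -> bdd_mfun (fun x => expR (f x)).
Proof.
move=> [mf [M fM]]; split; first by apply: measurableT_comp => //; exact: measurable_expR.
exists (expR M) => x; rewrite ger0_norm ?expR_ge0// ler_expR.
exact: le_trans (ler_norm _) (fM x).
Qed.

Lemma bdd_mfun_indic (A : set T) : measurable A -> bdd_mfun (\1_A : T -> R).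
Proof.
move=> mA; split; first exact: measurable_indic.
by exists 1 => x; rewrite indicE; case: (_ \in _); rewrite /= ?normr1 ?normr0.
Qed.

End BoundedMeasurable.

Lemma bdd_mfun_comp d d' (T : measurableType d) (T' : measurableType d')
    (R : realType) (f : T' -> R) (h : T -> T') :
  bdd_mfun f -> measurable_fun setT h -> bdd_mfun (fun x => f (h x)).
Proof.
move=> [mf [M fM]] mh; split; first exact: measurableT_comp.
by exists M => x.
Qed.

Ltac bdd_tac := repeat first
  [ assumption
  | match goal with
    | |- bdd_mfun (fun _ => _ + - _) => apply: bdd_mfunB
    | |- bdd_mfun (fun _ => _ + _) => apply: bdd_mfunD
    | |- bdd_mfun (fun _ => - _) => apply: bdd_mfunN
    | |- bdd_mfun (fun _ => _ ^+ _) => apply: bdd_mfunX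
    | |- bdd_mfun (fun _ => _ * _) => apply: bdd_mfunM
    | |- bdd_mfun (fun _ => expR _) => apply: bdd_mfun_expR
    | |- bdd_mfun (fun _ => \1_ _ _) => apply: bdd_mfun_indic
    | |- bdd_mfun (fun _ => bigop _ _ _) => apply: bdd_mfun_sum => * 
    end
  | exact: bdd_mfun_cst ].

Section BoundedIntegral.
Context d (T : measurableType d) (R : realType).
Variable P : probability T R.
Implicit Types f g : T -> R.

Lemma bdd_integrable f : bdd_mfun f -> P.-integrable setT (EFin \o f).
Proof.
move=> [mf [M fM]]; apply: measurable_bounded_integrable => //.
  by have : (P setT < +oo)%E by rewrite probability_setT ltry.
exists M; split; first exact: num_real.
by move=> N MN x _; apply: le_trans (fM x) (ltW MN).
Qed.

Lemma bmeanD f g : bdd_mfun f -> bdd_mfun g ->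
  \int[P]_x (f x + g x) = \int[P]_x f x + \int[P]_x g x.
Proof. by move=> bf bg; rewrite RintegralD//; exact: bdd_integrable. Qed.

Lemma bmeanB f g : bdd_mfun f -> bdd_mfun g ->
  \int[P]_x (f x - g x) = \int[P]_x f x - \int[P]_x g x.
Proof. by move=> bf bg; rewrite RintegralB//; exact: bdd_integrable. Qed.

Lemma bmeanZ c f : bdd_mfun f -> \int[P]_x (c * f x) = c * \int[P]_x f x.
Proof. by move=> bf; rewrite RintegralZl//; exact: bdd_integrable. Qed.

Lemma bmean_cst c : \int[P]_x (c : R) = c.
Proof. by rewrite Rintegral_cst// [X in fine X](_ : _ = 1%E) ?mulr1//; exact: probability_setT. Qed.

Lemma bmean_le f g : bdd_mfun f -> bdd_mfun g -> (forall x, f x <= g x) ->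
  \int[P]_x f x <= \int[P]_x g x.
Proof. by move=> bf bg fg; apply: le_Rintegral => //; exact: bdd_integrable. Qed.

Lemma bmean_sum I (r : seq I) (f : I -> T -> R) : (forall i, bdd_mfun (f i)) ->
  \int[P]_x (\sum_(i <- r) f i x) = \sum_(i <- r) \int[P]_x f i x.
Proof.
move=> bf; elim: r => [|i r IH].
  under eq_Rintegral do rewrite big_nil.
  by rewrite big_nil bmean_cst.
under eq_Rintegral do rewrite big_cons.
by rewrite bmeanD// ?IH ?big_cons//; exact: bdd_mfun_sum.
Qed.

Lemma bmean_le_cst f M : bdd_mfun f -> (forall x, f x <= M) -> \int[P]_x f x <= M.
Proof.
move=> bf fM; rewrite -[leRHS]bmean_cst; apply: bmean_le => //.
exact: bdd_mfun_cst.
Qed.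

Lemma bmean_norm_le f M : bdd_mfun f -> (forall x, `|f x| <= M) ->
  `|\int[P]_x f x| <= M.
Proof.
move=> bf fM; rewrite ler_norml; apply/andP; split.
  rewrite -[leLHS]bmean_cst; apply: bmean_le => //; first exact: bdd_mfun_cst.
  by move=> x; have := fM x; rewrite ler_norml => /andP[].
by apply: bmean_le_cst => // x; exact: le_trans (ler_norm _) (fM x).
Qed.

Lemma bmean_indic (A : set T) : measurable A -> (\int[P]_x \1_A x)%:E = P A.
Proof.
move=> mA; rewrite /Rintegral integral_indic// setIT fineK//.
exact: fin_num_measure.
Qed.

Lemma EFin_bmean f : bdd_mfun f -> (\int[P]_x f x)%:E = (\int[P]_x (f x)%:E)%E.
Proof.
by move=> bf; rewrite /Rintegral fineK// integrable_fin_num//; exact: bdd_integrable.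
Qed.

Lemma bmean_sqr_le f : bdd_mfun f ->
  (\int[P]_x f x) ^+ 2 <= \int[P]_x (f x ^+ 2).
Proof.
move=> bf; set m := \int[P]_x f x.
have : 0 <= \int[P]_x (f x - m) ^+ 2 by apply: Rintegral_ge0 => x _; exact: sqr_ge0.
have E x : (f x - m) ^+ 2 = (f x ^+ 2 - (2 * m) * f x) + m ^+ 2 by ring.
under eq_Rintegral do rewrite E.
rewrite bmeanD ?bmeanB ?bmeanZ ?bmean_cst//; bdd_tac.
by rewrite -/m; lra.
Qed.

(** Markov's inequality in pointwise form: the indicator of the event is at least 1 - exp(f - (K +
    x)), and this is integrated. *)
Lemma chernoff f K x : bdd_mfun f -> \int[P]_w expR (f w) <= expR K ->
  with_prob_ge P (1 - expR (- x)) [set w | f w <= K + x].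
Proof.
move=> bf fK; have [mf _] := bf.
have mA : measurable [set w | f w <= K + x].
  rewrite -[X in measurable X]setTI.
  have -> : [set w | f w <= K + x] = f @^-1` `]-oo, (K + x)].
    by apply/seteqP; split => w /=; rewrite in_itv.
  exact: mf.
exists [set w | f w <= K + x]; split => //.
set A := [set w | _].
rewrite -(bmean_indic mA) lee_fin.
have b1 : bdd_mfun (fun w => expR (f w)) by exact: bdd_mfun_expR.
have bA : bdd_mfun (\1_A : T -> R) by exact: bdd_mfun_indic.
have : \int[P]_w (1 - expR (- (K + x)) * expR (f w)) <= \int[P]_w \1_A w.
  apply: bmean_le => //.
    by bdd_tac.
  move=> w; rewrite indicE; case: (boolP (w \in A)) => wA /=.
    by rewrite gerBl mulr_ge0 ?expR_ge0.
  rewrite subr_le0 -expRD -[leLHS]expR0 ler_expR.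
  move: wA; rewrite notin_setE /A /= => /negP; rewrite -ltNge; lra.
apply: le_trans; rewrite bmeanB ?bmeanZ ?bmean_cst//; bdd_tac.
rewrite lerD2l lerN2; apply: le_trans (ler_wpM2l (expR_ge0 _) fK) _.
by rewrite -expRD ler_expR; lra.
Qed.

End BoundedIntegral.

Section BoundedFubini.
Context d1 d2 (T1 : measurableType d1) (T2 : measurableType d2) (R : realType).
Variable P2 : probability T2 R.
Variable P1 : probability T1 R.
Implicit Type f : T1 * T2 -> R.

Lemma bdd_mfun_sec1 f x : bdd_mfun f -> bdd_mfun (fun y => f (x, y)).
Proof. by move=> bf; apply: (bdd_mfun_comp bf); exact: measurable_fun_pair. Qed.

Lemma bdd_mfun_sec2 f y : bdd_mfun f -> bdd_mfun (fun x => f (x, y)).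
Proof. by move=> bf; apply: (bdd_mfun_comp bf); exact: measurable_fun_pair. Qed.

Lemma bdd_mfun_mean1 f : bdd_mfun f -> bdd_mfun (fun x => \int[P2]_y f (x, y)).
Proof.
move=> bf; have [mf [M fM]] := bf; split; last first.
  by exists M => x; apply: bmean_norm_le => //; exact: bdd_mfun_sec1.
(* Tonelli's measurability statement wants a nonnegative integrand, hence the shift by the bound
   [M]. *)
have -> : (fun x => \int[P2]_y f (x, y)) =
    (fun x => \int[P2]_y (f (x, y) + M) - M).
  apply/funext => x; rewrite bmeanD ?bmean_cst ?addrK//.
  - exact: bdd_mfun_sec1.
  - exact: bdd_mfun_cst.
apply: measurable_funB => //.
rewrite /Rintegral; apply: measurableT_comp => //.
apply: (measurable_fun_fubini_tonelli_F (fun z => (f z + M)%:E)).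
  by apply/measurable_EFinP; exact: measurable_funD.
by move=> z; rewrite lee_fin; have := fM z; rewrite ler_norml => /andP[]; lra.
Qed.

Lemma bmean_fubini f : bdd_mfun f ->
  \int[P1]_x \int[P2]_y f (x, y) = \int[(P1 \x P2)%E]_z f z.
Proof.
move=> bf; rewrite [RHS]/Rintegral -integral12_prod_meas1; last exact: bdd_integrable.
rewrite [LHS]/Rintegral; congr fine; apply: eq_integral => x _.
by rewrite /fubini_F EFin_bmean//; exact: bdd_mfun_sec1.
Qed.

End BoundedFubini.

Lemma bdd_mfun_swap d1 d2 (T1 : measurableType d1) (T2 : measurableType d2)
    (R : realType) (f : T1 * T2 -> R) :
  bdd_mfun f -> bdd_mfun (fun z : T2 * T1 => f (z.2, z.1)).
Proof.
move=> bf; apply: (bdd_mfun_comp bf).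
by apply: measurable_fun_pair; [exact: measurable_snd|exact: measurable_fst].
Qed.

Lemma bmean_fubini2 d1 d2 (T1 : measurableType d1) (T2 : measurableType d2)
    (R : realType) (P1 : probability T1 R) (P2 : probability T2 R) (f : T1 * T2 -> R) :
  bdd_mfun f ->
  \int[P1]_x \int[P2]_y f (x, y) = \int[P2]_y \int[P1]_x f (x, y).
Proof.
move=> bf; rewrite bmean_fubini// [LHS]/Rintegral -integral21_prod_meas1; last exact: bdd_integrable.
rewrite [RHS]/Rintegral; congr fine; apply: eq_integral => x _.
by rewrite /fubini_G EFin_bmean//; exact: bdd_mfun_sec2.
Qed.

(** * Exponential moments along the history *)

Lemma in_fset_iota (i j : nat) : (i \in [fset m in iota 0 j]%fset) = (i < j)%N.
Proof. by rewrite in_fset /= mem_iota add0n leq0n. Qed.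

Section History.
Context d (Omega : measurableType d) d' (X : measurableType d') (R : realType).
Variables (Pr : probability Omega R) (P : probability X R) (Z : nat -> Omega -> X).
Hypothesis mZ : forall i, measurable_fun setT (Z i).
Hypothesis indZ : independent_family Pr Z.
Hypothesis lawZ : forall i B, measurable B -> Pr (Z i @^-1` B) = P B.

(** The finite rectangles: a pi-system, so that two measures can be compared on it. *)
Definition hist_system j : set (set Omega) :=
  [set A | exists B : nat -> set X, (forall i, measurable (B i)) /\
     A = \bigcap_(i in `I_j) Z i @^-1` B i].

(** A copy of [Omega] that carries only the sigma-algebra generated by [Z i] for i < j.
    Measurability on [hist j] is adaptedness, while the same function can still be evaluated and
    integrated on [Omega]. *)
Definition hist j : Type := g_sigma_algebraType (hist_system j).
HB.instance Definition _ j := Measurable.on (hist j).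

Lemma hist_systemT j : hist_system j setT.
Proof.
exists (fun=> setT); split; first by [].
by apply/seteqP; split => // w _ i _.
Qed.

Lemma hist_systemI j : setI_closed (hist_system j).
Proof.
move=> _ _ [B [mB ->]] [C [mC ->]]; exists (fun i => B i `&` C i); split.
  by move=> i; exact: measurableI.
apply/seteqP; split => [w [wB wC] i ij|w H].
  by split; [exact: wB|exact: wC].
by split => i ij; have [] := H i ij.
Qed.

Lemma measurable_hist_id j : measurable_fun setT (id : Omega -> hist j).
Proof.
apply: (@measurability _ _ _ _ setT (id : Omega -> hist j) (hist_system j)) => //.
move=> _ [_ [B [mB ->]] <-]; rewrite setTI preimage_id.
apply: bigcap_measurableType => i _.
by rewrite -[X in measurable X]setTI; exact: mZ.
Qed.

Lemma measurable_hist_obs i j : (i < j)%N -> measurable_fun setT (Z i : hist j -> X).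
Proof.
move=> ij _ B mB; rewrite setTI; apply: sub_sigma_algebra.
exists (fun m => if m == i then B else setT); split.
  by move=> m; case: ifP.
apply/seteqP; split => [w ZB m _ /=|w /(_ i ij)/=]; last by rewrite eqxx.
by case: eqP => [->|].
Qed.

Let hid_mix j := isMeasurableFun.Build _ _ _ _ _ (@measurable_hist_id j).
Definition hist_mfun j : {mfun Omega >-> hist j} := HB.pack (id : Omega -> hist j) (hid_mix j).

Definition hist_law j : probability (hist j) R := distribution Pr (hist_mfun j).

Lemma hist_indep_system j A B : hist_system j A -> measurable B ->
  Pr (A `&` Z j @^-1` B) = (Pr A * P B)%E.
Proof.
move=> [C [mC ->]] mB.
(* The event is itself a rectangle over the first [j.+1] indices, with [B] as last factor.
   Independence is used for [J] and for [J']; the two products differ by the factor [P B]. *)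
pose D m := if m == j then B else C m.
have mD m : measurable (D m) by rewrite /D; case: ifP.
pose J := [fset i in iota 0 j.+1]%fset.
pose J' := [fset i in iota 0 j]%fset.
have indJ := indZ (J := J) (fun i _ => mD i).
have indJ' := indZ (J := J') (fun i _ => mC i).
have setJ' : [set` J'] = `I_j.
  by apply/seteqP; split => i /=; rewrite in_fset_iota.
have setJ : [set` J] = `I_j.+1.
  by apply/seteqP; split => i /=; rewrite in_fset_iota.
rewrite setJ in indJ; rewrite setJ' in indJ'.
have -> : \bigcap_(i in `I_j) Z i @^-1` C i `&` Z j @^-1` B =
    \bigcap_(i in `I_j.+1) Z i @^-1` D i.
  apply/seteqP; split => [w [wC wB] i /= ij|w wD].
    rewrite /D; case: eqP => [-> //|/eqP nij]; apply: wC => /=.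
    by rewrite ltn_neqAle nij -ltnS.
  split => [i /= ij|]; last first.
    by have /= := wD j (ltnSn j); rewrite /D eqxx.
  have /= := wD i (ltnW ij : (i < j.+1)%N).
  by rewrite /D; case: eqP ij => [->|//]; rewrite ltnn.
rewrite indJ indJ'.
have JE : J = (j |` J')%fset.
  apply/fsetP => i; rewrite in_fset1U !in_fset_iota.
  by rewrite ltnS leq_eqVlt.
rewrite JE big_fsetU1 /=; last by rewrite in_fset_iota ltnn.
have Dj : D j = B by rewrite /D eqxx.
rewrite Dj lawZ// muleC; congr (_ * _)%E.
rewrite big_seq [RHS]big_seq; apply: eq_bigr => i.
rewrite in_fset_iota /D => ij.
by rewrite ltn_eqF.
Qed.

(** As functions of [A] both sides are finite measures: [Pr] restricted to the event that [Z j]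
    falls in [B], and [Pr] scaled by [P B]. They agree on the pi-system of rectangles, hence on the
    whole history. *)
Lemma hist_indep j (A : set (hist j)) B : measurable A -> measurable B ->
  Pr (A `&` Z j @^-1` B) = (Pr A * P B)%E.
Proof.
move=> mA mB.
have mZB : measurable (Z j @^-1` B).
  by rewrite -[X in measurable X]setTI; exact: mZ.
have PBfin : P B \is a fin_num by exact: fin_num_measure.
have PB0 : 0 <= fine (P B) by rewrite fine_ge0.
pose m1' := [the measure (hist j) R of pushforward (mrestr Pr mZB) (hist_mfun j)].
pose m1 : {measure set (hist j) -> \bar R} := m1' (@measurable_hist_id j).
pose m2 : {measure set (hist j) -> \bar R} :=
  [the measure _ _ of mscale (NngNum PB0) (hist_law j)].
have m1E C : m1 C = Pr (C `&` Z j @^-1` B) by [].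
have m2E C : m2 C = (Pr C * P B)%E.
  by rewrite (_ : m2 C = (fine (P B))%:E * Pr C)%E// fineK// muleC.
rewrite -m1E -m2E.
apply: (@measure_unique _ R (hist j) (hist_system j) (fun=> setT)) => //.
- exact: hist_systemI.
- by move=> ?; exact: hist_systemT.
- by rewrite bigcup_const//; exists 0%N.
- by move=> C hC; rewrite m1E m2E; exact: hist_indep_system.
- by move=> _; rewrite m1E setTI ltey_eq fin_num_measure.
Qed.

Lemma measurable_hist_pair j : measurable_fun setT (fun w : Omega => (w : hist j, Z j w)).
Proof.
by apply: measurable_fun_pair => //; exact: measurable_hist_id.
Qed.

Lemma hist_pair_law j (A : set (hist j * X)) : measurable A ->
  (hist_law j \x P)%E A = pushforward Pr (fun w : Omega => (w : hist j, Z j w)) A.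
Proof.
pose mix := isMeasurableFun.Build _ _ _ _ _ (@measurable_hist_pair j).
pose h : {mfun Omega >-> (hist j * X)%type} :=
  HB.pack (fun w : Omega => (w : hist j, Z j w)) mix.
move=> mA; apply: (@product_measure_unique _ _ _ _ R (hist_law j) P (distribution Pr h)) => //.
move=> B C mB mC.
exact: hist_indep.
Qed.

(** The substitute for conditional expectation: the history and [Z j] have a product law, so
    Fubini's theorem allows [Z j] to be integrated out first. *)
Lemma bmean_hist j (F : hist j * X -> R) : bdd_mfun F ->
  \int[Pr]_w F (w, Z j w) = \int[Pr]_w \int[P]_x F (w, x).
Proof.
move=> bF; have [mF _] := bF.
have mid := @measurable_hist_id j; have mpair := @measurable_hist_pair j.
transitivity (\int[(hist_law j \x P)%E]_z F z).
  rewrite /Rintegral; congr fine.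
  rewrite (@eq_measure_integral _ _ _ _ (pushforward Pr (fun w : Omega => (w : hist j, Z j w)))).
    rewrite integral_pushforward //=; first exact/measurable_EFinP.
    by apply: bdd_integrable; exact: bdd_mfun_comp bF mpair.
  by move=> A mA _; exact: hist_pair_law.
rewrite -bmean_fubini//.
have bG := bdd_mfun_mean1 P bF; have [mG _] := bG.
rewrite /Rintegral; congr fine.
rewrite integral_pushforward //=; first exact/measurable_EFinP.
by apply: bdd_integrable; exact: bdd_mfun_comp bG mid.
Qed.

Lemma bdd_mfun_hist j (f : hist j -> R) : bdd_mfun f -> bdd_mfun (f : Omega -> R).
Proof. by move=> bf; apply: (bdd_mfun_comp bf); exact: measurable_hist_id. Qed.

Lemma bdd_mfun_hist_pair j (F : hist j * X -> R) :
  bdd_mfun F -> bdd_mfun (fun w : Omega => F (w, Z j w)).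
Proof. by move=> bf; apply: (bdd_mfun_comp bf); exact: measurable_hist_pair. Qed.

(** The histories form a filtration; an earlier increment can thus be read at a later level. *)
Lemma measurable_hist_widen i j : (i <= j)%N ->
  measurable_fun setT (id : hist j -> hist i).
Proof.
move=> ij; apply: (@measurability _ _ _ _ setT (id : hist j -> hist i) (hist_system i)) => //.
move=> _ [_ [B [mB ->]] <-]; rewrite setTI preimage_id.
apply: bigcap_measurableType => m mi.
by rewrite -[X in measurable X]setTI; apply: measurable_hist_obs => //; exact: leq_trans mi ij.
Qed.

(* [Z n] is independent of the history of [Z 0, ..., Z n.-1], so integrating it out first bounds
   the exponential moment of the last term conditionally on the previous ones. *)
Lemma bmean_expR_sum (h : nat -> Omega * X -> R) (kappa : R) n :
  (forall j, (j < n)%N -> bdd_mfun (h j : hist j * X -> R)) ->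
  (forall j w, (j < n)%N -> \int[P]_x expR (h j (w, x)) <= expR kappa) ->
  \int[Pr]_w expR (\sum_(j < n) h j (w, Z j w)) <= expR (n%:R * kappa).
Proof.
elim: n => [|n IH] bh hk.
  under eq_Rintegral do rewrite big_ord0.
  by rewrite bmean_cst mul0r.
have bsum : bdd_mfun (fun w : hist n => expR (\sum_(j < n) h j (w, Z j w))).
  apply: bdd_mfun_expR; apply: bdd_mfun_sum => j _.
  apply: (bdd_mfun_comp (bh _ (ltnW (ltn_ord j : (j.+1 <= n)%N)))).
  apply: measurable_fun_pair; last exact: measurable_hist_obs.
  by apply: measurable_hist_widen; exact: ltnW.
have bhn := bdd_mfun_expR (bh _ (ltnSn n)).
pose F z := expR (\sum_(j < n) h j (z.1, Z j z.1)) * expR (h n z).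
have bF : bdd_mfun (F : hist n * X -> R).
  apply: bdd_mfunM => //.
  by apply: (bdd_mfun_comp bsum); exact: measurable_fst.
have -> : \int[Pr]_w expR (\sum_(j < n.+1) h j (w, Z j w)) =
    \int[Pr]_w F (w, Z n w).
  by apply: eq_Rintegral => w _; rewrite /F big_ord_recr/= expRD.
rewrite bmean_hist//.
have -> : (n.+1%:R * kappa) = kappa + n%:R * kappa by rewrite -natr1; ring.
rewrite expRD.
apply: le_trans (_ : \int[Pr]_w (expR kappa * expR (\sum_(j < n) h j (w, Z j w))) <= _).
  apply: bmean_le => [| |w].
  - exact: (bdd_mfun_hist (bdd_mfun_mean1 P bF)).
  - by apply: bdd_mfunZ; exact: (bdd_mfun_hist bsum).
  - rewrite /F /= (bmeanZ P _ (bdd_mfun_sec1 (w : hist n) bhn)).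
    by rewrite mulrC ler_wpM2r ?expR_ge0// hk.
rewrite bmeanZ; last exact: (bdd_mfun_hist bsum).
rewrite ler_wpM2l ?expR_ge0// IH// => j => [jn|w jn]; first exact/bh/ltnW.
exact/hk/ltnW.
Qed.

Lemma hist_tail (h : nat -> Omega * X -> R) (kappa : R) x n :
  (forall j, (j < n)%N -> bdd_mfun (h j : hist j * X -> R)) ->
  (forall j w, (j < n)%N -> \int[P]_x expR (h j (w, x)) <= expR kappa) ->
  with_prob_ge Pr (1 - expR (- x))
    [set w | \sum_(j < n) h j (w, Z j w) <= n%:R * kappa + x].
Proof.
move=> bh hk; apply: chernoff; last exact: bmean_expR_sum.
apply: bdd_mfun_sum => j _.
by have := bdd_mfun_hist_pair (bh _ (ltn_ord j)).
Qed.

End History.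

(** * Intersections of events of large probability *)

Section LargeProbability.
Context d (Omega : measurableType d) (R : realType) (Pr : probability Omega R).
Implicit Types (p q : R) (E F : set Omega).

Lemma with_prob_ge_sub p q E F : q <= p -> E `<=` F ->
  with_prob_ge Pr p E -> with_prob_ge Pr q F.
Proof.
move=> qp EF [A [mA AE pA]]; exists A; split => //.
  exact: subset_trans EF.
by apply: le_trans pA; rewrite lee_fin.
Qed.

Lemma with_prob_geI p q E F : with_prob_ge Pr (1 - p) E ->
  with_prob_ge Pr (1 - q) F -> with_prob_ge Pr (1 - (p + q)) (E `&` F).
Proof.
move=> [A [mA AE pA]] [B [mB BF qB]]; exists (A `&` B); split.
- exact: measurableI.
- exact: setISS.
have bA := bdd_mfun_indic R mA; have bB := bdd_mfun_indic R mB.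
have bAB := bdd_mfun_indic R (measurableI _ _ mA mB).
rewrite -(bmean_indic Pr mA) lee_fin in pA; rewrite -(bmean_indic Pr mB) lee_fin in qB.
rewrite -(bmean_indic Pr (measurableI _ _ mA mB)) lee_fin.
have : \int[Pr]_w (\1_A w + \1_B w - 1) <= \int[Pr]_w \1_(A `&` B) w.
  apply: bmean_le; bdd_tac => // w; rewrite !indicE in_setI.
  by case: (_ \in A); case: (_ \in B) => /=; lra.
rewrite bmeanB ?bmeanD ?bmean_cst; bdd_tac => //; lra.
Qed.

Lemma with_prob_geT p : 0 <= p -> with_prob_ge Pr (1 - p) setT.
Proof.
by move=> p0; exists setT; split => //; rewrite probability_setT lee_fin gerBl.
Qed.

Lemma with_prob_ge_big (I : eqType) (r : seq I) p (E : I -> set Omega) : 0 <= p ->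
  (forall i, i \in r -> with_prob_ge Pr (1 - p) (E i)) ->
  with_prob_ge Pr (1 - (size r)%:R * p) [set w | forall i, i \in r -> E i w].
Proof.
move=> p0; elim: r => [|i r IH] hr.
  rewrite mul0r; apply: with_prob_ge_sub (with_prob_geT (lexx 0)) => //.
have /(with_prob_geI (hr i (mem_head _ _))) :=
  IH (fun j jr => hr j (mem_behead (s := i :: r) jr)).
apply: with_prob_ge_sub => /=; first by rewrite -natr1; lra.
by move=> w [Ei Er] j; rewrite inE => /predU1P[-> //|]; exact: Er.
Qed.

Lemma with_prob_ge_ord n p (E : 'I_n -> set Omega) : 0 <= p ->
  (forall i, with_prob_ge Pr (1 - p) (E i)) ->
  with_prob_ge Pr (1 - n%:R * p) [set w | forall i, E i w].
Proof.
move=> p0 hE; have := @with_prob_ge_big 'I_n (enum 'I_n) p E p0 (fun i _ => hE i).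
rewrite size_enum_ord; apply: with_prob_ge_sub => // w H i.
by apply: H; rewrite mem_enum.
Qed.

End LargeProbability.

(** * One-sided exponential moments *)

Section ExponentialMoment.
Context d (X : measurableType d) (R : realType) (P : probability X R).

(** From exp(-y) >= 1 - y comes exp(y) <= 1 / (1 - y), and (1 - y)(1 + y + 2y^2) = 1 + y^2 (1 - 2y)
    is at least 1. The bound is one-sided in [y] because the increments of the smoothed norm are
    bounded only from above. *)
Lemma expR_le_quadratic (y : R) : y <= 2^-1 -> expR y <= 1 + y + 2 * y ^+ 2.
Proof.
move=> y2; have yN := expR_ge1Dx (- y).
have E0 := expR_gt0 y.
have : expR y * (1 - y) <= 1.
  by rewrite -[leRHS](expRxMexpNx_1 y) ler_wpM2l ?expR_ge0.
nra.
Qed.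

Lemma bmean_expR_le (f : X -> R) : bdd_mfun f -> (forall x, f x <= 2^-1) ->
  \int[P]_x expR (f x) <= expR (\int[P]_x f x + 2 * \int[P]_x (f x ^+ 2)).
Proof.
move=> bf f2; have b2 := bdd_mfunX 2 bf.
apply: le_trans (expR_ge1Dx _).
apply: le_trans (_ : \int[P]_x (1 + f x + 2 * f x ^+ 2) <= _).
  apply: bmean_le; bdd_tac => x; exact: expR_le_quadratic.
by rewrite !bmeanD ?bmeanZ ?bmean_cst; bdd_tac; rewrite addrA.
Qed.

Lemma bmean_cauchy (f g : X -> R) : bdd_mfun f -> bdd_mfun g ->
  (\int[P]_x (f x * g x)) ^+ 2 <= \int[P]_x (f x ^+ 2) * \int[P]_x (g x ^+ 2).
Proof.
move=> bf bg; have bfg := bdd_mfunM bf bg.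
have bf2 := bdd_mfunX 2 bf; have bg2 := bdd_mfunX 2 bg.
set a := \int[P]_x _; set b := \int[P]_x (f x ^+ 2); set c := \int[P]_x (g x ^+ 2).
have H t u : 0 <= t ^+ 2 * b - 2 * (t * u) * a + u ^+ 2 * c.
  have : 0 <= \int[P]_x (t * f x - u * g x) ^+ 2.
    by apply: Rintegral_ge0 => x _; exact: sqr_ge0.
  have E x : (t * f x - u * g x) ^+ 2 =
    t ^+ 2 * f x ^+ 2 - 2 * (t * u) * (f x * g x) + u ^+ 2 * g x ^+ 2 by ring.
  under eq_Rintegral do rewrite E.
  by rewrite bmeanD ?bmeanB ?bmeanZ; bdd_tac.
have b0 : 0 <= b by apply: Rintegral_ge0 => x _; exact: sqr_ge0.
have c0 : 0 <= c by apply: Rintegral_ge0 => x _; exact: sqr_ge0.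
have [c00|c1] := eqVneq c 0.
  have [->|a0] := eqVneq a 0; first by rewrite expr0n/= mulr_ge0.
  (* When [c] vanishes, the quadratic form takes at this point the value b - 2(b + 1), which is
     negative: so [a] must vanish too. *)
  have := H 1 ((b + 1) / a); rewrite c00 !mul1r mulr0 addr0 -mulrA.
  by rewrite mulfVK//; lra.
have cp : 0 < c by rewrite lt_neqAle eq_sym c1.
have := H c a; nra.
Qed.

End ExponentialMoment.

(** * Bernstein's inequality *)

Section Bernstein.
Context d (Omega : measurableType d) d' (X : measurableType d') (R : realType).
Variables (Pr : probability Omega R) (P : probability X R) (Z : nat -> Omega -> X).
Hypothesis mZ : forall i, measurable_fun setT (Z i).
Hypothesis indZ : independent_family Pr Z.
Hypothesis lawZ : forall i B, measurable B -> Pr (Z i @^-1` B) = P B.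

(** The exponential parameter is 1/c: the bound on [f] keeps the exponent below 1/2, the variance
    condition makes the [n] quadratic terms cost at most 2x, and Chernoff adds x; hence the 3. *)
Lemma bernstein_le (f : X -> R) c x n : bdd_mfun f -> \int[P]_y f y = 0 -> 0 < c ->
  (forall y, 2 * `|f y| <= c) -> n%:R * \int[P]_y (f y ^+ 2) <= c ^+ 2 * x ->
  with_prob_ge Pr (1 - expR (- x)) [set w | \sum_(i < n) f (Z i w) <= 3 * c * x].
Proof.
move=> bf f0 c0 fc nf.
have f2 : 0 <= \int[P]_y (f y ^+ 2) by apply: Rintegral_ge0 => y _; exact: sqr_ge0.
pose h (j : nat) (z : Omega * X) := c^-1 * f z.2.
pose kappa := 2 * (c ^- 2 * \int[P]_y (f y ^+ 2)).
have bh j : bdd_mfun (h j : hist Z j * X -> R).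
  by apply: bdd_mfunZ; apply: (bdd_mfun_comp bf); exact: measurable_snd.
have hk j w : \int[P]_y expR (h j (w, y)) <= expR kappa.
  rewrite /h /=; apply: le_trans (bmean_expR_le P (bdd_mfunZ c^-1 bf) _) _ => [y|].
    rewrite -(ler_pM2l c0) mulrA divff ?gt_eqF// mul1r.
    have := fc y; have := ler_norm (f y); lra.
  rewrite bmeanZ// f0 mulr0 add0r ler_expR /kappa.
  under eq_Rintegral do rewrite exprMn.
  by rewrite bmeanZ ?exprVn//; bdd_tac.
have := hist_tail mZ indZ lawZ x (fun j (_ : (j < n)%N) => bh j) (fun j w _ => hk j w).
apply: with_prob_ge_sub => // w /=; rewrite /h /= -mulr_sumr.
set S := \sum_(_ < _) _ => H.
have : c^-1 * S <= 3 * x.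
  apply: le_trans H _; rewrite /kappa.
  have : n%:R * (c ^- 2 * \int[P]_y f y ^+ 2) <= x.
    by rewrite mulrCA mulrC ler_pdivrMr ?exprn_gt0// [leRHS]mulrC.
  lra.
by rewrite ler_pdivrMl//; lra.
Qed.

Lemma bernstein_abs (f : X -> R) c x n : bdd_mfun f -> \int[P]_y f y = 0 -> 0 < c ->
  (forall y, 2 * `|f y| <= c) -> n%:R * \int[P]_y (f y ^+ 2) <= c ^+ 2 * x ->
  with_prob_ge Pr (1 - 2 * expR (- x))
    [set w | `|\sum_(i < n) f (Z i w)| <= 3 * c * x].
Proof.
move=> bf f0 c0 fc nf.
have H1 := bernstein_le bf f0 c0 fc nf.
have Nf0 : \int[P]_y - f y = 0.
  under eq_Rintegral do rewrite -mulN1r.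
  by rewrite bmeanZ// f0 mulr0.
have H2 : with_prob_ge Pr (1 - expR (- x)) [set w | \sum_(i < n) - f (Z i w) <= 3 * c * x].
  apply: (@bernstein_le (fun y => - f y)) => //; bdd_tac.
    by move=> y; rewrite normrN.
  by under eq_Rintegral do rewrite sqrrN.
have := with_prob_geI H1 H2; apply: with_prob_ge_sub; first lra.
by move=> w [/= ?]; rewrite sumrN ler_norml; lra.
Qed.

End Bernstein.

(** * Degenerate U-statistics *)

Section UStatistic.
Context d (Omega : measurableType d) d' (X : measurableType d') (R : realType).
Variables (Pr : probability Omega R) (P : probability X R) (Z : nat -> Omega -> X).
Hypothesis mZ : forall i, measurable_fun setT (Z i).
Hypothesis indZ : independent_family Pr Z.
Hypothesis lawZ : forall i B, measurable B -> Pr (Z i @^-1` B) = P B.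

Variables (g : X * X -> R) (D a : R).
Hypothesis bg : bdd_mfun g.
Hypothesis g_sym : forall x y, g (x, y) = g (y, x).
Hypothesis g_deg : forall x, \int[P]_y g (x, y) = 0.
Hypothesis g_D : forall x, \int[P]_y (g (x, y) ^+ 2) <= D.
Hypothesis g_a : \int[P]_x \int[P]_y (g (x, y) ^+ 2) <= a.

(** The increment at time [j] of the martingale of the sums over i < j, with the new point left
    free. *)
Definition usum j (z : Omega * X) : R := \sum_(i < j) g (Z i z.1, z.2).

(** Two objects at once: the squared L^2(P) norm of the function g(Z_0, .) + ... + g(Z_(j-1), .),
    and the conditional variance of the martingale increment. A tail bound for the former is
    therefore the variance input of Freedman's inequality. *)
Definition usqr j (w : Omega) : R := \int[P]_y (usum j (w, y) ^+ 2).

Lemma bdd_usum j : bdd_mfun (usum j : hist Z j * X -> R).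
Proof.
apply: bdd_mfun_sum => i _; apply: (bdd_mfun_comp bg).
apply: measurable_fun_pair; last exact: measurable_snd.
exact: (measurableT_comp (measurable_hist_obs (Z := Z) (ltn_ord i)) measurable_fst).
Qed.

Lemma bdd_usum1 j w : bdd_mfun (fun y => usum j (w, y)).
Proof. exact: (bdd_mfun_sec1 (w : hist Z j) (bdd_usum j)). Qed.

Lemma bdd_usqr j : bdd_mfun (usqr j : hist Z j -> R).
Proof. by have := bdd_mfun_mean1 P (bdd_mfunX 2 (bdd_usum j)). Qed.

Lemma usqr_ge0 j w : 0 <= usqr j w.
Proof. by apply: Rintegral_ge0 => y _; exact: sqr_ge0. Qed.

Lemma mean_usum j w : \int[P]_y usum j (w, y) = 0.
Proof.
rewrite /usum /= bmean_sum => [|i]; last exact: bdd_mfun_sec1.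
by rewrite big1.
Qed.

Lemma usumS j w y : usum j.+1 (w, y) = usum j (w, y) + g (Z j w, y).
Proof. by rewrite /usum big_ord_recr. Qed.

Let upd j (z : Omega * X) : R := \int[P]_y ((usum j (z.1, y) + g (z.2, y)) ^+ 2).

Let usqrS j w : usqr j.+1 w = upd j (w, Z j w).
Proof. by apply: eq_Rintegral => y _; rewrite usumS. Qed.

Let cross j (z : Omega * X) : R := \int[P]_y (usum j (z.1, y) * g (z.2, y)).
Let gsqr x : R := \int[P]_y (g (x, y) ^+ 2).

Let updE j w x : upd j (w, x) = usqr j w + 2 * cross j (w, x) + gsqr x.
Proof.
have bu := bdd_usum1 j w; have bgx := bdd_mfun_sec1 x bg.
rewrite /upd /cross /gsqr /usqr /=.
rewrite -bmeanZ; last by bdd_tac.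
rewrite -!bmeanD; bdd_tac.
by apply: eq_Rintegral => y _; ring.
Qed.

Let btriple j : bdd_mfun (fun u : (hist Z j * X) * X => usum j (u.1.1, u.2)).
Proof.
apply: (bdd_mfun_comp (bdd_usum j)); apply: measurable_fun_pair => //.
exact: (measurableT_comp measurable_fst measurable_fst).
Qed.

Let btriple_g j : bdd_mfun (fun u : (hist Z j * X) * X => g (u.1.2, u.2)).
Proof.
apply: (bdd_mfun_comp bg); apply: measurable_fun_pair => //.
exact: (measurableT_comp measurable_snd measurable_fst).
Qed.

Let bdd_cross j : bdd_mfun (cross j : hist Z j * X -> R).
Proof. exact: (bdd_mfun_mean1 P (bdd_mfunM (btriple j) (btriple_g j))). Qed.

Let bdd_upd j : bdd_mfun (upd j : hist Z j * X -> R).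
Proof.
exact: (bdd_mfun_mean1 P (bdd_mfunX 2 (bdd_mfunD (btriple j) (btriple_g j)))).
Qed.

Let bdd_gsqr : bdd_mfun gsqr.
Proof. exact: (bdd_mfun_mean1 P (bdd_mfunX 2 bg)). Qed.

Let gsqr_ge0 x : 0 <= gsqr x.
Proof. by apply: Rintegral_ge0 => y _; exact: sqr_ge0. Qed.

Let upd_ge0 j z : 0 <= upd j z.
Proof. by apply: Rintegral_ge0 => y _; exact: sqr_ge0. Qed.

(** By Fubini's theorem the new point can be averaged first, where symmetry and degeneracy give
    zero. The only drift of the squared norm is thus the mean of [gsqr], at most [a]. *)
Let mean_cross j w : \int[P]_x cross j (w, x) = 0.
Proof.
have bu := bdd_usum1 j w.
rewrite /cross /= (@bmean_fubini2 _ _ _ _ _ P P (fun z => usum j (w, z.2) * g z)).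
  rewrite -[RHS](bmean_cst P); apply: eq_Rintegral => y _ /=.
  rewrite bmeanZ; last exact: bdd_mfun_sec2.
  by under eq_Rintegral do rewrite g_sym; rewrite g_deg mulr0.
apply: bdd_mfunM => //; apply: (bdd_mfun_comp bu); exact: measurable_snd.
Qed.

Let cross_sqr j w x : cross j (w, x) ^+ 2 <= usqr j w * gsqr x.
Proof. by apply: bmean_cauchy; [exact: bdd_usum1|exact: bdd_mfun_sec1]. Qed.

Lemma bdd_mfun_sqrt d1 (T : measurableType d1) (f : T -> R) :
  bdd_mfun f -> bdd_mfun (fun x => Num.sqrt (f x)).
Proof.
move=> [mf [M fM]]; split.
  apply: measurableT_comp => //; apply: continuous_measurable_fun; exact: sqrt_continuous.
exists (Num.sqrt M) => x; rewrite ger0_norm ?sqrtr_ge0//; apply: ler_wsqrtr.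
exact: le_trans (ler_norm _) (fM x).
Qed.

Section Norm.
Variable om : R.
Hypothesis om0 : 0 < om.
Hypothesis Dom : 9 * D <= om ^+ 2.

(** Adding [om ^+ 2] under the root keeps the norm away from 0, so that its increments measured in
    units of [om] are bounded above and have a small mean. *)
Let nrm j (w : Omega) : R := Num.sqrt (usqr j w + om ^+ 2).
Let step j (z : Omega * X) : R := om^-1 * (Num.sqrt (upd j z + om ^+ 2) - nrm j z.1).

Let nrm_sqr j w : nrm j w ^+ 2 = usqr j w + om ^+ 2.
Proof. by rewrite sqr_sqrtr// addr_ge0 ?usqr_ge0 ?sqr_ge0. Qed.

Let nrm_ge j w : om <= nrm j w.
Proof.
rewrite -(ger0_norm (ltW om0)) -sqrtr_sqr; apply: ler_wsqrtr.
by rewrite lerDr usqr_ge0.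
Qed.

Let bdd_step j : bdd_mfun (step j : hist Z j * X -> R).
Proof.
have bu := bdd_upd j; have bq := bdd_usqr j.
apply: bdd_mfunZ; apply: bdd_mfunB; first by apply: bdd_mfun_sqrt; bdd_tac.
have : bdd_mfun (nrm j : hist Z j -> R) by apply: bdd_mfun_sqrt; bdd_tac.
by move/bdd_mfun_comp; apply; exact: measurable_fst.
Qed.

(** The tangent of the square root at the current value; by concavity it dominates the increment
    [step]. *)
Let lin j w x : R := (2 * nrm j w * om)^-1 * (2 * cross j (w, x) + gsqr x).

Let step_le_lin j w x : step j (w, x) <= lin j w x.
Proof.
have n0 := lt_le_trans om0 (nrm_ge j w).
rewrite /step /lin invfM mulrAC [leRHS]mulrC ler_wpM2l ?invr_ge0 ?(ltW om0)//=.
rewrite ler_pdivlMl ?mulr_gt0//.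
set r := Num.sqrt _; have r2 : r ^+ 2 = upd j (w, x) + om ^+ 2.
  by rewrite sqr_sqrtr// addr_ge0 ?upd_ge0 ?sqr_ge0.
have := nrm_sqr j w; have := sqr_ge0 (r - nrm j w); rewrite updE in r2; nra.
Qed.

(** Cauchy-Schwarz and [9 * D <= om ^+ 2] give 3 [cross] <= [nrm] [om] and 9 [gsqr] <= [om ^+ 2] <=
    [nrm] [om]; then 2 [cross] + [gsqr] is at most (2/3 + 1/9) [nrm] [om]. *)
Let lin_le j w x : lin j w x <= 2^-1.
Proof.
have n0 := lt_le_trans om0 (nrm_ge j w).
rewrite /lin ler_pdivrMl ?mulr_gt0//.
have := cross_sqr j w x; have := nrm_sqr j w; have := nrm_ge j w.
have := g_D x; have := gsqr_ge0 x; have := usqr_ge0 j w.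
rewrite -/(gsqr x); set G := gsqr x; set c := cross _ _; set Q := usqr j w; set N := nrm j w.
move=> Q0 G0 GD Nom N2 cs.
have No : 0 <= N * om by rewrite mulr_ge0 ?ltW.
have c3 : 3 * c <= N * om.
  have h : (3 * c) ^+ 2 <= (N * om) ^+ 2.
    have q1 := ler_wpM2l Q0 GD; have q2 := ler_wpM2l Q0 Dom.
    by rewrite !exprMn N2; have := sqr_ge0 (om ^+ 2); have := Dom; lra.
  have [c0|c0] := leP c 0; first by apply: le_trans No; lra.
  by rewrite -(@ler_pXn2r _ 2) ?nnegrE//; lra.
have := ler_wpM2r (ltW om0) Nom; have := Dom; rewrite -expr2; lra.
Qed.

Let bdd_lin j w : bdd_mfun (lin j w).
Proof.
have bc := bdd_mfun_sec1 (w : hist Z j) (bdd_cross j).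
by apply: bdd_mfunZ; bdd_tac.
Qed.

(** The random factor 8 [usqr] + 2 [D] of the second moment is at most 8 times the square of [nrm],
    which the normalization of [lin] divides out. This makes the bound free of the history; the
    terms add up to 9/2, rounded to 6. *)
Let mean_lin j w : \int[P]_x lin j w x + 2 * \int[P]_x (lin j w x ^+ 2) <= 6 * (a / om ^+ 2).
Proof.
have bc := bdd_mfun_sec1 (w : hist Z j) (bdd_cross j).
have n0 := lt_le_trans om0 (nrm_ge j w).
have G0 : 0 <= \int[P]_x gsqr x by apply: Rintegral_ge0 => x _; exact: gsqr_ge0.
have Ga : \int[P]_x gsqr x <= a by exact: g_a.
set k := (2 * nrm j w * om)^-1.
have k0 : 0 < k by rewrite invr_gt0 !mulr_gt0.
have -> : \int[P]_x lin j w x = k * \int[P]_x gsqr x.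
  rewrite /lin bmeanZ ?bmeanD ?bmeanZ; bdd_tac.
  by rewrite mean_cross mulr0 add0r.
have lin2 x : lin j w x ^+ 2 <= (k ^+ 2 * (8 * usqr j w + 2 * D)) * gsqr x.
  rewrite /lin -/k exprMn -mulrA ler_wpM2l ?sqr_ge0//.
  have := cross_sqr j w x; have := g_D x; rewrite -/(gsqr x); have := gsqr_ge0 x.
  set G := gsqr x; set c := cross _ _; move=> ? ? ?.
  have : (2 * c + G) ^+ 2 <= 8 * c ^+ 2 + 2 * G ^+ 2.
    by have := sqr_ge0 (2 * c - G); lra.
  nra.
have L2 : \int[P]_x (lin j w x ^+ 2) <= (k ^+ 2 * (8 * usqr j w + 2 * D)) * \int[P]_x gsqr x.
  rewrite -bmeanZ//; apply: bmean_le => //; last by bdd_tac.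
  exact: (bdd_mfunX 2 (bdd_lin j w)).
have kE : k * (nrm j w * om) = 2^-1.
  by rewrite /k -[2 * _ * _]mulrA invfM -mulrA mulVf ?mulr1// mulf_neq0 ?gt_eqF.
set I := \int[P]_x gsqr x in G0 Ga L2 *.
have N2 := nrm_sqr j w; have Nom := nrm_ge j w; have Q0 := usqr_ge0 j w.
have D0 : 0 <= D by apply: le_trans (gsqr_ge0 point) (g_D point).
have E1 : k ^+ 2 * (8 * usqr j w + 2 * D) <= 2 / om ^+ 2.
  rewrite ler_pdivlMr ?exprn_gt0//.
  have kQ : k ^+ 2 * (8 * usqr j w + 8 * om ^+ 2) * om ^+ 2 = 2.
    have -> : k ^+ 2 * (8 * usqr j w + 8 * om ^+ 2) * om ^+ 2 =
      8 * (k ^+ 2 * ((usqr j w + om ^+ 2) * om ^+ 2)) by ring.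
    by rewrite -N2 -!exprMn kE; lra.
  rewrite -[leRHS]kQ ler_wpM2r ?sqr_ge0// ler_wpM2l ?sqr_ge0//.
  have := Dom; have := sqr_ge0 om; lra.
have E2 : k <= 2^-1 / om ^+ 2.
  by rewrite ler_pdivlMr ?exprn_gt0// -kE expr2 ler_wpM2l ?(ltW k0)// ler_wpM2r// ltW.
have om20 : 0 <= (om ^+ 2)^-1 by rewrite invr_ge0 sqr_ge0.
have aI : I / om ^+ 2 <= a / om ^+ 2 by rewrite ler_wpM2r.
have E1' : k ^+ 2 * (8 * usqr j w + 2 * D) * I <= 2 * (I / om ^+ 2).
  have -> : 2 * (I / om ^+ 2) = 2 / om ^+ 2 * I by ring.
  exact: ler_wpM2r.
have E2' : k * I <= 2^-1 * (I / om ^+ 2).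
  have -> : 2^-1 * (I / om ^+ 2) = 2^-1 / om ^+ 2 * I by ring.
  exact: ler_wpM2r.
have I0 : 0 <= I / om ^+ 2 by exact: mulr_ge0.
lra.
Qed.

Lemma usqr_tail n j x : (j <= n)%N -> n%:R * a <= om ^+ 2 -> 1 <= x ->
  with_prob_ge Pr (1 - expR (- x)) [set w | usqr j w <= (8 * x * om) ^+ 2].
Proof.
move=> jn nom x1.
have hk i w : \int[P]_y expR (step i (w, y)) <= expR (6 * (a / om ^+ 2)).
  apply: le_trans (_ : expR (\int[P]_y lin i w y + 2 * \int[P]_y (lin i w y ^+ 2)) <= _); last first.
    by rewrite ler_expR.
  apply: le_trans (bmean_expR_le P (bdd_lin i w) (lin_le i w)).
  apply: bmean_le => [| |y]; last by rewrite ler_expR.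
  - by apply: bdd_mfun_expR; exact: (bdd_mfun_sec1 (w : hist Z i) (bdd_step i)).
  - exact: bdd_mfun_expR.
have a0 : 0 <= a.
  by apply: le_trans g_a; apply: Rintegral_ge0 => y _; exact: gsqr_ge0.
have := hist_tail mZ indZ lawZ x (fun i (_ : (i < j)%N) => bdd_step i) (fun i w _ => hk i w).
apply: with_prob_ge_sub => // w /=.
have -> : \sum_(i < j) step i (w, Z i w) = om^-1 * (nrm j w - om).
  rewrite -mulr_sumr; congr (_ * _).
  have nrm0 : nrm 0%N w = om.
    rewrite /nrm /usqr; under eq_Rintegral do rewrite /usum big_ord0 expr0n.
    by rewrite bmean_cst add0r sqrtr_sqr gtr0_norm.
  transitivity (nrm j w - nrm 0%N w); last by rewrite nrm0.
  rewrite -(telescope_sumr (nrm^~ w) (leq0n j)) big_mkord.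
  by apply: eq_bigr => i _; rewrite /nrm usqrS.
rewrite ler_pdivrMl// => H.
(* The drifts add up to at most 6, so [nrm j] is at most [om] (1 + 6 + x), hence at most 8 x [om] as
   x >= 1. *)
have ja : j%:R * (6 * (a / om ^+ 2)) <= 6.
  rewrite mulrCA -[leRHS]mulr1 ler_wpM2l// mulrA ler_pdivrMr ?exprn_gt0// mul1r.
  by apply: le_trans nom; rewrite ler_wpM2r// ler_nat.
have H1 := ler_wpM2l (ltW om0) (lerD ja (lexx x)).
have H2 := ler_wpM2l (ltW om0) x1.
have nx : nrm j w <= 8 * x * om by lra.
have : nrm j w ^+ 2 <= (8 * x * om) ^+ 2.
  have := nrm_ge j w; have := om0 => ? ?.
  by rewrite lerXn2r ?nnegrE//; lra.
by rewrite nrm_sqr; have := sqr_ge0 om; lra.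
Qed.

End Norm.

(** With the new point frozen at y, [usum] is a sum of i.i.d. centered variables, and Bernstein's
    inequality holds with the same bound for every y. Since [Z j] is independent of the history, y
    can then be averaged out by Fubini's theorem. *)
Lemma usum_tail c n j x : (j <= n)%N -> 0 < c -> (forall z, 2 * `|g z| <= c) ->
  n%:R * D <= c ^+ 2 -> 1 <= x ->
  with_prob_ge Pr (1 - 2 * expR (- x)) [set w | `|usum j (w, Z j w)| <= 3 * c * x].
Proof.
move=> jn c0 gc nD x1.
have x0 : 0 <= x by exact: le_trans x1.
pose A : set (hist Z j * X) := [set z | `|usum j z| <= 3 * c * x].
have [mu _] := bdd_usum j.
have mA : measurable A.
  rewrite -[X in measurable X]setTI.
  have -> : A = (fun z : hist Z j * X => `|usum j z|) @^-1` `]-oo, (3 * c * x)].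
    by apply/seteqP; split => w /=; rewrite /A /= in_itv.
  by apply: measurableT_comp.
have bA : bdd_mfun (\1_A : hist Z j * X -> R) by exact: bdd_mfun_indic.
have mAZ : measurable [set w | A (w, Z j w)].
  rewrite -[X in measurable X]setTI; exact: measurable_hist_pair.
exists [set w | A (w, Z j w)]; split => //.
rewrite -(bmean_indic Pr mAZ) lee_fin.
have -> : \int[Pr]_w \1_[set w | A (w, Z j w)] w = \int[Pr]_w \1_A (w, Z j w) by [].
rewrite (bmean_hist mZ indZ lawZ bA).
have mid := @measurable_hist_id _ _ _ _ _ mZ j.
have bG := bdd_mfun_mean1 P bA.
have -> : \int[Pr]_w \int[P]_y \1_A (w, y) = \int[hist_law Pr mZ j]_w \int[P]_y \1_A (w, y).
  rewrite [RHS]/Rintegral integral_pushforward //=.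
    by apply/measurable_EFinP; case: bG.
  by apply: bdd_integrable; exact: bdd_mfun_comp bG mid.
rewrite bmean_fubini2// -[leLHS](bmean_cst P).
apply: bmean_le => [| |y]; first exact: bdd_mfun_cst.
  by have := bdd_mfun_mean1 (hist_law Pr mZ j) (bdd_mfun_swap bA).
have -> : \int[hist_law Pr mZ j]_w \1_A (w, y) = \int[Pr]_w \1_[set w | A (w, y)] w.
  have b2 := bdd_mfun_sec2 y bA.
  rewrite [LHS]/Rintegral integral_pushforward //=.
    by apply/measurable_EFinP; case: b2.
  by apply: bdd_integrable; exact: bdd_mfun_comp b2 mid.
have mAy : measurable [set w : Omega | A (w, y)].
  rewrite -[X in measurable X]setTI.
  apply: (measurableT_comp (f := fun w : hist Z j => (w, y)) _ mid) => //.
have [|B [mB BA pB]] := bernstein_abs mZ indZ lawZ (x := x) (n := j) (bdd_mfun_sec1 y bg) (g_deg y) c0 (fun z => gc (y, z)).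
  apply: le_trans (_ : n%:R * D <= _).
    apply: ler_pM => //; last by rewrite ler_nat.
    by apply: Rintegral_ge0 => z _; exact: sqr_ge0.
  by apply: le_trans nD _; rewrite ler_peMr// sqr_ge0.
rewrite -lee_fin (bmean_indic Pr mAy); apply: le_trans pB _.
apply: le_measure; rewrite ?inE// => w /BA /=; rewrite /A/= /usum.
by under eq_bigr do rewrite g_sym.
Qed.

(* Freedman's inequality for the martingale of the sums [usum j (w, Z j w)],
   truncated where an increment or its conditional variance is too large. *)
Lemma usum_truncated_le V beta n x (s : R) : 0 <= V -> `|s| = 1 -> 0 < beta -> n%:R * V <= beta ^+ 2 * x ->
  with_prob_ge Pr (1 - expR (- x))
    [set w | (forall j : 'I_n, usqr j w <= V) ->
             (forall j : 'I_n, 2 * `|usum j (w, Z j w)| <= beta) ->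
             s * \sum_(j < n) usum j (w, Z j w) <= 5 * beta * x].
Proof.
move=> V0 s1 beta0 nV.
have s2 : s ^+ 2 = 1 by rewrite -(real_normK (num_real s)) s1 expr1n.
pose A j : set (hist Z j * X) := [set z | 2 * `|usum j z| <= beta].
pose B j : set (hist Z j) := [set w | usqr j w <= V].
have mA j : measurable (A j).
  have [mu _] := bdd_usum j.
  rewrite -[X in measurable X]setTI.
  have -> : A j = (fun z : hist Z j * X => 2 * `|usum j z|) @^-1` `]-oo, beta].
    by apply/seteqP; split => w /=; rewrite /A /= in_itv.
  by apply: measurable_funM => //; exact: measurableT_comp.
have mB j : measurable (B j).
  have [mq _] := bdd_usqr j.
  rewrite -[X in measurable X]setTI.
  have -> : B j = (usqr j : hist Z j -> R) @^-1` `]-oo, V].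
    by apply/seteqP; split => w /=; rewrite /B /= in_itv.
  exact: mq.
(* The indicator of [B j] is known from the history and preserves centering; that of [A j] involves
   the new point and creates a bias, estimated in [IT]. *)
pose T j (z : Omega * X) := \1_(B j) z.1 * (usum j z * \1_(A j) z).
pose h j (z : Omega * X) := (s / beta) * T j z.
have bT j : bdd_mfun (T j : hist Z j * X -> R).
  apply: bdd_mfunM.
    by apply: (bdd_mfun_comp (bdd_mfun_indic R (mB j))); exact: measurable_fst.
  by apply: bdd_mfunM; [exact: bdd_usum|exact: bdd_mfun_indic].
have bh j : bdd_mfun (h j : hist Z j * X -> R) by exact: bdd_mfunZ.
(* Of the factor 4, one half pays for the truncation bias and the other for the second moment. *)
have hk j w : \int[P]_y expR (h j (w, y)) <= expR (4 * (V / beta ^+ 2)).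
  have bT1 := bdd_mfun_sec1 (w : hist Z j) (bT j).
  have bu := bdd_usum1 j w.
  have bA1 := bdd_mfun_sec1 (w : hist Z j) (bdd_mfun_indic R (mA j)).
  have Tbeta y : 2 * `|T j (w, y)| <= beta.
    rewrite /T /= !indicE; case: (_ \in B j); last by rewrite mul0r normr0 mulr0 ltW.
    rewrite mul1r; case: (boolP (_ \in A j)) => [|_]; last by rewrite mulr0 normr0 mulr0 ltW.
    by rewrite inE /A /= mulr1.
  have nsb : `|s / beta| = beta^-1 by rewrite normrM s1 mul1r gtr0_norm ?invr_gt0.
  apply: le_trans (bmean_expR_le P (bdd_mfunZ (s / beta) bT1) _) _ => [y|].
    apply: le_trans (ler_norm _) _; rewrite normrM nsb ler_pdivrMl//.
    have := Tbeta y; lra.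
  have [wB|wB] := boolP ((w : hist Z j) \in B j); last first.
    have T0 y : T j (w, y) = 0 by rewrite /T /= indicE (negbTE wB) mul0r.
    under eq_Rintegral do rewrite T0 mulr0.
    rewrite bmean_cst; under eq_Rintegral do rewrite T0 mulr0 expr0n.
    rewrite bmean_cst ler_expR/=.
    by rewrite mulr0 addr0 mulr_ge0// divr_ge0// sqr_ge0.
  have QV : usqr j w <= V by move: wB; rewrite inE.
  have T1 y : T j (w, y) = usum j (w, y) * \1_(A j) (w, y).
    by rewrite /T /= indicE wB mul1r.
  (* As [usum] is centered, the bias is the mean of the removed part, which lives where 2 |u| >
     beta; there |u| <= 2 u^2 / beta. *)
  have IT : `|\int[P]_y T j (w, y)| <= 2 * V / beta.
    have -> : \int[P]_y T j (w, y) = \int[P]_y (T j (w, y) - usum j (w, y)).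
      by rewrite bmeanB ?mean_usum ?subr0.
    have b2 : bdd_mfun (fun y => (2 / beta) * usum j (w, y) ^+ 2).
      by apply: bdd_mfunZ; exact: bdd_mfunX.
    apply: le_trans (le_normr_Rintegral _ _) _ => //.
      by apply: bdd_integrable; exact: bdd_mfunB.
    apply: le_trans (_ : \int[P]_y ((2 / beta) * usum j (w, y) ^+ 2) <= _).
      apply: le_Rintegral => // [||y _].
      - by apply: integrable_norm; apply: bdd_integrable; exact: bdd_mfunB.
      - exact: (bdd_integrable P b2).
      rewrite T1 indicE; case: (boolP (_ \in A j)) => [_|].
        by rewrite mulr1 subrr normr0 mulr_ge0 ?sqr_ge0// divr_ge0// ltW.
      rewrite mulr0 sub0r normrN notin_setE /A /= => /negP; rewrite -ltNge => ub.
      rewrite mulrAC ler_pdivlMr// -(real_normK (num_real (usum j (w, y)))) expr2.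
      by rewrite mulrA mulrC ler_wpM2r// ltW.
    rewrite bmeanZ; last exact: bdd_mfunX.
    have -> : 2 * V / beta = 2 / beta * V by ring.
    by rewrite ler_wpM2l// divr_ge0// ltW.
  have IT2 : \int[P]_y (T j (w, y) ^+ 2) <= V.
    apply: le_trans QV; apply: bmean_le => [| |y]; try exact: bdd_mfunX.
    rewrite T1 exprMn -[leRHS]mulr1 ler_wpM2l ?sqr_ge0// indicE.
  rewrite ler_expR bmeanZ//.
  have -> : \int[P]_y (s / beta * T j (w, y)) ^+ 2 = (beta^-1) ^+ 2 * \int[P]_y (T j (w, y) ^+ 2).
    rewrite -bmeanZ; last exact: bdd_mfunX.
    by apply: eq_Rintegral => y _; rewrite !exprMn s2 mul1r.
  have : s / beta * \int[P]_y T j (w, y) <= 2 * (V / beta ^+ 2).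
    apply: le_trans (ler_norm _) _; rewrite normrM nsb.
    have -> : 2 * (V / beta ^+ 2) = beta^-1 * (2 * V / beta) by field; rewrite gt_eqF.
    by rewrite ler_wpM2l// invr_ge0 ltW.
  have : (beta^-1) ^+ 2 * \int[P]_y (T j (w, y) ^+ 2) <= V / beta ^+ 2.
    by rewrite [leRHS]mulrC -exprVn ler_wpM2l// sqr_ge0.
  lra.
have := hist_tail mZ indZ lawZ x (fun i (_ : (i < n)%N) => bh i) (fun i w _ => hk i w).
apply: with_prob_ge_sub => // w /= H QV ub.
have hE (j : 'I_n) : h j (w, Z j w) = s / beta * usum j (w, Z j w).
  rewrite /h /T /= !indicE.
  have -> : (w : hist Z j) \in B j by rewrite inE; exact: QV.
  have -> : ((w, Z j w) : hist Z j * X) \in A j by rewrite inE; exact: ub.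
  by rewrite mul1r mulr1.
move: H; under eq_bigr do rewrite hE; rewrite -mulr_sumr mulrAC ler_pdivrMr// => /le_trans; apply.
have : n%:R * (4 * (V / beta ^+ 2)) <= 4 * x.
  rewrite mulrCA ler_wpM2l// mulrA ler_pdivrMr ?exprn_gt0//; lra.
nra.
Qed.

Lemma ustat_tail c om n x : 0 < c -> (forall z, 2 * `|g z| <= c) ->
  n%:R * D <= c ^+ 2 -> 0 < om -> 9 * D <= om ^+ 2 -> n%:R * a <= om ^+ 2 -> 1 <= x ->
  with_prob_ge Pr (1 - (3 * n%:R + 2) * expR (- x))
    [set w | `|\sum_(j < n) \sum_(i < j) g (Z i w, Z j w)| <=
             30 * c * x ^+ 2 + 40 * om * x * Num.sqrt (n%:R * x)].
Proof.
move=> c0 gc nD om0 Dom na x1.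
have x0 : 0 < x by exact: lt_le_trans x1.
set sq := Num.sqrt _.
have sq2 : sq ^+ 2 = n%:R * x by rewrite sqr_sqrtr// mulr_ge0// ltW.
have sq0 : 0 <= sq by exact: sqrtr_ge0.
(* The first term is twice the bound of [usum_tail], so that no increment is truncated; the second
   gives n V <= beta^2 x for the variance level [V] of [usqr_tail]. *)
pose beta := 6 * c * x + 8 * om * sq.
have cx : 0 < c * x by exact: mulr_gt0.
have os : 0 <= om * sq by rewrite mulr_ge0// ltW.
have beta0 : 0 < beta by rewrite /beta -!mulrA; lra.
pose V := (8 * x * om) ^+ 2.
have nV : n%:R * V <= beta ^+ 2 * x.
  have -> : n%:R * V = (8 * om * sq) ^+ 2 * x by rewrite !exprMn sq2 /V; ring.
  rewrite ler_wpM2r ?(ltW x0)// lerXn2r ?nnegrE//.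
  - by rewrite -mulrA; lra.
  - exact: ltW.
  - by rewrite /beta -!mulrA; lra.
have E1 := with_prob_ge_ord (expR_ge0 (- x))
  (fun j : 'I_n => usqr_tail om0 Dom (ltnW (ltn_ord j)) na x1).
have E2 := with_prob_ge_ord (mulr_ge0 (ler0n _ 2) (expR_ge0 (- x)))
  (fun j : 'I_n => usum_tail (ltnW (ltn_ord j)) c0 gc nD x1).
have E3 := usum_truncated_le (sqr_ge0 _ : 0 <= V) (normr1 _) beta0 nV.
have E4 := usum_truncated_le (sqr_ge0 _ : 0 <= V) (normrN1 _) beta0 nV.
(* Failures: n for the norms, 2n for the increments, 2 for the two signs of the martingale. *)
have := with_prob_geI (with_prob_geI E1 E2) (with_prob_geI E3 E4).
apply: with_prob_ge_sub; first by lra.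
move=> w /= [[Q U] [U1 U2]].
have U' (j : 'I_n) : 2 * `|usum j (w, Z j w)| <= beta.
  by have := U j; rewrite /beta -!mulrA; lra.
have := U1 Q U'; have := U2 Q U'; rewrite mul1r mulN1r /beta /usum /=.
set S := \sum_(_ < _) _ => H1 H2.
have -> : 30 * c * x ^+ 2 + 40 * om * x * sq = 5 * (6 * c * x + 8 * om * sq) * x by ring.
rewrite ler_norml; lra.
Qed.

End UStatistic.

(** * Hoeffding's decomposition and reduction to degenerate kernels *)

Lemma sum_symmetric (R : comPzRingType) (F : nat -> nat -> R) n :
  (forall i j, F i j = F j i) ->
  \sum_(i < n) \sum_(j < n) F i j =
  2 * (\sum_(j < n) \sum_(i < j) F i j) + \sum_(i < n) F i i.
Proof.
move=> Fs; elim: n => [|n IH]; first by rewrite !big_ord0 mulr0 addr0.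
rewrite big_ord_recr /=.
have -> : \sum_(i < n) \sum_(j < n.+1) F i j =
    \sum_(i < n) \sum_(j < n) F i j + \sum_(i < n) F i n.
  by rewrite -big_split; apply: eq_bigr => i _; rewrite big_ord_recr.
have -> : \sum_(j < n.+1) F n j = \sum_(i < n) F i n + F n n.
  by rewrite big_ord_recr /=; congr (_ + _); apply: eq_bigr => i _; rewrite Fs.
by rewrite IH !big_ord_recr /=; ring.
Qed.

Lemma sum_ord_cst (R : pzRingType) n (c : R) : \sum_(i < n) c = n%:R * c.
Proof. by rewrite sumr_const card_ord mulr_natl. Qed.

Section NonDegenerate.
Context d (Omega : measurableType d) d' (X : measurableType d') (R : realType).
Variables (Pr : probability Omega R) (P : probability X R) (Z : nat -> Omega -> X).

(** The second-order term of Hoeffding's decomposition of a symmetric [f]. *)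
Definition degenerate (f : X * X -> R) (z : X * X) : R :=
  f z - \int[P]_y f (z.1, y) - \int[P]_y f (z.2, y) + \int[P]_x \int[P]_y f (x, y).

(** An algebraic identity valid for arbitrary points [u]. For [Aker] it expands the squared norm of
    the estimator; for the kernel itself, the sum of the estimator over the observations. *)
Lemma sum_degenerate (f : X * X -> R) n (u : nat -> X) :
  (forall x y, f (x, y) = f (y, x)) ->
  \sum_(i < n) \sum_(j < n) f (u i, u j) =
  2 * (\sum_(j < n) \sum_(i < j) degenerate f (u i, u j))
  + \sum_(i < n) f (u i, u i) + 2 * (n%:R - 1) * (\sum_(i < n) \int[P]_y f (u i, y))
  - n%:R * (n%:R - 1) * \int[P]_x \int[P]_y f (x, y).
Proof.
move=> fs.
have Gs i j : degenerate f (u i, u j) = degenerate f (u j, u i).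
  by rewrite /degenerate /= fs; ring.
have := sum_symmetric n Gs; set U := \sum_(j < n) \sum_(i < j) _.
rewrite /degenerate /=; set m := \int[P]_x \int[P]_y f (x, y).
pose f1 x := \int[P]_y f (x, y).
have -> : \sum_(i < n) (f (u i, u i) - \int[P]_y f (u i, y) - \int[P]_y f (u i, y) + m) =
    \sum_(i < n) f (u i, u i) - 2 * \sum_(i < n) f1 (u i) + n%:R * m.
  rewrite big_split /= !sumrB sum_ord_cst /f1; ring.
have -> : \sum_(i < n) \sum_(j < n)
     (f (u i, u j) - \int[P]_y f (u i, y) - \int[P]_y f (u j, y) + m) =
   \sum_(i < n) \sum_(j < n) f (u i, u j) - 2 * n%:R * \sum_(i < n) f1 (u i) + n%:R ^+ 2 * m.
  under eq_bigr do rewrite big_split /= !sumrB !sum_ord_cst.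
  rewrite big_split /= !sumrB !sum_ord_cst -mulr_sumr /f1; ring.
rewrite -/(f1 _) => H.
have -> : \sum_(i < n) \sum_(j < n) f (u i, u j) =
  2 * U + (\sum_(i < n) f (u i, u i) - 2 * \sum_(i < n) f1 (u i) + n%:R * m)
  + 2 * n%:R * \sum_(i < n) f1 (u i) - n%:R ^+ 2 * m by rewrite -H; ring.
by rewrite -/f1; ring.
Qed.

Hypothesis mZ : forall i, measurable_fun setT (Z i).
Hypothesis indZ : independent_family Pr Z.
Hypothesis lawZ : forall i B, measurable B -> Pr (Z i @^-1` B) = P B.

Lemma degenerate_tail (f : X * X -> R) B D a c om n x : bdd_mfun f ->
  (forall x y, f (x, y) = f (y, x)) -> (forall z, `|f z| <= B) ->
  (forall x, \int[P]_y (f (x, y) ^+ 2) <= D) ->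
  \int[P]_x \int[P]_y (f (x, y) ^+ 2) <= a ->
  0 < c -> 8 * B <= c -> n%:R * (4 * D) <= c ^+ 2 ->
  0 < om -> 36 * D <= om ^+ 2 -> n%:R * (4 * a) <= om ^+ 2 -> 1 <= x ->
  with_prob_ge Pr (1 - (3 * n%:R + 2) * expR (- x))
    [set w | `|\sum_(j < n) \sum_(i < j) degenerate f (Z i w, Z j w)| <=
             30 * c * x ^+ 2 + 40 * om * x * Num.sqrt (n%:R * x)].
Proof.
move=> bf fs fB fD fa c0 Bc nD om0 Dom na x1.
pose f1 x := \int[P]_y f (x, y); pose m := \int[P]_x f1 x.
have bf1 : bdd_mfun f1 := bdd_mfun_mean1 P bf.
have bf11 : bdd_mfun (fun z : X * X => f1 z.1) by apply: (bdd_mfun_comp bf1); exact: measurable_fst.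
have bf12 : bdd_mfun (fun z : X * X => f1 z.2) by apply: (bdd_mfun_comp bf1); exact: measurable_snd.
have bs x' : bdd_mfun (fun y => f (x', y)) by exact: bdd_mfun_sec1.
have gE x' y : degenerate f (x', y) = (f (x', y) - f1 y) - (f1 x' - m).
  by rewrite /degenerate /= -/(f1 _) -/(f1 _) -/m; ring.
have bg : bdd_mfun (degenerate f) by rewrite /degenerate; bdd_tac.
have f1B y : `|f1 y| <= B by exact: bmean_norm_le.
have mB : `|m| <= B by exact: bmean_norm_le.
have f1sq : \int[P]_y (f1 y ^+ 2) <= \int[P]_x \int[P]_y (f (x, y) ^+ 2).
  apply: bmean_le => [| |y]; first exact: bdd_mfunX.
    exact: (bdd_mfun_mean1 P (bdd_mfunX 2 bf)).
  exact: bmean_sqr_le.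
have f1D : \int[P]_y (f1 y ^+ 2) <= D.
  apply: le_trans f1sq _; apply: bmean_le_cst => //.
  exact: (bdd_mfun_mean1 P (bdd_mfunX 2 bf)).
have bF2 : bdd_mfun (fun x => \int[P]_y (f (x, y) ^+ 2)) := bdd_mfun_mean1 P (bdd_mfunX 2 bf).
(* For fixed x', [degenerate f] is f(x', .) - f1 minus its mean, and centering lowers the second
   moment. The inequality (u - v)^2 <= 2u^2 + 2v^2 then produces the 4 in front of [D] and [a]. *)
have g2 x' : \int[P]_y (degenerate f (x', y) ^+ 2) <=
    2 * \int[P]_y (f (x', y) ^+ 2) + 2 * \int[P]_y (f1 y ^+ 2).
  have bd : bdd_mfun (fun y => f (x', y) - f1 y) by bdd_tac.
  have dE : \int[P]_y (f (x', y) - f1 y) = f1 x' - m by rewrite bmeanB.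
  apply: le_trans (_ : \int[P]_y (f (x', y) - f1 y) ^+ 2 <= _).
    have E y : degenerate f (x', y) ^+ 2 = (f (x', y) - f1 y) ^+ 2
      - 2 * (f1 x' - m) * (f (x', y) - f1 y) + (f1 x' - m) ^+ 2 by rewrite gE; ring.
    under eq_Rintegral do rewrite E.
    rewrite bmeanD; bdd_tac.
    rewrite bmeanB; bdd_tac.
    by rewrite bmeanZ// dE bmean_cst; have := sqr_ge0 (f1 x' - m); lra.
  have bsx := bs x'.
  rewrite -!bmeanZ -?bmeanD; bdd_tac.
  apply: bmean_le => [| |y]; bdd_tac.
  by have := sqr_ge0 (f (x', y) + f1 y); lra.
have := @ustat_tail _ _ _ _ _ _ P _ mZ indZ lawZ (degenerate f) (4 * D) (4 * a) bg _ _ _ _ c om n x c0 _ nD om0 _ na x1.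
apply.
- by move=> x' y; rewrite /degenerate /= fs; ring.
- move=> x'; have : \int[P]_y ((f (x', y) - f1 y) - (f1 x' - m)) = 0.
    by rewrite !bmeanB ?bmean_cst; bdd_tac => //; rewrite subrr.
  by move=> <-; apply: eq_Rintegral => y _; exact: gE.
- by move=> x'; apply: le_trans (g2 x') _; have := fD x'; lra.
- apply: le_trans (_ : \int[P]_x (2 * \int[P]_y (f (x, y) ^+ 2) + 2 * \int[P]_y (f1 y ^+ 2)) <= _).
    apply: bmean_le => [| |y]; bdd_tac => //.
    exact: (bdd_mfun_mean1 P (bdd_mfunX 2 bg)).
  rewrite bmeanD ?bmeanZ ?bmean_cst; bdd_tac; lra.
- move=> [x' y]; rewrite gE; have := fB (x', y); have := f1B x'; have := f1B y; have := mB.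
  rewrite !ler_norml => ? ? ? ?; suff : `|f (x', y) - f1 y - (f1 x' - m)| <= 4 * B by lra.
  by rewrite ler_norml; lra.
- lra.
Qed.

End NonDegenerate.

(** * Densities and square integrable functions *)

Section Density.
Context d (T : measurableType d) (R : realType).
Variables (mu nu : {measure set T -> \bar R}) (s : T -> R).
Hypothesis ms : measurable_fun setT s.
Hypothesis s0 : forall x, 0 <= s x.
Hypothesis nuE : forall B, measurable B -> nu B = (\int[mu]_(x in B) (s x)%:E)%E.

Import HBNNSimple.

Lemma sfun_integral_density (h : {nnsfun T >-> R}) :
  (\int[nu]_x (h x)%:E = \int[mu]_x (h x * s x)%:E)%E.
Proof.
have hE x : h x = \sum_(y \in range h) y * \1_(h @^-1` [set y]) x by exact: fimfunE.
have mh y : measurable (h @^-1` [set y]) by [].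
transitivity (\int[nu]_x (\sum_(y \in range h) (y * \1_(h @^-1` [set y]) x)%:E))%E.
  by apply: eq_integral => x _; rewrite [in LHS]hE -fsumEFin.
rewrite ge0_integral_fsum//; last 2 first.
  - by move=> y; exact/measurable_EFinP/measurable_funM.
  - by move=> y x _; rewrite nnfun_muleindic_ge0.
transitivity (\int[mu]_x (\sum_(y \in range h) (y * \1_(h @^-1` [set y]) x * s x)%:E))%E; last first.
  apply: eq_integral => x _; rewrite [in RHS]hE EFinM -fsumEFin//.
  rewrite ge0_mule_fsuml; first by apply: eq_fsbigr => y _; rewrite EFinM.
  by move=> y; rewrite nnfun_muleindic_ge0.
rewrite ge0_integral_fsum//; last 2 first.
  - move=> y; apply/measurable_EFinP/measurable_funM => //; exact: measurable_funM.
  - by move=> y x _; rewrite EFinM mule_ge0 ?lee_fin// -lee_fin nnfun_muleindic_ge0.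
apply: eq_fsbigr => y; rewrite inE => -[t _ hty].
have y0 : 0 <= y by rewrite -hty.
under eq_integral do rewrite EFinM.
rewrite ge0_integralZl//; last by apply/measurable_EFinP.
under [in RHS]eq_integral do rewrite -mulrA EFinM.
rewrite ge0_integralZl//; [|by apply/measurable_EFinP; exact: measurable_funM|
  by move=> x _; rewrite lee_fin mulr_ge0].
congr (_ * _)%E; rewrite integral_indic// setIT nuE// integral_mkcond.
by apply: eq_integral => x _; rewrite patchE indicE; case: ifPn; rewrite ?mul1r ?mul0r.
Qed.

Lemma ge0_integral_density (f : T -> \bar R) : measurable_fun setT f ->
  (forall x, (0 <= f x)%E) -> (\int[nu]_x f x = \int[mu]_x (f x * (s x)%:E))%E.
Proof.
move=> mf f0; pose h := nnsfun_approx measurableT mf.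
have fh x : (EFin \o h n) x @[n --> \oo] --> f x by exact: cvg_nnsfun_approx.
transitivity (limn (fun n => \int[nu]_x (h n x)%:E))%E.
  rewrite -monotone_convergence//.
  - by apply: eq_integral => x _; apply/esym/cvg_lim => //; exact: fh.
  - by move=> n; exact/measurable_EFinP.
  - by move=> n x _; rewrite lee_fin.
  - by move=> x _ a b ab; rewrite lee_fin; exact/lefP/nd_nnsfun_approx.
transitivity (limn (fun n => \int[mu]_x ((h n x)%:E * (s x)%:E)))%E.
  by congr (limn _); apply/funext => n; rewrite sfun_integral_density.
rewrite -monotone_convergence//.
- apply: eq_integral => x _; apply/cvg_lim => //; apply: cvgeZr => //; exact: fh.
- by move=> n; apply: emeasurable_funM; exact/measurable_EFinP.
- by move=> n x _; rewrite mule_ge0// lee_fin.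
- by move=> x _ a b ab; rewrite lee_wpmul2r ?lee_fin//; exact/lefP/nd_nnsfun_approx.
Qed.

(** As [s] is nonnegative, multiplying by it commutes with taking positive and negative parts. The
    measure [nu] is generic because the lemma serves both [P], with density [s], and [mu_supp], with
    density an indicator. *)
Lemma integral_density (f : T -> R) : measurable_fun setT f ->
  (\int[nu]_x (f x)%:E = \int[mu]_x (f x * s x)%:E)%E.
Proof.
move=> mf; have mfE : measurable_fun setT (EFin \o f) by exact/measurable_EFinP.
rewrite integralE [RHS]integralE; congr (_ - _)%E.
- rewrite ge0_integral_density//; last exact: measurable_funepos.
  by apply: eq_integral => x _; rewrite !funeposE maxe_pMl ?lee_fin// mul0e EFinM.
- rewrite ge0_integral_density//; last exact: measurable_funeneg.
  by apply: eq_integral => x _; rewrite !funenegE maxe_pMl ?lee_fin// mul0e EFinM mulNe.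
Qed.
End Density.

(** * Inner products of square integrable functions *)

Section SquareIntegrable.
Context d (T : measurableType d) (R : realType).
Variable mu : {measure set T -> \bar R}.
Implicit Types f g h : T -> R.

Definition sqint f : Prop :=
  measurable_fun setT f /\ (\int[mu]_x (f x ^+ 2)%:E < +oo)%E.

Definition dotf f g : R := \int[mu]_x (f x * g x).

Lemma sqint_integrable f : sqint f -> mu.-integrable setT (EFin \o (fun x => f x ^+ 2)).
Proof.
move=> [mf fi]; apply/integrableP; split.
  by apply/measurable_EFinP; exact: measurable_funX.
by under eq_integral => x _ do rewrite /= ger0_norm ?sqr_ge0//.
Qed.

Lemma Lnorm2E f :
  ('N[mu]_2%:E[EFin \o f] `^ 2 = \int[mu]_x (f x ^+ 2)%:E)%E.
Proof.
rewrite poweR_Lnorm//; apply: eq_integral => x _ /=.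
by rewrite powR_mulrn// real_normK// num_real.
Qed.

Lemma in_L2P f : in_L2 mu f <-> sqint f.
Proof.
split=> -[mf fi]; split=> //.
  rewrite -Lnorm2E; exact: poweR_lty.
by apply: (@lty_poweRy _ _ 2) => //; rewrite Lnorm2E.
Qed.

Lemma l2norm_sqr f : sqint f -> l2norm mu f ^+ 2 = dotf f f.
Proof.
move=> fi; have [_ nf] := (in_L2P f).2 fi.
have nfin : 'N[mu]_2%:E[EFin \o f]%E \is a fin_num by rewrite ge0_fin_numE// Lnorm_ge0.
rewrite /dotf /Rintegral.
under eq_integral do rewrite -expr2.
rewrite -Lnorm2E -(fineK nfin) poweR_EFin /=.
by rewrite powR_mulrn// fine_ge0// Lnorm_ge0.
Qed.

Lemma l2norm_ge0 f : 0 <= l2norm mu f.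
Proof. by rewrite /l2norm fine_ge0// Lnorm_ge0. Qed.

Lemma integrable_dotf f g : sqint f -> sqint g ->
  mu.-integrable setT (EFin \o (fun x => f x * g x)).
Proof.
move=> fi gi; have [mf _] := fi; have [mg _] := gi.
have := integrableD measurableT (sqint_integrable fi) (sqint_integrable gi).
apply: le_integrable => //; first by apply/measurable_EFinP; exact: measurable_funM.
move=> x _ /=; rewrite lee_fin normrM [leRHS]ger0_norm ?addr_ge0 ?sqr_ge0//.
rewrite -(real_normK (num_real (f x))) -(real_normK (num_real (g x))).
have := sqr_ge0 (`|f x| - `|g x|); have := sqr_ge0 `|f x|; have := sqr_ge0 `|g x|; nra.
Qed.

Lemma EFin_dotf f : sqint f -> (dotf f f)%:E = (\int[mu]_x (f x ^+ 2)%:E)%E.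
Proof.
move=> fi; rewrite /dotf /Rintegral fineK; last first.
  by apply: integrable_fin_num => //; exact: (integrable_dotf fi fi).
by apply: eq_integral => x _; rewrite expr2.
Qed.

Lemma dotfC f g : dotf f g = dotf g f.
Proof. by apply: eq_Rintegral => x _; rewrite mulrC. Qed.

Lemma sqintZ c f : sqint f -> sqint (fun x => c * f x).
Proof.
move=> fi; have [mf _] := fi; split; first exact: measurable_funM.
have := integrable_lty measurableT (integrableZl measurableT (c ^+ 2) (sqint_integrable fi)).
by under eq_integral do rewrite /= -EFinM -exprMn.
Qed.

Lemma sqintD f g : sqint f -> sqint g -> sqint (fun x => f x + g x).
Proof.
move=> fi gi; have [mf _] := fi; have [mg _] := gi.
split; first exact: measurable_funD.
have i1 := integrableD measurableT (sqint_integrable fi) (sqint_integrable gi).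
have i2 := integrableD measurableT i1 (integrableZl measurableT 2 (integrable_dotf fi gi)).
have := integrable_lty measurableT i2; apply: le_lt_trans.
rewrite le_eqVlt; apply/orP; left; apply/eqP; apply: eq_integral => x _ /=.
by rewrite -EFinM -!EFinD; congr (_%:E); ring.
Qed.

Lemma sqintB f g : sqint f -> sqint g -> sqint (fun x => f x - g x).
Proof.
move=> fi gi; have := sqintD fi (sqintZ (-1) gi).
by under [X in sqint X]eq_fun do rewrite mulN1r.
Qed.

Lemma sqint0 : sqint (fun=> 0).
Proof.
split; first exact: measurable_cst.
by under eq_integral do rewrite expr0n; rewrite integral0 ltry.
Qed.

Lemma sqint_sum I (r : seq I) (f : I -> T -> R) :
  (forall i, sqint (f i)) -> sqint (fun x => \sum_(i <- r) f i x).
Proof.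
move=> fi; elim: r => [|i r IH].
  have -> : (fun x => \sum_(i <- [::]) f i x) = (fun=> 0).
    by apply/funext => x; rewrite big_nil.
  exact: sqint0.
have -> : (fun x => \sum_(j <- i :: r) f j x) = (fun x => f i x + \sum_(j <- r) f j x).
  by apply/funext => x; rewrite big_cons.
exact: sqintD.
Qed.

Lemma dotfDl f g h : sqint f -> sqint g -> sqint h ->
  dotf (fun x => f x + g x) h = dotf f h + dotf g h.
Proof.
move=> fi gi hi; rewrite /dotf -RintegralD//; try exact: integrable_dotf.
by apply: eq_Rintegral => x _; rewrite mulrDl.
Qed.

Lemma dotfZl c f h : sqint f -> sqint h -> dotf (fun x => c * f x) h = c * dotf f h.
Proof.
move=> fi hi; rewrite /dotf -RintegralZl//; last exact: integrable_dotf.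
by apply: eq_Rintegral => x _; rewrite mulrA.
Qed.

Lemma dotfBl f g h : sqint f -> sqint g -> sqint h ->
  dotf (fun x => f x - g x) h = dotf f h - dotf g h.
Proof.
move=> fi gi hi; rewrite /dotf -RintegralB//; try exact: integrable_dotf.
by apply: eq_Rintegral => x _; rewrite mulrBl.
Qed.

Lemma dotfBr f g h : sqint f -> sqint g -> sqint h ->
  dotf h (fun x => f x - g x) = dotf h f - dotf h g.
Proof. by move=> fi gi hi; rewrite dotfC dotfBl// [dotf f h]dotfC [dotf g h]dotfC. Qed.

Lemma dotf_suml I (r : seq I) (f : I -> T -> R) h : (forall i, sqint (f i)) -> sqint h ->
  dotf (fun x => \sum_(i <- r) f i x) h = \sum_(i <- r) dotf (f i) h.
Proof.
move=> fi hi; elim: r => [|i r IH].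
  rewrite big_nil /dotf /Rintegral; under eq_integral do rewrite big_nil mul0r.
  by rewrite integral0.
rewrite big_cons -IH -dotfDl//; last exact: sqint_sum.
by apply: eq_Rintegral => x _; rewrite big_cons.
Qed.

Lemma dotf_ge0 f : 0 <= dotf f f.
Proof. by apply: Rintegral_ge0 => x _; rewrite -expr2 sqr_ge0. Qed.

Lemma dotf_sqrB f g : sqint f -> sqint g ->
  dotf (fun x => f x - g x) (fun x => f x - g x) = dotf f f - 2 * dotf f g + dotf g g.
Proof.
move=> fi gi; have bi := sqintB fi gi.
by rewrite dotfBl// !dotfBr// [dotf g f]dotfC; ring.
Qed.

Lemma dotf_cauchy f g : sqint f -> sqint g -> dotf f g ^+ 2 <= dotf f f * dotf g g.
Proof.
move=> fi gi; have bf := dotf_ge0 f; have bg := dotf_ge0 g.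
set a := dotf f g; set b := dotf f f in bf *; set c := dotf g g in bg *.
have H t u : 0 <= t ^+ 2 * b - 2 * (t * u) * a + u ^+ 2 * c.
  have tf := sqintZ t fi; have ug := sqintZ u gi.
  have := dotf_ge0 (fun x => t * f x - u * g x).
  rewrite dotf_sqrB// !dotfZl// [dotf f (fun x => t * f x)]dotfC.
  rewrite [dotf f (fun x => u * g x)]dotfC [dotf g (fun x => u * g x)]dotfC.
  by rewrite !dotfZl// [dotf g f]dotfC -/a -/b -/c; lra.
have [c00|c1] := eqVneq c 0.
  have [->|a0] := eqVneq a 0; first by rewrite expr0n/= mulr_ge0.
  have := H 1 ((b + 1) / a); rewrite c00 !mul1r mulr0 addr0 -mulrA.
  by rewrite mulfVK//; lra.
have cp : 0 < c by rewrite lt_neqAle eq_sym c1.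
have := H c a; nra.
Qed.

Lemma dotf_norm_le f g p q : sqint f -> sqint g -> 0 <= p -> 0 <= q ->
  dotf f f <= p ^+ 2 -> dotf g g <= q ^+ 2 -> `|dotf f g| <= p * q.
Proof.
move=> fi gi p0 q0 fp gq.
rewrite -(@ler_pXn2r _ 2) ?nnegrE ?mulr_ge0// real_normK ?num_real//.
apply: le_trans (dotf_cauchy fi gi) _; rewrite exprMn ler_pM ?dotf_ge0//.
Qed.

End SquareIntegrable.

(* [mu] is not assumed sigma-finite, but its restriction to the support of a
   square integrable function is, which makes Fubini's theorem available. *)
Section Support.
Context d (X : measurableType d) (R : realType).
Variables (mu : {measure set X -> \bar R}) (a : X -> R).
Hypothesis ai : sqint mu a.

Definition suppf : set X := [set x | a x != 0].

Lemma measurable_suppf : measurable suppf.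
Proof.
have [ma _] := ai; rewrite -[X in measurable X]setTI.
have -> : suppf = a @^-1` (~` [set 0]).
  by apply/seteqP; split => x /=; move/eqP.
by apply: ma => //; apply: measurableC.
Qed.

Definition mu_supp := mrestr mu measurable_suppf.

(** Chebyshev's inequality bounds the measure of the set where |a| >= 1/(m + 1). The complement of
    the support is added to each of these sets: it completes the cover and has [mu_supp]-measure
    zero. *)
Lemma mu_supp_sigma_finite : sigma_finite setT mu_supp.
Proof.
have [ma _] := ai.
pose F (m : nat) := ~` suppf `|` [set x | m.+1%:R^-1 <= `|a x|].
have mE (m : nat) : measurable [set x | m.+1%:R^-1 <= `|a x|].
  rewrite -[X in measurable X]setTI.
  have -> : [set x | m.+1%:R^-1 <= `|a x|] = (fun x => `|a x|) @^-1` `[m.+1%:R^-1, +oo[.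
    by apply/seteqP; split => w /=; rewrite in_itv/= andbT.
  by apply: measurableT_comp.
have mF m : measurable (F m).
  by apply: measurableU => //; apply: measurableC; exact: measurable_suppf.
exists F.
  apply/seteqP; split => // x _.
  have [ax|ax] := eqVneq (a x) 0; first by exists 0%N => //; left; rewrite /suppf /= ax eqxx.
  exists (Num.truncn `|a x|^-1) => //; right => /=.
  rewrite invf_ple ?posrE ?normr_gt0//.
  by rewrite ltW// truncnS_gt.
move=> m; split => //; rewrite /mu_supp /mrestr.
have sub : F m `&` suppf `<=` [set x | m.+1%:R^-1 <= `|a x|] by move=> x [[//|//] ?].
apply: (@le_lt_trans _ _ (mu [set x | m.+1%:R^-1 <= `|a x|])).
  by apply: le_measure => //; rewrite inE//; apply: measurableI => //; exact: measurable_suppf.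
set E := [set x | _]; have mEm : measurable E by exact: mE.
have m0 : (0 : R) < m.+1%:R^-1 ^+ 2 by rewrite exprn_gt0// invr_gt0.
have [_ fi] := ai.
have : (((m.+1%:R^-1 ^+ 2)%:E * mu E) <= \int[mu]_x (a x ^+ 2)%:E)%E.
  have -> : mu E = (\int[mu]_x (\1_E x)%:E)%E by rewrite integral_indic// setIT.
  rewrite -ge0_integralZl//; last by apply/measurable_EFinP; exact: measurable_indic.
  apply: ge0_le_integral; first exact: measurableT.
  - by move=> x _; rewrite mule_ge0// lee_fin// ltW.
  - by apply: measurable_funeM; apply/measurable_EFinP; exact: measurable_indic.
  - by apply/measurable_EFinP; exact: measurable_funX.
  - move=> x _; rewrite -EFinM lee_fin indicE.
    case: (boolP (x \in E)) => [|_]; last by rewrite mulr0 sqr_ge0.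
    rewrite inE /E /= mulr1 => H.
    rewrite -(real_normK (num_real (a x))) lerXn2r ?nnegrE//.
have [//|] := ltP (mu E) +oo%E.
rewrite leye_eq => /eqP ->; rewrite gt0_muley ?lte_fin// => H.
by move: (le_lt_trans H fi); rewrite ltxx.
Qed.

HB.instance Definition _ := Measure.on mu_supp.
HB.instance Definition _ := Measure_isSigmaFinite.Build _ _ _ mu_supp mu_supp_sigma_finite.

(** [mu_supp] has the indicator of the support as density with respect to [mu], and [a] vanishes
    elsewhere. *)
Lemma integral_mu_supp (f : X -> R) : measurable_fun setT f ->
  (\int[mu_supp]_x (a x * f x)%:E = \int[mu]_x (a x * f x)%:E)%E.
Proof.
move=> mf; have [ma _] := ai.
rewrite (@integral_density _ _ _ mu _ (\1_suppf)).
- apply: eq_integral => x _; congr (_%:E).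
  rewrite indicE; case: (boolP (x \in suppf)) => [_|]; first by rewrite mulr1.
  by rewrite notin_setE /suppf /= => /negP/negPn/eqP ->; rewrite !mul0r.
- by apply: measurable_indic; exact: measurable_suppf.
- by [].
- move=> B mB; rewrite integral_indic//; last exact: measurable_suppf.
  by rewrite setIC.
- exact: measurable_funM.
Qed.

Lemma ge0_integral_mu_supp_le (f : X -> R) : measurable_fun setT f -> (forall x, 0 <= f x) ->
  (\int[mu_supp]_x (f x)%:E <= \int[mu]_x (f x)%:E)%E.
Proof.
move=> mf f0; rewrite [leLHS](@integral_density _ _ _ mu _ (\1_suppf)) => //.
- apply: ge0_le_integral; first exact: measurableT.
  + by move=> x _; rewrite lee_fin mulr_ge0.
  + apply/measurable_EFinP; apply: measurable_funM => //.
    by apply: measurable_indic; exact: measurable_suppf.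
  + exact/measurable_EFinP.
  + by move=> x _; rewrite lee_fin ler_piMr.
- by apply: measurable_indic; exact: measurable_suppf.
- move=> B mB; rewrite integral_indic//; last exact: measurable_suppf.
  by rewrite setIC.
Qed.

End Support.

(** * Kernels: smoothing, A_k and Theta_k *)

Section Kernel.
Context d (X : measurableType d) (R : realType).
Variables (mu : {measure set X -> \bar R}) (P : probability X R) (s : X -> R) (S : R).
Hypothesis ms : measurable_fun setT s.
Hypothesis s0 : forall x, 0 <= s x.
Hypothesis sS : forall x, s x <= S.
Hypothesis PE : forall B, measurable B -> P B = (\int[mu]_(x in B) (s x)%:E)%E.

Lemma Pint_mean (f : X -> R) : measurable_fun setT f -> Pint mu s f = \int[P]_x f x.
Proof. by move=> mf; rewrite /Rintegral (integral_density ms s0 PE mf). Qed.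

Lemma mean_sqr_le (f : X -> R) : sqint mu f -> bdd_mfun f ->
  \int[P]_x (f x ^+ 2) <= S * dotf mu f f.
Proof.
move=> fi [mf _]; rewrite -Pint_mean; last exact: measurable_funX.
have ii := sqint_integrable fi.
rewrite /Pint /dotf -RintegralZl//.
have S0 : 0 <= S := le_trans (s0 point) (sS point).
apply: le_Rintegral => // [||x _].
- have := integrableZl measurableT S ii; apply: le_integrable => //.
    by apply/measurable_EFinP; apply: measurable_funM => //; exact: measurable_funX.
  move=> x _; rewrite /= lee_fin (ger0_norm (mulr_ge0 (sqr_ge0 (f x)) (s0 x))) (ger0_norm (mulr_ge0 S0 (sqr_ge0 (f x)))).
  by rewrite mulrC ler_wpM2r ?sqr_ge0.
- exact: (integrableZl measurableT S (integrable_dotf fi fi)).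
- by rewrite -expr2 mulrC ler_wpM2r ?sqr_ge0.
Qed.

Lemma sqint_density : sqint mu s.
Proof.
split=> //.
have S0 : 0 <= S := le_trans (s0 point) (sS point).
have s1 : (\int[mu]_x (s x)%:E = 1)%E by rewrite -PE// probability_setT.
apply: (@le_lt_trans _ _ (\int[mu]_x (S%:E * (s x)%:E))%E).
  apply: ge0_le_integral; first exact: measurableT.
  - by move=> x _; rewrite lee_fin sqr_ge0.
  - by apply/measurable_EFinP; exact: measurable_funX.
  - by apply: measurable_funeM; exact/measurable_EFinP.
  - by move=> x _; rewrite -EFinM lee_fin expr2 ler_wpM2r.
rewrite ge0_integralZl//; last 2 first.
- exact/measurable_EFinP.
- by move=> x _; rewrite lee_fin.
by rewrite s1 mule1 ltry.
Qed.

Variables (k : X * X -> R) (C : R).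
Hypothesis mk : measurable_fun setT k.
Hypothesis ksym : forall x y, k (x, y) = k (y, x).
Hypothesis kC2 : forall x, (\int[mu]_y (k (x, y) ^+ 2)%:E <= C%:E)%E.
Hypothesis kC : forall z, `|k z| <= C.

Lemma bdd_kernel : bdd_mfun k.
Proof. by split => //; exists C. Qed.

Lemma measurable_krow x : measurable_fun setT (fun y => k (x, y)).
Proof. by case: (bdd_mfun_sec1 x bdd_kernel). Qed.

Lemma sqint_krow x : sqint mu (fun y => k (x, y)).
Proof. by split; [exact: measurable_krow|exact: le_lt_trans (kC2 x) (ltry _)]. Qed.

Lemma AkerE x y : Aker mu k (x, y) = dotf mu (fun z => k (x, z)) (fun z => k (y, z)).
Proof. by apply: eq_Rintegral => z _ /=; rewrite [k (z, y)]ksym. Qed.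

Lemma ThetaE x : Theta mu k x = dotf mu (fun z => k (x, z)) (fun z => k (x, z)).
Proof. exact: AkerE. Qed.

Lemma Aker_sym x y : Aker mu k (x, y) = Aker mu k (y, x).
Proof. by rewrite !AkerE dotfC. Qed.

Lemma Theta_ge0 x : 0 <= Theta mu k x.
Proof. by rewrite ThetaE dotf_ge0. Qed.

Lemma kernel_bound_ge0 : 0 <= C.
Proof. exact: le_trans (normr_ge0 _) (kC point). Qed.

Lemma Theta_le x : Theta mu k x <= C.
Proof.
by rewrite ThetaE -lee_fin EFin_dotf ?kC2//; exact: sqint_krow.
Qed.

Lemma Aker_le z : `|Aker mu k z| <= C.
Proof.
case: z => x y; rewrite AkerE.
have C0 := kernel_bound_ge0.
have C2 : Num.sqrt C ^+ 2 = C by rewrite sqr_sqrtr.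
rewrite -[leRHS]C2 expr2.
apply: (dotf_norm_le (sqint_krow x) (sqint_krow y)); rewrite ?sqrtr_ge0// C2 -ThetaE.
- exact: Theta_le.
- exact: Theta_le.
Qed.

Lemma smoothE x : smooth mu s k x = \int[P]_y k (x, y).
Proof.
rewrite -Pint_mean; last exact: measurable_krow.
by apply: eq_Rintegral => y _; rewrite ksym.
Qed.

Lemma bdd_smooth : bdd_mfun (smooth mu s k).
Proof.
have -> : smooth mu s k = (fun x => \int[P]_y k (x, y)) by apply/funext => x; exact: smoothE.
exact: bdd_mfun_mean1 bdd_kernel.
Qed.

Lemma smooth_dotf x : smooth mu s k x = dotf mu s (fun y => k (x, y)).
Proof. by apply: eq_Rintegral => y _; rewrite ksym mulrC. Qed.

Section Fubini.
Variable a : X -> R.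
Hypothesis ai : sqint mu a.

Let F (z : X * X) : \bar R := (a z.1 * k (z.2, z.1))%:E.

Let mF : measurable_fun setT F.
Proof.
have [ma _] := ai; apply/measurable_EFinP; apply: measurable_funM.
  exact: measurableT_comp ma measurable_fst.
by have [] := bdd_mfun_swap bdd_kernel.
Qed.

Let A := fine (\int[mu]_x (a x ^+ 2)%:E)%E.

(** The inequality |a k| <= a^2 + k^2 bounds the inner integral uniformly in [x]; as [P] is a
    probability, this is the integrability that Fubini's theorem requires. *)
Let mean_F x : (\int[mu_supp ai]_z `|F (z, x)| <= (A + C)%:E)%E.
Proof.
have [ma fa] := ai; have mkx := measurable_krow x.
apply: le_trans (ge0_integral_mu_supp_le ai (f := fun z => `|a z * k (x, z)|) _ _) _ => //.
  by apply: measurableT_comp => //; exact: measurable_funM.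
apply: (@le_trans _ _ (\int[mu]_z ((a z ^+ 2)%:E + (k (x, z) ^+ 2)%:E))%E).
  apply: ge0_le_integral; first exact: measurableT.
  - by move=> z _; rewrite lee_fin.
  - by apply/measurable_EFinP; apply: measurableT_comp => //; exact: measurable_funM.
  - by apply: emeasurable_funD; apply/measurable_EFinP; exact: measurable_funX.
  - move=> z _; rewrite -EFinD lee_fin normrM.
    rewrite -(real_normK (num_real (a z))) -(real_normK (num_real (k (x, z)))).
    have := sqr_ge0 (`|a z| - `|k (x, z)|).
    have := sqr_ge0 `|a z|; have := sqr_ge0 `|k (x, z)|; nra.
rewrite ge0_integralD//.
- rewrite EFinD leeD//.
  by rewrite /A fineK// ge0_fin_numE// integral_ge0// => z _; rewrite lee_fin sqr_ge0.
- by move=> z _; rewrite lee_fin sqr_ge0.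
- by apply/measurable_EFinP; exact: measurable_funX.
- by move=> z _; rewrite lee_fin sqr_ge0.
- by apply/measurable_EFinP; exact: measurable_funX.
Qed.

Let integrable_F : (mu_supp ai \x P)%E.-integrable setT F.
Proof.
apply/(integrable21ltyP _ _ mF).
apply: (@le_lt_trans _ _ (\int[P]_x (cst (A + C)%:E x))%E).
  apply: ge0_le_integral; first exact: measurableT.
  - by move=> x _; exact: integral_ge0.
  - apply: (measurable_fun_fubini_tonelli_G (m1 := mu_supp ai) (abse \o F)) => //=.
    exact: measurableT_comp.
  - exact: measurable_cst.
  - by move=> x _; exact: mean_F.
by rewrite integral_cst//= (@probability_setT _ _ _ P) mule1 ltry.
Qed.

Let innerE x : (\int[mu_supp ai]_z F (z, x) = (dotf mu a (fun z => k (x, z)))%:E)%E.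
Proof.
rewrite /F /= integral_mu_supp; last exact: measurable_krow.
rewrite /dotf /Rintegral fineK// integrable_fin_num//.
exact: (integrable_dotf ai (sqint_krow x)).
Qed.

(** Measurability in [x] comes from Fubini's theorem for [mu_supp] and [P]; passing to [mu_supp]
    leaves the integral unchanged because of the factor [a]. *)
Lemma bdd_dotf_krow : bdd_mfun (fun x => dotf mu a (fun z => k (x, z))).
Proof.
split.
  apply/measurable_EFinP; have := measurable_fubini_G integrable_F.
  by apply: eq_measurable_fun => x _; rewrite /fubini_G innerE.
exists (A + C) => x; rewrite -lee_fin; apply: le_trans (mean_F x).
rewrite -abse_EFin -innerE; apply: le_abse_integral => //.
have [ma _] := ai; apply/measurable_EFinP; apply: measurable_funM => //=.
exact: measurable_krow.
Qed.

(** s_k is the [P]-mean of the rows of the kernel, and the mean is taken out of the inner product.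
    With a row as [a] this computes the mean of A_k, with s_k the double mean ||s_k||^2, with the
    bias the mean of [bias_dot]. *)
Lemma dotf_smooth : dotf mu a (smooth mu s k) = \int[P]_x dotf mu a (fun z => k (x, z)).
Proof.
have FE := Fubini integrable_F.
rewrite [RHS]/Rintegral; under eq_integral do rewrite -innerE.
rewrite -FE /dotf /Rintegral; congr fine.
rewrite -(integral_mu_supp ai); last by case: bdd_smooth.
apply: eq_integral => z _; rewrite /F /=.
rewrite smoothE -(bmeanZ _ _ (bdd_mfun_sec1 z bdd_kernel)) EFin_bmean.
  by apply: eq_integral => x _; rewrite ksym.
by apply: bdd_mfunZ; exact: (bdd_mfun_sec1 z bdd_kernel).
Qed.

End Fubini.

Hypothesis mA : measurable_fun setT (Aker mu k).
Hypothesis smi : sqint mu (smooth mu s k).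

Lemma bdd_Aker : bdd_mfun (Aker mu k).
Proof. by split => //; exists C; exact: Aker_le. Qed.

Lemma bdd_Theta : bdd_mfun (Theta mu k).
Proof. by apply: (bdd_mfun_comp bdd_Aker); exact: measurable_fun_pair. Qed.

Lemma bdd_chi : bdd_mfun (chi k).
Proof. by apply: (bdd_mfun_comp bdd_kernel); exact: measurable_fun_pair. Qed.

Lemma mean_Aker x : \int[P]_y Aker mu k (x, y) = dotf mu (smooth mu s k) (fun z => k (x, z)).
Proof.
rewrite dotfC (dotf_smooth (sqint_krow x)).
by apply: eq_Rintegral => y _; rewrite AkerE.
Qed.

Lemma mean_mean_Aker : \int[P]_x \int[P]_y Aker mu k (x, y) = dotf mu (smooth mu s k) (smooth mu s k).
Proof.
rewrite (dotf_smooth smi); apply: eq_Rintegral => x _; exact: mean_Aker.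
Qed.

Lemma mean_krow_sqr x : \int[P]_y (k (x, y) ^+ 2) <= S * Theta mu k x.
Proof. rewrite ThetaE; apply: mean_sqr_le; [exact: sqint_krow|exact: (bdd_mfun_sec1 x bdd_kernel)]. Qed.

Lemma mean_mean_kernel_sqr : \int[P]_x \int[P]_y (k (x, y) ^+ 2) <= S * \int[P]_x Theta mu k x.
Proof.
rewrite -bmeanZ; last exact: bdd_Theta.
apply: bmean_le => [| |x]; last exact: mean_krow_sqr.
- exact: (bdd_mfun_mean1 P (bdd_mfunX 2 bdd_kernel)).
- exact/bdd_mfunZ/bdd_Theta.
Qed.

End Kernel.

(** * Deviations for a kernel *)

Lemma amgm_weighted (R : realFieldType) (t p q : R) : 0 < t ->
  2 * (p * q) <= t * p ^+ 2 + q ^+ 2 / t.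
Proof.
move=> t0; rewrite -(ler_pM2l t0) mulrDr.
have -> : t * (q ^+ 2 / t) = q ^+ 2 by rewrite mulrC divfK// gt_eqF.
by have := sqr_ge0 (t * p - q); lra.
Qed.

(* [t] is the parameter traded off in [amgm_weighted]; the constant is merely large enough to
   absorb the numerical factors of all deviation bounds below. *)
Definition dev_err (R : realType) (Ups L t : R) : R := 330 * 330 * Ups * L ^+ 3 / t ^+ 3.

(** Every remainder below has the form a Ups L^i / t^j with i, j <= 3; L >= 1 and t <= 1 place all
    of them under one envelope, so that only the numerical factors [a] have to be added. *)
Lemma dev_err_ge (R : realType) (Ups L t a : R) i j : 1 <= Ups -> 1 <= L -> 0 < t <= 1 ->
  (i <= 3)%N -> (j <= 3)%N -> 0 <= a ->
  a * Ups * L ^+ i / t ^+ j <= a * (dev_err Ups L t / (330 * 330)).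
Proof.
move=> U1 L1 /andP[t0 t1] i3 j3 a0.
have -> : dev_err Ups L t / (330 * 330) = Ups * (L ^+ 3 / t ^+ 3).
  by rewrite /dev_err; field; rewrite gt_eqF.
have U0 : 0 <= Ups by exact: le_trans U1.
have -> : a * Ups * L ^+ i / t ^+ j = a * (Ups * (L ^+ i / t ^+ j)) by rewrite !mulrA.
rewrite !ler_wpM2l// ler_pM ?invr_ge0 ?exprn_ge0 ?(ltW t0)//.
- exact: le_trans L1.
- exact: ler_weXn2l.
- by rewrite lef_pV2 ?posrE ?exprn_gt0// ler_wiXn2l// ltW.
Qed.

Lemma dev_err_ge0 (R : realType) (Ups L t : R) : 0 <= Ups -> 0 <= L -> 0 < t ->
  0 <= dev_err Ups L t.
Proof.
move=> U0 L0 t0; apply: divr_ge0; last exact/exprn_ge0/ltW.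
apply: mulr_ge0; last exact: exprn_ge0.
exact: (mulr_ge0 (mulr_ge0 (ler0n _ 330) (ler0n _ 330)) U0).
Qed.

Section Deviation.
Context d (Omega : measurableType d) d' (X : measurableType d') (R : realType).
Variables (Pr : probability Omega R) (P : probability X R) (Z : nat -> Omega -> X).
Hypothesis mZ : forall i, measurable_fun setT (Z i).
Hypothesis indZ : independent_family Pr Z.
Hypothesis lawZ : forall i B, measurable B -> Pr (Z i @^-1` B) = P B.

Lemma bernstein_mean (f : X -> R) B q x n : bdd_mfun f -> 0 < B -> (forall y, `|f y| <= B) ->
  0 <= q -> 0 < x -> n%:R * \int[P]_y (f y ^+ 2) * x <= q ^+ 2 ->
  with_prob_ge Pr (1 - 2 * expR (- x))
    [set w | `|\sum_(i < n) f (Z i w) - n%:R * \int[P]_y f y| <= 12 * B * x + 3 * q].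
Proof.
move=> bf B0 fB q0 x0 nq.
set m := \int[P]_y f y.
have mB : `|m| <= B by exact: bmean_norm_le.
have bf2 := bdd_mfunX 2 bf.
(* The sum of the two demands of Bernstein's inequality: 4B dominates 2 |f - m|, and q/x answers the
   variance condition. *)
pose c := 4 * B + q / x.
have qx : 0 <= q / x by rewrite divr_ge0// ltW.
have c0 : 0 < c by rewrite /c; lra.
have b0 : bdd_mfun (fun y => f y - m) by bdd_tac.
have H1 : \int[P]_y (f y - m) = 0 by rewrite bmeanB ?bmean_cst ?subrr; bdd_tac.
have H2 y : 2 * `|f y - m| <= c.
  by have := ler_normB (f y) m; have := fB y; rewrite /c; lra.
have H3 : n%:R * \int[P]_y ((f y - m) ^+ 2) <= c ^+ 2 * x.
  have : \int[P]_y ((f y - m) ^+ 2) <= \int[P]_y (f y ^+ 2).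
    have E y : (f y - m) ^+ 2 = f y ^+ 2 - 2 * m * f y + m ^+ 2 by ring.
    under eq_Rintegral do rewrite E.
    rewrite bmeanD; bdd_tac; rewrite bmeanB; bdd_tac.
    by rewrite bmeanZ// bmean_cst -/m; have := sqr_ge0 m; lra.
  move=> H; have := ler_wpM2l (ler0n _ n) H => {}H; apply: le_trans H _.
  apply: le_trans (_ : (q / x) ^+ 2 * x <= _).
    rewrite exprMn exprVn expr2 [x ^+ 2]expr2 invfM !mulrA mulfVK ?gt_eqF//.
    by rewrite ler_pdivlMr// -expr2.
  rewrite ler_wpM2r ?(ltW x0)// lerXn2r ?nnegrE//; first exact: ltW.
  by rewrite /c; lra.
have := bernstein_abs mZ indZ lawZ b0 H1 c0 H2 H3.
apply: with_prob_ge_sub => // w /=; rewrite sumrB sum_ord_cst.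
have -> // : 3 * c * x = 12 * B * x + 3 * q.
by rewrite /c mulrDr mulrDl !mulrA mulfVK ?gt_eqF//; ring.
Qed.

Variables (n : nat) (Ups L V : R).
Hypothesis n0 : (0 < n)%N.
Hypothesis U1 : 1 <= Ups.
Hypothesis L1 : 1 <= L.
Hypothesis V0 : 0 <= V.

Let N0 : (0 : R) < n%:R. Proof. by rewrite ltr0n. Qed.
Let U0 : 0 <= Ups. Proof. exact: le_trans U1. Qed.
Let L0 : 0 <= L. Proof. exact: le_trans L1. Qed.

Lemma sum_deviation (f : X -> R) : bdd_mfun f -> (forall y, `|f y| <= Ups * n%:R) ->
  \int[P]_y (f y ^+ 2) <= Ups * n%:R * V ->
  with_prob_ge Pr (1 - 2 * expR (- (4 * L)))
    [set w | forall t, 0 < t <= 1 ->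
      `|\sum_(i < n) f (Z i w) - n%:R * \int[P]_y f y| <= n%:R * (t * V + dev_err Ups L t)].
Proof.
move=> bf fB fV; have ? := N0; have ? := U0; have ? := L0; have ? := U1; have ? := L1; have ? := V0.
set sV := Num.sqrt V; set sU := Num.sqrt (Ups * L).
have sV2 : sV ^+ 2 = V by rewrite sqr_sqrtr.
have sU2 : sU ^+ 2 = Ups * L by rewrite sqr_sqrtr// mulr_ge0.
have sV0 : 0 <= sV by exact: sqrtr_ge0.
have sU0 : 0 <= sU by exact: sqrtr_ge0.
have := @bernstein_mean f (Ups * n%:R) (2 * (n%:R * (sV * sU))) (4 * L) n bf.
move=> /(_ _ fB _ _ _).
have UN : 0 < Ups * n%:R by rewrite mulr_gt0//; lra.
have q0 : 0 <= 2 * (n%:R * (sV * sU)) by rewrite !mulr_ge0// ltW.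
have x0 : 0 < 4 * L by lra.
move=> /(_ UN q0 x0).
have nq : n%:R * \int[P]_y f y ^+ 2 * (4 * L) <= (2 * (n%:R * (sV * sU))) ^+ 2.
  have -> : (2 * (n%:R * (sV * sU))) ^+ 2 = n%:R * (Ups * n%:R * V) * (4 * L).
    by rewrite !exprMn sV2 sU2; ring.
  by rewrite ler_wpM2r ?(ltW x0)// ler_wpM2l// ltW.
(* The event obtained so far does not involve [t], which enters only through the weighted
   arithmetic-geometric inequality: one event serves all [t] simultaneously. *)
move=> /(_ nq); apply: with_prob_ge_sub => // w /= H t /andP[t0 t1].
apply: le_trans H _.
have tt : 0 < t <= 1 by rewrite t0.
have H1 := amgm_weighted sV (3 * sU) t0.
have H2 := @dev_err_ge R Ups L t 9 1 1 U1 L1 tt isT isT (ler0n _ 9).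
have H3 := @dev_err_ge R Ups L t 48 1 0 U1 L1 tt isT isT (ler0n _ 48).
have E : (3 * sU) ^+ 2 / t = 9 * Ups * L ^+ 1 / t ^+ 1 by rewrite exprMn sU2 !expr1; ring.
rewrite E sV2 in H1; rewrite expr0 expr1 divr1 in H3.
have d0 : 0 <= dev_err Ups L t by exact: dev_err_ge0.
have -> : 12 * (Ups * n%:R) * (4 * L) + 3 * (2 * (n%:R * (sV * sU))) =
  n%:R * (48 * Ups * L + 2 * (sV * (3 * sU))) by ring.
rewrite ler_wpM2l ?(ltW N0)//; lra.
Qed.

Lemma ustat_deviation (f : X * X -> R) : bdd_mfun f ->
  (forall x y, f (x, y) = f (y, x)) -> (forall z, `|f z| <= Ups * n%:R) ->
  (forall x, \int[P]_y (f (x, y) ^+ 2) <= Ups ^+ 2 * n%:R) ->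
  \int[P]_x \int[P]_y (f (x, y) ^+ 2) <= Ups * V ->
  with_prob_ge Pr (1 - (3 * n%:R + 2) * expR (- (4 * L)))
    [set w | forall t, 0 < t <= 1 ->
      `|\sum_(j < n) \sum_(i < j) degenerate P f (Z i w, Z j w)|
        <= n%:R * (t * V + dev_err Ups L t)].
Proof.
move=> bf fs fB fD fV.
have hN := N0; have hU := U0; have hL := L0; have hU1 := U1; have hL1 := L1; have hV := V0.
set sV := Num.sqrt V; set sU := Num.sqrt Ups; set sn := Num.sqrt (n%:R : R); set l := Num.sqrt L.
have sV2 : sV ^+ 2 = V by rewrite sqr_sqrtr.
have sU2 : sU ^+ 2 = Ups by rewrite sqr_sqrtr.
have sn2 : sn ^+ 2 = n%:R by rewrite sqr_sqrtr// ltW.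
have l2 : l ^+ 2 = L by rewrite sqr_sqrtr.
have sV0 : 0 <= sV by exact: sqrtr_ge0.
have sU0 : 0 <= sU by exact: sqrtr_ge0.
have sn0 : 0 < sn by rewrite sqrtr_gt0.
have l0 : 0 <= l by exact: sqrtr_ge0.
have l1 : l <= L by rewrite -l2 expr2; have := hL1; rewrite -l2; nra.
(* Each summand meets one requirement on [om]: the first dominates 36 D with D = Ups^2 n, the second
   4 n a with a = Ups V. *)
pose om := sn * (6 * Ups + 2 * (sU * sV)).
have UV : 0 <= sU * sV by exact: mulr_ge0.
have om0 : 0 < om by rewrite mulr_gt0//; lra.
have sq : Num.sqrt (n%:R * (4 * L)) = 2 * (sn * l).
  have -> : n%:R * (4 * L) = (2 * (sn * l)) ^+ 2 by rewrite !exprMn sn2 l2; ring.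
  by rewrite sqrtr_sqr ger0_norm// !mulr_ge0// ltW.
have := @degenerate_tail _ _ _ _ _ _ P _ mZ indZ lawZ f (Ups * n%:R) (Ups ^+ 2 * n%:R) (Ups * V)
  (8 * Ups * n%:R) om n (4 * L) bf fs fB fD fV.
have h1 : 0 < 8 * Ups * n%:R by rewrite mulr_gt0//; lra.
have h2 : 8 * (Ups * n%:R) <= 8 * Ups * n%:R by lra.
have h3 : n%:R * (4 * (Ups ^+ 2 * n%:R)) <= (8 * Ups * n%:R) ^+ 2.
  have -> : (8 * Ups * n%:R) ^+ 2 = 64 * (Ups * n%:R) ^+ 2 by ring.
  by have := sqr_ge0 (Ups * n%:R); lra.
have h4 : 36 * (Ups ^+ 2 * n%:R) <= om ^+ 2.
  rewrite exprMn sn2 [leRHS]mulrC mulrA ler_wpM2r ?(ltW hN)//.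
  have -> : 36 * Ups ^+ 2 = (6 * Ups) ^+ 2 by ring.
  by rewrite lerXn2r ?nnegrE//; lra.
have h5 : n%:R * (4 * (Ups * V)) <= om ^+ 2.
  rewrite exprMn sn2 ler_wpM2l ?(ltW hN)//.
  have -> : 4 * (Ups * V) = (2 * (sU * sV)) ^+ 2 by rewrite !exprMn sU2 sV2; ring.
  by rewrite lerXn2r ?nnegrE//; lra.
have h6 : 1 <= 4 * L by lra.
move=> /(_ h1 h2 h3 om0 h4 h5 h6); apply: with_prob_ge_sub => // w /= H t /andP[t0 t1].
apply: le_trans H _; rewrite sq.
have tt : 0 < t <= 1 by rewrite t0.
(* The square of L sqrt(L) is the origin of L^3. The numerical factors, 320 * 320 + 60 * 64 + 30 *
   64 = 108160, are what the constant 330 * 330 = 108900 has to exceed. *)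
have H1 := amgm_weighted sV (320 * (sU * (l * L))) t0.
have H2 := @dev_err_ge R Ups L t (320 * 320) 3 1 U1 L1 tt isT isT (mulr_ge0 (ler0n _ 320) (ler0n _ 320)).
have H3 := @dev_err_ge R Ups L t (60 * 64) 2 0 U1 L1 tt isT isT (mulr_ge0 (ler0n _ 60) (ler0n _ 64)).
have H4 := @dev_err_ge R Ups L t (30 * 64) 2 0 U1 L1 tt isT isT (mulr_ge0 (ler0n _ 30) (ler0n _ 64)).
have E : (320 * (sU * (l * L))) ^+ 2 / t = (320 * 320) * Ups * L ^+ 3 / t ^+ 1.
  by rewrite !exprMn sU2 l2 expr1 [L ^+ 3]exprS; ring.
rewrite E sV2 in H1; rewrite expr0 divr1 in H3 H4.
have d0 : 0 <= dev_err Ups L t by exact: dev_err_ge0.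
have -> : 30 * (8 * Ups * n%:R) * (4 * L) ^+ 2 + 40 * om * (4 * L) * (2 * (sn * l)) =
  n%:R * (60 * 64 * Ups * L ^+ 2 + 30 * 64 * Ups * (l * L) + 2 * (sV * (320 * (sU * (l * L))))).
  by rewrite /om -sn2; ring.
have lL : l * L <= L ^+ 2 by rewrite expr2 ler_wpM2r.
have ulL := ler_wpM2l hU lL.
apply: ler_wpM2l; first exact: ltW.
lra.
Qed.

End Deviation.

(** The assumptions on one kernel, with integrals against [P] in place of [Pint] and of
    expectations, and [Ups] in place of [Gam]. *)
Record good_kernel d (X : measurableType d) (R : realType) (mu : {measure set X -> \bar R})
    (P : probability X R) (s : X -> R) (n : nat) (Ups : R) (k : X * X -> R) : Prop := GoodKernel {
  gk_meas : measurable_fun setT k;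
  gk_sym : forall x y, k (x, y) = k (y, x);
  gk_sqr : forall x, (\int[mu]_y (k (x, y) ^+ 2)%:E <= (Ups * n%:R)%:E)%E;
  gk_bound : forall z, `|k z| <= Ups * n%:R;
  gk_Aker : measurable_fun setT (Aker mu k);
  gk_smooth : sqint mu (smooth mu s k);
  gk_smooth_le : dotf mu (smooth mu s k) (smooth mu s k) <= Ups;
  gk_chi : \int[P]_x (chi k x ^+ 2) <= Ups * n%:R * \int[P]_x Theta mu k x;
  gk_Aker_mean : \int[P]_x \int[P]_y (Aker mu k (x, y) ^+ 2) <= Ups * \int[P]_x Theta mu k x;
  gk_Aker_sup : forall x, \int[P]_y (Aker mu k (x, y) ^+ 2) <= Ups * n%:R;
  gk_vsq : (vsq mu s k <= (Num.max Ups (Num.sqrt (Ups * \int[P]_x Theta mu k x)))%:E)%E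
}.

Definition bias d (X : measurableType d) (R : realType) (mu : {measure set X -> \bar R})
  (s : X -> R) (k : X * X -> R) (x : X) : R := s x - smooth mu s k x.

(** The linear part of the loss. Up to the norm of the bias it is a function of B_k, which is how
    v_k^2 enters. *)
Definition bias_dot d (X : measurableType d) (R : realType) (mu : {measure set X -> \bar R})
  (s : X -> R) (k : X * X -> R) (x : X) : R := dotf mu (bias mu s k) (fun y => k (x, y)).

Definition smooth_diff d (X : measurableType d) (R : realType) (mu : {measure set X -> \bar R})
  (s : X -> R) (k k1 : X * X -> R) (x : X) : R := smooth mu s k x - smooth mu s k1 x.

(** Everything that the analysis of the loss and of the criterion asks of the sample; once it holds,
    that analysis is deterministic. *)
Record kernel_deviation d (X : measurableType d) (R : realType) (mu : {measure set X -> \bar R})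
    (P : probability X R) (s : X -> R) (n : nat) (Ups L : R) (k k1 : X * X -> R)
    (u : nat -> X) (t : R) : Prop := KernelDeviation {
  kd_Theta : `|\sum_(i < n) Theta mu k (u i) - n%:R * \int[P]_x Theta mu k x|
    <= n%:R * (t * \int[P]_x Theta mu k x + dev_err Ups L t);
  kd_chi : `|\sum_(i < n) chi k (u i) - n%:R * \int[P]_x chi k x|
    <= n%:R * (t * \int[P]_x Theta mu k x + dev_err Ups L t);
  kd_Aker : `|\sum_(j < n) \sum_(i < j) degenerate P (Aker mu k) (u i, u j)|
    <= n%:R * (t * \int[P]_x Theta mu k x + dev_err Ups L t);
  kd_kernel : `|\sum_(j < n) \sum_(i < j) degenerate P k (u i, u j)|
    <= n%:R * (t * \int[P]_x Theta mu k x + dev_err Ups L t);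
  kd_bias : `|\sum_(i < n) bias_dot mu s k (u i) - n%:R * \int[P]_x bias_dot mu s k x|
    <= 2 * t * (n%:R * dotf mu (bias mu s k) (bias mu s k) + \int[P]_x Theta mu k x) + dev_err Ups L t;
  kd_diff : `|\sum_(i < n) smooth_diff mu s k k1 (u i) - n%:R * \int[P]_x smooth_diff mu s k k1 x|
    <= 4 * t * (n%:R * (dotf mu (bias mu s k) (bias mu s k) + dotf mu (bias mu s k1) (bias mu s k1)))
       + dev_err Ups L t
}.

Section KernelDeviation.
Context dO (Omega : measurableType dO) d (X : measurableType d) (R : realType).
Variables (Pr : probability Omega R) (P : probability X R) (Z : nat -> Omega -> X).
Hypothesis mZ : forall i, measurable_fun setT (Z i).
Hypothesis indZ : independent_family Pr Z.
Hypothesis lawZ : forall i B, measurable B -> Pr (Z i @^-1` B) = P B.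
Variables (mu : {measure set X -> \bar R}) (s : X -> R) (n : nat) (Ups L : R).
Hypothesis ms : measurable_fun setT s.
Hypothesis s0 : forall x, 0 <= s x.
Hypothesis sS : forall x, s x <= Ups.
Hypothesis PE : forall B, measurable B -> P B = (\int[mu]_(x in B) (s x)%:E)%E.
Hypothesis n0 : (0 < n)%N.
Hypothesis U1 : 1 <= Ups.
Hypothesis L1 : 1 <= L.

Variable k : X * X -> R.
Hypothesis gk : good_kernel mu P s n Ups k.

Let V := \int[P]_x Theta mu k x.
Let mk := gk_meas gk.
Let ksym := gk_sym gk.
Let kC2 := gk_sqr gk.
Let kC := gk_bound gk.
Let mA := gk_Aker gk.
Let smi := gk_smooth gk.
Let si : sqint mu s := sqint_density ms s0 sS PE.
Let N0 : (0 : R) < n%:R. Proof. by rewrite ltr0n. Qed.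
Let U0 : 0 <= Ups. Proof. exact: le_trans U1. Qed.
Let L0 : 0 <= L. Proof. exact: le_trans L1. Qed.
Let bA := bdd_Aker mk ksym kC2 kC mA.
Let bTh := bdd_Theta mk ksym kC2 kC mA.
Let bk : bdd_mfun k := bdd_kernel mk kC.

Lemma mean_Theta_ge0 : 0 <= V.
Proof. by apply: Rintegral_ge0 => x _; exact: Theta_ge0. Qed.
Let V0 := mean_Theta_ge0.

Lemma Theta_deviation :
  with_prob_ge Pr (1 - 2 * expR (- (4 * L)))
    [set w | forall t, 0 < t <= 1 ->
      `|\sum_(i < n) Theta mu k (Z i w) - n%:R * V| <= n%:R * (t * V + dev_err Ups L t)].
Proof.
apply: sum_deviation => //.
  by move=> y; rewrite ger0_norm ?Theta_ge0//; exact: Theta_le.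
rewrite -bmeanZ//; apply: bmean_le => [| |y]; [exact: bdd_mfunX|exact: bdd_mfunZ|].
by rewrite expr2 ler_wpM2r ?Theta_ge0//; exact: Theta_le.
Qed.

Lemma chi_deviation :
  with_prob_ge Pr (1 - 2 * expR (- (4 * L)))
    [set w | forall t, 0 < t <= 1 ->
      `|\sum_(i < n) chi k (Z i w) - n%:R * \int[P]_x chi k x| <= n%:R * (t * V + dev_err Ups L t)].
Proof.
apply: sum_deviation => //; [exact: bdd_chi mk kC|by move=> y; exact: kC|exact: (gk_chi gk)].
Qed.

Let UUn : Ups * n%:R <= Ups ^+ 2 * n%:R.
Proof. by rewrite ler_wpM2r ?(ltW N0)// expr2 ler_peMr. Qed.

Lemma Aker_deviation :
  with_prob_ge Pr (1 - (3 * n%:R + 2) * expR (- (4 * L)))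
    [set w | forall t, 0 < t <= 1 ->
      `|\sum_(j < n) \sum_(i < j) degenerate P (Aker mu k) (Z i w, Z j w)|
        <= n%:R * (t * V + dev_err Ups L t)].
Proof.
apply: ustat_deviation => //.
- exact: Aker_sym.
- exact: Aker_le.
- by move=> x; apply: le_trans UUn; exact: (gk_Aker_sup gk).
- exact: (gk_Aker_mean gk).
Qed.

Lemma kernel_ustat_deviation :
  with_prob_ge Pr (1 - (3 * n%:R + 2) * expR (- (4 * L)))
    [set w | forall t, 0 < t <= 1 ->
      `|\sum_(j < n) \sum_(i < j) degenerate P k (Z i w, Z j w)|
        <= n%:R * (t * V + dev_err Ups L t)].
Proof.
apply: ustat_deviation => //.
- move=> x; apply: le_trans (mean_krow_sqr ms s0 sS PE mk ksym kC2 kC x) _.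
  by rewrite expr2 -mulrA ler_wpM2l//; exact: Theta_le.
- by apply: (mean_mean_kernel_sqr ms).
Qed.

Lemma sqint_bias : sqint mu (bias mu s k).
Proof. exact: sqintB. Qed.

Lemma bdd_bias_dot : bdd_mfun (bias_dot mu s k).
Proof. by apply: (bdd_dotf_krow P mk) => //; exact: sqint_bias. Qed.

Let b := dotf mu (bias mu s k) (bias mu s k).

(** The normalized bias is an admissible [a] in the definition of [Bset], so the second moment is at
    most b v_k^2; the maximum in the assumption on v_k^2 is relaxed to a sum. A zero bias cannot be
    normalized and is treated apart. *)
Lemma bias_dot_sqr : \int[P]_x (bias_dot mu s k x ^+ 2) <= b * (Ups + Num.sqrt (Ups * V)).
Proof.
have b0 : 0 <= b by exact: dotf_ge0.
have bbd := bdd_bias_dot.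
have sq0 : 0 <= Num.sqrt (Ups * V) by exact: sqrtr_ge0.
have [b00|b1] := eqVneq b 0.
  rewrite b00 mul0r -[leRHS](bmean_cst P); apply: bmean_le => [| |x].
  - exact: bdd_mfunX.
  - exact: bdd_mfun_cst.
  - apply: le_trans (dotf_cauchy sqint_bias (sqint_krow mk kC2 kC x)) _.
    by rewrite -/b b00 mul0r.
have bp : 0 < b by rewrite lt_neqAle eq_sym b1.
have sb : 0 < Num.sqrt b by rewrite sqrtr_gt0.
have sb2 : Num.sqrt b ^+ 2 = b by rewrite sqr_sqrtr.
pose a x := (Num.sqrt b)^-1 * bias mu s k x.
have ai : sqint mu a by exact: sqintZ sqint_bias.
have aa : dotf mu a a = 1.
  rewrite /a dotfZl//; last exact: sqint_bias.
  rewrite dotfC dotfZl//; try exact: sqint_bias.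
  by rewrite -/b mulrA -expr2 exprVn sb2 mulVf ?gt_eqF.
have aB : Bset mu k (fun x => \int[mu]_z (a z * k (z, x))).
  exists a; split => //; first exact/in_L2P.
  by rewrite -(@ler_pXn2r _ 2) ?nnegrE ?l2norm_ge0// l2norm_sqr// aa expr1n.
have tE x : \int[mu]_z (a z * k (z, x)) = (Num.sqrt b)^-1 * bias_dot mu s k x.
  rewrite /bias_dot -dotfZl; [|exact: sqint_bias|exact: sqint_krow mk kC2 kC x].
  by apply: eq_Rintegral => z _; rewrite [k (z, x)]ksym.
have bta : bdd_mfun (fun x => \int[mu]_z (a z * k (z, x))).
  have -> : (fun x => \int[mu]_z (a z * k (z, x))) = (fun x => (Num.sqrt b)^-1 * bias_dot mu s k x).
    by apply/funext => x; exact: tE.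
  exact: bdd_mfunZ.
have := ereal_sup_ubound (S := [set (\int[mu]_x (t x ^+ 2 * s x)%:E)%E | t in Bset mu k]) (ex_intro2 _ _ _ aB erefl).
move=> /le_trans/(_ (gk_vsq gk)).
rewrite -(integral_density ms s0 PE); last by have [] := bdd_mfunX 2 bta.
rewrite -EFin_bmean; last exact: bdd_mfunX.
rewrite lee_fin -/V; under eq_Rintegral do rewrite tE exprMn.
rewrite bmeanZ; last exact: bdd_mfunX.
rewrite exprVn sb2 ler_pdivrMl// => /le_trans; apply.
by rewrite ler_wpM2l// ge_max lerDl sq0 lerDr U0.
Qed.

Lemma bias_deviation :
  with_prob_ge Pr (1 - 2 * expR (- (4 * L)))
    [set w | forall t, 0 < t <= 1 ->
      `|\sum_(i < n) bias_dot mu s k (Z i w) - n%:R * \int[P]_x bias_dot mu s k x|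
        <= 2 * t * (n%:R * b + V) + dev_err Ups L t].
Proof.
have hN := N0; have hU := U0; have hL := L0; have hU1 := U1; have hL1 := L1; have hV := V0.
have b0 : 0 <= b by exact: dotf_ge0.
have bbd := bdd_bias_dot.
set sV := Num.sqrt V; set sU := Num.sqrt Ups; set sb := Num.sqrt (n%:R * b).
have sV2 : sV ^+ 2 = V by rewrite sqr_sqrtr.
have sU2 : sU ^+ 2 = Ups by rewrite sqr_sqrtr.
have sb2 : sb ^+ 2 = n%:R * b by rewrite sqr_sqrtr// mulr_ge0// ltW.
have sV0 : 0 <= sV by exact: sqrtr_ge0.
have sU0 : 0 <= sU by exact: sqrtr_ge0.
have sb0 : 0 <= sb by exact: sqrtr_ge0.
have sUV : Num.sqrt (Ups * V) = sU * sV by rewrite sqrtrM.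
have UV : 0 <= sU * sV by exact: mulr_ge0.
set m := Num.sqrt (L * (Ups + sU * sV)).
have m2 : m ^+ 2 = L * (Ups + sU * sV) by rewrite sqr_sqrtr// mulr_ge0// addr_ge0.
have m0 : 0 <= m by exact: sqrtr_ge0.
(* [sb * sU] is the Cauchy-Schwarz envelope, with Theta_k <= Ups n; the 1 keeps it positive when the
   bias vanishes. *)
have B0 : 0 < sb * sU + 1 by rewrite ltr_wpDl// mulr_ge0.
have bB y : `|bias_dot mu s k y| <= sb * sU + 1.
  rewrite -(@ler_pXn2r _ 2) ?nnegrE ?(ltW B0)// real_normK ?num_real//.
  apply: le_trans (dotf_cauchy sqint_bias (sqint_krow mk kC2 kC y)) _.
  rewrite -ThetaE//; apply: le_trans (_ : (sb * sU) ^+ 2 <= _); last first.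
    by rewrite lerXn2r ?nnegrE ?mulr_ge0// ?lerDl// ltW.
  have -> : (sb * sU) ^+ 2 = b * (Ups * n%:R) by rewrite exprMn sb2 sU2; ring.
  by apply: ler_wpM2l => //; exact: Theta_le.
have x0 : 0 < 4 * L by lra.
have q0 : 0 <= 2 * (sb * m) by rewrite !mulr_ge0.
have nq : n%:R * \int[P]_y (bias_dot mu s k y ^+ 2) * (4 * L) <= (2 * (sb * m)) ^+ 2.
  have -> : (2 * (sb * m)) ^+ 2 = n%:R * (b * (Ups + sU * sV)) * (4 * L).
    by rewrite !exprMn sb2 m2; ring.
  rewrite ler_wpM2r ?(ltW x0)// ler_wpM2l ?(ltW hN)// -sUV; exact: bias_dot_sqr.
have := bernstein_mean mZ indZ lawZ bbd B0 bB q0 x0 nq.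
apply: with_prob_ge_sub => // w /= H t tt; apply: le_trans H _.
have /andP[t0 t1] := tt.
have A1 := amgm_weighted sb (24 * (L * sU)) t0.
have A2 := amgm_weighted sb (3 * m) t0.
(* [A2] leaves the mixed term L sqrt(Ups V) / t, which is split once more in order to be paid by t
   V. This second splitting is the origin of the power t^(-3) in [dev_err]. *)
have A3 := amgm_weighted sV (5 * (L * sU) / t) t0.
have D1 := @dev_err_ge R Ups L t 600 2 1 U1 L1 tt isT isT (ler0n _ _).
have D2 := @dev_err_ge R Ups L t 48 1 0 U1 L1 tt isT isT (ler0n _ _).
have D3 := @dev_err_ge R Ups L t 9 1 1 U1 L1 tt isT isT (ler0n _ _).
have D4 := @dev_err_ge R Ups L t 25 2 3 U1 L1 tt isT isT (ler0n _ _).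
have d0 : 0 <= dev_err Ups L t by exact: dev_err_ge0.
have E1 : (24 * (L * sU)) ^+ 2 / t = 24 * 24 * (Ups * L ^+ 2 / t).
  by rewrite !exprMn sU2; ring.
have E2 : (3 * m) ^+ 2 / t = 9 * (Ups * L / t) + 9 * (L * (sU * sV) / t).
  by rewrite exprMn m2; ring.
have E3 : (5 * (L * sU) / t) ^+ 2 / t = 25 * (Ups * L ^+ 2 / t ^+ 3).
  by rewrite !exprMn sU2 exprVn; field; rewrite gt_eqF.
have E4 : sV * (5 * (L * sU) / t) = 5 * (L * (sU * sV) / t) by ring.
have UL : L <= Ups * L by rewrite ler_peMl.
have i0 : 0 <= L * (sU * sV) / t by rewrite !mulr_ge0// invr_ge0 ltW.
rewrite E1 sb2 in A1; rewrite E2 sb2 in A2; rewrite E3 E4 sV2 in A3.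
have F1 : 600 * Ups * L ^+ 2 / t ^+ 1 = 600 * (Ups * L ^+ 2 / t) by rewrite expr1 !mulrA.
have F2 : 48 * Ups * L ^+ 1 / t ^+ 0 = 48 * (Ups * L) by rewrite expr0 expr1 divr1 mulrA.
have F3 : 9 * Ups * L ^+ 1 / t ^+ 1 = 9 * (Ups * L / t) by rewrite !expr1 !mulrA.
have F4 : 25 * Ups * L ^+ 2 / t ^+ 3 = 25 * (Ups * L ^+ 2 / t ^+ 3) by rewrite !mulrA.
rewrite F1 in D1; rewrite F2 in D2; rewrite F3 in D3; rewrite F4 in D4.
have J1 : 0 <= Ups * L ^+ 2 / t by rewrite !mulr_ge0 ?exprn_ge0// invr_ge0 ltW.
have -> : 12 * (sb * sU + 1) * (4 * L) + 3 * (2 * (sb * m)) =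
  2 * (sb * (24 * (L * sU))) + 48 * L + 2 * (sb * (3 * m)) by ring.
have -> : 2 * t * (n%:R * b + V) = 2 * (t * (n%:R * b)) + 2 * (t * V) by ring.
have tV : 0 <= t * V by rewrite mulr_ge0// ltW.
move: A1 A2 A3 D1 D2 D3 D4 UL J1 i0 tV.
set y1 := Ups * L ^+ 2 / t; set y2 := L * (sU * sV) / t; set y3 := Ups * L ^+ 2 / t ^+ 3.
set y4 := Ups * L / t; set y5 := Ups * L; set y6 := t * (n%:R * b); set y7 := t * V.
set e := dev_err Ups L t.
move=> *; lra.
Qed.

Variable k1 : X * X -> R.
Hypothesis gk1 : good_kernel mu P s n Ups k1.
Hypothesis diff_sup : forall x, `|smooth_diff mu s k k1 x| <=
  Num.max Ups (Num.sqrt (Ups * n%:R) * l2norm mu (smooth_diff mu s k k1)).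

Lemma diff_deviation :
  with_prob_ge Pr (1 - 2 * expR (- (4 * L)))
    [set w | forall t, 0 < t <= 1 ->
      `|\sum_(i < n) smooth_diff mu s k k1 (Z i w) - n%:R * \int[P]_x smooth_diff mu s k k1 x|
        <= 4 * t * (n%:R * (b + dotf mu (bias mu s k1) (bias mu s k1))) + dev_err Ups L t].
Proof.
have hN := N0; have hU := U0; have hL := L0; have hU1 := U1; have hL1 := L1.
set b1 := dotf mu (bias mu s k1) (bias mu s k1).
have smi1 := gk_smooth gk1.
have bi1 : sqint mu (bias mu s k1) by exact: sqintB.
have di : sqint mu (smooth_diff mu s k k1) by exact: sqintB.
have bd : bdd_mfun (smooth_diff mu s k k1).
  apply: bdd_mfunB; first exact: (bdd_smooth ms s0 PE mk ksym kC).
  exact: (bdd_smooth ms s0 PE (gk_meas gk1) (gk_sym gk1) (gk_bound gk1)).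
pose be := dotf mu (smooth_diff mu s k k1) (smooth_diff mu s k k1).
have be0 : 0 <= be by exact: dotf_ge0.
(* s_k - s_(k1) is a difference of biases; by the parallelogram identity, the bound amounts to the
   sum of the biases having a nonnegative squared norm. *)
have beb : be <= 2 * (b + b1).
  have bi := sqint_bias.
  have -> : be = dotf mu (fun x => bias mu s k1 x - bias mu s k x) (fun x => bias mu s k1 x - bias mu s k x).
    by apply: eq_Rintegral => x _; rewrite /smooth_diff /bias; ring.
  have := dotf_ge0 mu (fun x => bias mu s k1 x - (- 1) * bias mu s k x).
  have Ni := sqintZ (-1) bi.
  have q1 : dotf mu (bias mu s k1) (fun x => -1 * bias mu s k x) =
      - dotf mu (bias mu s k1) (bias mu s k).
    by rewrite dotfC dotfZl// dotfC mulN1r.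
  have q2 : dotf mu (fun x => -1 * bias mu s k x) (fun x => -1 * bias mu s k x) = b.
    by rewrite dotfZl// dotfC dotfZl// -/b; ring.
  by rewrite (dotf_sqrB bi1 bi) (dotf_sqrB bi1 Ni) q1 q2 -/b -/b1; lra.
set sU := Num.sqrt Ups; set sb := Num.sqrt (n%:R * be); set l := Num.sqrt L.
have sU2 : sU ^+ 2 = Ups by rewrite sqr_sqrtr.
have l2 : l ^+ 2 = L by rewrite sqr_sqrtr.
have sb2 : sb ^+ 2 = n%:R * be by rewrite sqr_sqrtr// mulr_ge0// ltW.
have sU0 : 0 <= sU by exact: sqrtr_ge0.
have l0 : 0 <= l by exact: sqrtr_ge0.
have sb0 : 0 <= sb by exact: sqrtr_ge0.
have B0 : 0 < Ups + sU * sb by rewrite ltr_pwDl ?mulr_ge0//; lra.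
have bB y : `|smooth_diff mu s k k1 y| <= Ups + sU * sb.
  apply: le_trans (diff_sup y) _.
  have -> : Num.sqrt (Ups * n%:R) * l2norm mu (smooth_diff mu s k k1) = sU * sb.
    rewrite /sU /sb sqrtrM// -mulrA; congr (_ * _); rewrite sqrtrM ?(ltW hN)//; congr (_ * _).
    by rewrite /be -l2norm_sqr// sqrtr_sqr ger0_norm// l2norm_ge0.
  by rewrite ge_max lerDl mulr_ge0// lerDr hU.
have x0 : 0 < 4 * L by lra.
have q0 : 0 <= 2 * (sb * (sU * l)) by rewrite !mulr_ge0.
have nq : n%:R * \int[P]_y (smooth_diff mu s k k1 y ^+ 2) * (4 * L) <= (2 * (sb * (sU * l))) ^+ 2.
  have -> : (2 * (sb * (sU * l))) ^+ 2 = n%:R * (Ups * be) * (4 * L).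
    by rewrite !exprMn sb2 sU2 l2; ring.
  rewrite ler_wpM2r ?(ltW x0)// ler_wpM2l ?(ltW hN)//.
  by apply: (mean_sqr_le ms s0 sS PE).
have := bernstein_mean mZ indZ lawZ bd B0 bB q0 x0 nq.
apply: with_prob_ge_sub => // w /= H t tt; apply: le_trans H _.
have /andP[t0 t1] := tt.
have A1 := amgm_weighted sb (24 * (L * sU)) t0.
have A2 := amgm_weighted sb (3 * (sU * l)) t0.
have D1 := @dev_err_ge R Ups L t 600 2 1 U1 L1 tt isT isT (ler0n _ _).
have D2 := @dev_err_ge R Ups L t 48 1 0 U1 L1 tt isT isT (ler0n _ _).
have D3 := @dev_err_ge R Ups L t 9 1 1 U1 L1 tt isT isT (ler0n _ _).
have d0 : 0 <= dev_err Ups L t by exact: dev_err_ge0.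
have E1 : (24 * (L * sU)) ^+ 2 / t = 24 * 24 * (Ups * L ^+ 2 / t).
  by rewrite !exprMn sU2; ring.
have E2 : (3 * (sU * l)) ^+ 2 / t = 9 * (Ups * L / t).
  by rewrite !exprMn sU2 l2; ring.
rewrite E1 sb2 in A1; rewrite E2 sb2 in A2.
have F1 : 600 * Ups * L ^+ 2 / t ^+ 1 = 600 * (Ups * L ^+ 2 / t) by rewrite expr1 !mulrA.
have F2 : 48 * Ups * L ^+ 1 / t ^+ 0 = 48 * (Ups * L) by rewrite expr0 expr1 divr1 mulrA.
have F3 : 9 * Ups * L ^+ 1 / t ^+ 1 = 9 * (Ups * L / t) by rewrite !expr1 !mulrA.
rewrite F1 in D1; rewrite F2 in D2; rewrite F3 in D3.
have J1 : 0 <= Ups * L ^+ 2 / t by rewrite !mulr_ge0 ?exprn_ge0// invr_ge0 ltW.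
have tb : t * (n%:R * be) <= 2 * (t * (n%:R * (b + b1))).
  have -> : 2 * (t * (n%:R * (b + b1))) = t * (n%:R * (2 * (b + b1))) by ring.
  by rewrite ler_wpM2l ?(ltW t0)// ler_wpM2l// ltW.
have -> : 12 * (Ups + sU * sb) * (4 * L) + 3 * (2 * (sb * (sU * l))) =
  2 * (sb * (24 * (L * sU))) + 48 * (Ups * L) + 2 * (sb * (3 * (sU * l))) by ring.
rewrite -[4 * t * _]mulrA.
move: A1 A2 D1 D2 D3 J1 tb.
set y1 := Ups * L ^+ 2 / t; set y4 := Ups * L / t; set y5 := Ups * L.
set y6 := t * (n%:R * be); set y7 := t * (n%:R * (b + b1)).
set e := dev_err Ups L t.
move=> *; lra.
Qed.

Lemma kernel_deviation_event :
  with_prob_ge Pr (1 - (6 * n%:R + 12) * expR (- (4 * L)))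
    [set w | forall t, 0 < t <= 1 -> kernel_deviation mu P s n Ups L k k1 (Z^~ w) t].
Proof.
(* Four sums cost 2 exponentials each and two U-statistics 3n + 2 each, which makes 6n + 12. *)
have := with_prob_geI (with_prob_geI (with_prob_geI Theta_deviation chi_deviation)
  (with_prob_geI Aker_deviation kernel_ustat_deviation)) (with_prob_geI bias_deviation diff_deviation).
apply: with_prob_ge_sub; first by lra.
by move=> w [[[h1 h2] [h3 h4]] [h5 h6]] t tt; split; [exact: h1|exact: h2|exact: h3|exact: h4|exact: h5|exact: h6].
Qed.

End KernelDeviation.

(** * Loss and criterion *)

Section LossAndCriterion.
Context d (X : measurableType d) (R : realType).
Variables (mu : {measure set X -> \bar R}) (P : probability X R) (s : X -> R).
Variables (n : nat) (Ups L : R) (u : nat -> X).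
Hypothesis ms : measurable_fun setT s.
Hypothesis s0 : forall x, 0 <= s x.
Hypothesis sS : forall x, s x <= Ups.
Hypothesis PE : forall B, measurable B -> P B = (\int[mu]_(x in B) (s x)%:E)%E.
Hypothesis n0 : (0 < n)%N.
Hypothesis U1 : 1 <= Ups.
Hypothesis L1 : 1 <= L.

Let si : sqint mu s := sqint_density ms s0 sS PE.
Let N0 : (0 : R) < n%:R. Proof. by rewrite ltr0n. Qed.
Let U0 : 0 <= Ups. Proof. exact: le_trans U1. Qed.

Lemma dotf_density_le : dotf mu s s <= Ups.
Proof.
rewrite -[leLHS]/(Pint mu s s) (Pint_mean ms s0 PE ms).
apply: bmean_le_cst => //; split => //; exists Ups => x.
by rewrite ger0_norm.
Qed.

Lemma sumn_inv_le (a c : R) : `|a| <= n%:R * c -> `|n%:R^-1 * a| <= c.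
Proof. by move=> H; rewrite normrM gtr0_norm ?invr_gt0// ler_pdivrMl. Qed.

Definition loss k : R := l2norm mu (s \- shat n u k) ^+ 2.
Definition crit k : R := Pn n u (contrast mu (shat n u k)).
Definition bias_sqr k : R := dotf mu (bias mu s k) (bias mu s k).
Definition mTheta k : R := \int[P]_x Theta mu k x.
Definition smooth_sum k : R := \sum_(i < n) smooth mu s k (u i).

Section OneKernel.
Variable k : X * X -> R.
Hypothesis gk : good_kernel mu P s n Ups k.
Let mk := gk_meas gk.
Let ksym := gk_sym gk.
Let kC2 := gk_sqr gk.
Let kC := gk_bound gk.
Let smi := gk_smooth gk.

Let rowi i : sqint mu (fun y => k (u i, y)). Proof. exact: sqint_krow. Qed.

Let sumi : sqint mu (fun x => \sum_(i < n) k (u i, x)).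
Proof. by apply: (sqint_sum _ (f := fun (i : 'I_n) x => k (u i, x))). Qed.

Lemma sqint_shat : sqint mu (shat n u k).
Proof. exact: sqintZ. Qed.

Lemma dotf_shat (h : X -> R) : sqint mu h ->
  n%:R * dotf mu (shat n u k) h = \sum_(i < n) dotf mu (fun y => k (u i, y)) h.
Proof.
move=> hi; rewrite /shat dotfZl// mulrA divff ?gt_eqF// mul1r.
exact: (dotf_suml _ (f := fun (i : 'I_n) x => k (u i, x))).
Qed.

Let dshat : n%:R * dotf mu (shat n u k) (shat n u k) =
  n%:R^-1 * \sum_(i < n) \sum_(j < n) Aker mu k (u i, u j).
Proof.
rewrite dotf_shat; last exact: sqint_shat.
rewrite mulr_sumr; apply: eq_bigr => i _.
rewrite dotfC -[LHS](mulKf (lt0r_neq0 N0)) dotf_shat; last exact: rowi.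
by congr (_ * _); apply: eq_bigr => j _; rewrite AkerE// dotfC.
Qed.

Let dshat_s : n%:R * dotf mu s (shat n u k) = smooth_sum k.
Proof.
rewrite dotfC dotf_shat; last exact: si.
by apply: eq_bigr => i _; rewrite dotfC -smooth_dotf.
Qed.

Lemma mean_smooth_abs : `|\int[P]_x smooth mu s k x| <= Ups.
Proof.
have sU2 : Num.sqrt Ups ^+ 2 = Ups by rewrite sqr_sqrtr.
have [msm _] := bdd_smooth ms s0 PE mk ksym kC.
rewrite -(Pint_mean ms s0 PE msm) -[X in `|X|]/(dotf mu (smooth mu s k) s).
rewrite -[leRHS]sU2 expr2; apply: dotf_norm_le => //; rewrite ?sqrtr_ge0// sU2.
- exact: gk_smooth_le gk.
- exact: dotf_density_le.
Qed.

Lemma mTheta_ge0 : 0 <= mTheta k.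
Proof. by apply: Rintegral_ge0 => x _; exact: Theta_ge0. Qed.

Lemma loss_eq : n%:R * loss k = n%:R * dotf mu s s - 2 * smooth_sum k
  + n%:R * dotf mu (shat n u k) (shat n u k).
Proof.
have shi := sqint_shat.
rewrite /loss l2norm_sqr; last exact: sqintB.
by rewrite (dotf_sqrB si shi) mulrDr mulrBr mulrCA dshat_s.
Qed.

(** The linear terms in Hoeffding's decomposition of n ||shat||^2 combine with those of the cross
    product with [s] into the sum of [bias_dot]. The only other linear term is 2 [SA] / n, due to
    the factor n - 1 in place of n. *)
Lemma loss_deviation k1 t : 0 < t <= 1 -> kernel_deviation mu P s n Ups L k k1 u t ->
  `|n%:R * loss k - (n%:R * bias_sqr k + mTheta k)|
    <= 9 * t * (n%:R * bias_sqr k + mTheta k) + 7 * dev_err Ups L t.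
Proof.
move=> tt kd; have /andP[t0 t1] := tt; have hN := N0; have hU := U0; have hU1 := U1.
have V0 := mTheta_ge0; have B0 : 0 <= bias_sqr k by exact: dotf_ge0.
have shi := sqint_shat.
have e0 : 0 <= dev_err Ups L t by apply: dev_err_ge0 => //; exact: le_trans L1.
set e := dev_err Ups L t in e0 *.
have eU : 4 * (Ups / t) <= e.
  have := @dev_err_ge R Ups L t 4 0 1 U1 L1 tt isT isT (ler0n _ _).
  by rewrite -/e expr0 expr1 mulr1 -mulrA; lra.
have Ut : Ups <= Ups / t by rewrite ler_peMr// invf_ge1.
pose sk2 := dotf mu (smooth mu s k) (smooth mu s k).
have sk20 : 0 <= sk2 by exact: dotf_ge0.
have sk2U : sk2 <= Ups := gk_smooth_le gk.
pose A1 x := dotf mu (smooth mu s k) (fun y => k (x, y)).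
pose UA := \sum_(j < n) \sum_(i < j) degenerate P (Aker mu k) (u i, u j).
pose ST := \sum_(i < n) Theta mu k (u i).
pose SA := \sum_(i < n) A1 (u i).
have AA : \sum_(i < n) \sum_(j < n) Aker mu k (u i, u j) =
    2 * UA + ST + 2 * (n%:R - 1) * SA - n%:R * (n%:R - 1) * sk2.
  rewrite (sum_degenerate P n u (Aker_sym mu ksym)) (mean_mean_Aker ms s0 PE mk ksym kC2 kC smi).
  congr (_ + _ * _ - _); apply: eq_bigr => i _.
  exact: (mean_Aker ms s0 PE mk ksym kC2 kC).
have biasE : \sum_(i < n) bias_dot mu s k (u i) = smooth_sum k - SA.
  rewrite -sumrB; apply: eq_bigr => i _.
  by rewrite /bias_dot dotfBl// -smooth_dotf.
have mbias : \int[P]_x bias_dot mu s k x = dotf mu s (smooth mu s k) - sk2.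
  have bi : sqint mu (bias mu s k) by exact: sqintB.
  by rewrite -(dotf_smooth ms s0 PE mk ksym kC2 kC bi) dotfBl.
have bE : bias_sqr k = dotf mu s s - 2 * dotf mu s (smooth mu s k) + sk2.
  exact: dotf_sqrB.
have [kT _ kA _ kB _] := kd.
rewrite biasE mbias -/e -/(bias_sqr k) -/(mTheta k) in kB.
rewrite -/UA -/(mTheta k) -/e in kA; rewrite -/ST -/(mTheta k) -/e in kT.
(* Termwise, 2 |<s_k, k(u_i, .)>| <= t Theta_k(u_i) + ||s_k||^2 / t, where ||s_k||^2 <= Ups; the sum
   of the Theta_k(u_i) is then controlled by its own deviation bound. *)
have A1le : `|2 * SA| <= t * ST + n%:R * (Ups / t).
  rewrite /SA mulr_sumr; apply: le_trans (ler_norm_sum _ _ _) _.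
  rewrite /ST mulr_sumr -sum_ord_cst -big_split /=; apply: ler_sum => i _.
  pose w x := k (u i, x).
  have wi : sqint mu w by exact: rowi.
  have H2 c : 2 * c * A1 (u i) <= t * Theta mu k (u i) + c ^+ 2 * (sk2 / t).
    have ri := sqintZ t wi; have ci := sqintZ c smi.
    have := dotf_ge0 mu (fun x => t * w x - c * smooth mu s k x).
    rewrite (dotf_sqrB ri ci) !dotfZl//.
    rewrite [dotf mu w (fun x => t * w x)]dotfC [dotf mu w (fun x => c * _)]dotfC.
    rewrite [dotf mu _ (fun x => c * _)]dotfC !dotfZl// -/sk2 -/(A1 (u i)).
    rewrite -(ThetaE mu ksym (u i)) => H.
    have -> : t * Theta mu k (u i) + c ^+ 2 * (sk2 / t) =
      t^-1 * (t * (t * Theta mu k (u i)) + c * (c * sk2)) by field; rewrite gt_eqF.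
    rewrite ler_pdivlMl//; lra.
  have tU : sk2 / t <= Ups / t by rewrite ler_wpM2r// invr_ge0 ltW.
  have := H2 1; have := H2 (-1); rewrite sqrrN !expr1n => ? ?.
  by rewrite ler_norml; lra.
pose iN : R := n%:R^-1.
have iN0 : 0 < iN by rewrite invr_gt0.
have NiN : n%:R * iN = 1 by rewrite divff// gt_eqF.
have E : n%:R * loss k - (n%:R * bias_sqr k + mTheta k) =
    - 2 * (smooth_sum k - SA - n%:R * (dotf mu s (smooth mu s k) - sk2))
    + 2 * (iN * UA) + iN * (ST - n%:R * mTheta k) - iN * (2 * SA) + sk2.
  rewrite loss_eq dshat AA bE -/iN.
  have -> : iN * (ST - n%:R * mTheta k) = iN * ST - (n%:R * iN) * mTheta k by ring.
  have -> : iN * (2 * UA + ST + 2 * (n%:R - 1) * SA - n%:R * (n%:R - 1) * sk2) =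
    2 * (iN * UA) + iN * ST + 2 * (n%:R * iN) * SA - iN * (2 * SA) - (n%:R * iN) * (n%:R - 1) * sk2 by ring.
  by rewrite NiN; ring.
have kA' := sumn_inv_le kA; have kT' := sumn_inv_le kT; rewrite -/iN in kA' kT'.
have SAl : `|iN * (2 * SA)| <= t * (2 * mTheta k + e) + Ups / t.
  have ST2 : iN * ST <= 2 * mTheta k + e.
    have : iN * (ST - n%:R * mTheta k) = iN * ST - (n%:R * iN) * mTheta k by ring.
    rewrite NiN mul1r => H.
    have tV : t * mTheta k <= mTheta k by rewrite ler_piMl.
    by move: kT'; rewrite ler_norml H; lra.
  rewrite normrM gtr0_norm//; apply: le_trans (ler_wpM2l (ltW iN0) A1le) _.
  have -> : iN * (t * ST + n%:R * (Ups / t)) = t * (iN * ST) + (n%:R * iN) * (Ups / t) by ring.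
  by rewrite NiN mul1r lerD2r ler_wpM2l// ltW.
have te : t * e <= e by rewrite ler_piMl.
rewrite E; move: kB kA' kT' SAl te.
set z1 := smooth_sum k - _ - _; set z2 := iN * UA; set z3 := iN * (ST - _); set z4 := iN * (2 * SA).
have tB : 0 <= t * (n%:R * bias_sqr k) by rewrite !mulr_ge0// ltW.
have tV : 0 <= t * mTheta k by rewrite mulr_ge0// ltW.
move: tB tV; rewrite !ler_norml.
have -> : 2 * t * (n%:R * bias_sqr k + mTheta k) = 2 * (t * (n%:R * bias_sqr k)) + 2 * (t * mTheta k) by ring.
have -> : 9 * t * (n%:R * bias_sqr k + mTheta k) = 9 * (t * (n%:R * bias_sqr k)) + 9 * (t * mTheta k) by ring.
have -> : t * (2 * mTheta k + e) = 2 * (t * mTheta k) + t * e by ring.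
set z5 := t * (n%:R * _); set z6 := t * mTheta k; set z7 := t * e; set z8 := Ups / t in eU Ut *.
move=> ? ? /andP[? ?] /andP[? ?] /andP[? ?] /andP[? ?] ?; apply/andP; split; lra.
Qed.

(** Hoeffding's decomposition of the sum of the estimator over the observations turns the linear
    term of the loss into one with coefficient -2(1 - 2/n). That term is kept explicit, since only
    its difference between two kernels will be bounded. *)
Lemma crit_deviation k1 t : 0 < t <= 1 -> kernel_deviation mu P s n Ups L k k1 u t ->
  `|n%:R * crit k - (n%:R * loss k - n%:R * dotf mu s s - 2 * \int[P]_x chi k x
       - 2 * (1 - 2 / n%:R) * (smooth_sum k - n%:R * \int[P]_x smooth mu s k x)
       + 2 * \int[P]_x smooth mu s k x)|
    <= 6 * (t * mTheta k + dev_err Ups L t).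
Proof.
move=> tt kd; have hN := N0.
have shi := sqint_shat.
pose UK := \sum_(j < n) \sum_(i < j) degenerate P k (u i, u j).
pose SC := \sum_(i < n) chi k (u i).
pose Ps := \int[P]_x smooth mu s k x.
pose iN : R := n%:R^-1.
have iN0 : 0 < iN by rewrite invr_gt0.
have NiN : n%:R * iN = 1 by rewrite divff// gt_eqF.
have KK : \sum_(i < n) \sum_(j < n) k (u i, u j) =
    2 * UK + SC + 2 * (n%:R - 1) * smooth_sum k - n%:R * (n%:R - 1) * Ps.
  rewrite (sum_degenerate P n u ksym).
  have -> : Ps = \int[P]_x \int[P]_y k (x, y).
    by apply: eq_Rintegral => x _; exact: smoothE.
  by congr (_ + _ * _ - _); apply: eq_bigr => i _; rewrite (smoothE ms s0 PE mk ksym kC).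
have cE : n%:R * crit k = n%:R * dotf mu (shat n u k) (shat n u k)
    - 2 * (iN * \sum_(i < n) \sum_(j < n) k (u i, u j)).
  rewrite /crit /Pn (mulVKf (lt0r_neq0 hN)) /contrast sumrB sum_ord_cst l2norm_sqr//.
  congr (_ - _); rewrite -mulr_sumr; congr (_ * _).
  rewrite /shat -mulr_sumr exchange_big /=; congr (_ * _).
have lE := loss_eq.
have [_ kC' _ kK _ _] := kd.
rewrite -/(mTheta k) -/UK in kK; rewrite -/(mTheta k) -/SC in kC'.
have kK' := sumn_inv_le kK; have kC'' := sumn_inv_le kC'; rewrite -/iN in kK' kC''.
have E : n%:R * crit k - (n%:R * loss k - n%:R * dotf mu s s - 2 * \int[P]_x chi k x
       - 2 * (1 - 2 / n%:R) * (smooth_sum k - n%:R * Ps) + 2 * Ps) =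
   - 4 * (iN * UK) - 2 * (iN * (SC - n%:R * \int[P]_x chi k x)).
  have -> : n%:R * dotf mu s s = n%:R * loss k + 2 * smooth_sum k
     - n%:R * dotf mu (shat n u k) (shat n u k) by rewrite lE; ring.
  rewrite cE KK -/iN.
  have -> : iN * (SC - n%:R * \int[P]_x chi k x) = iN * SC - (n%:R * iN) * \int[P]_x chi k x by ring.
  have -> : iN * (2 * UK + SC + 2 * (n%:R - 1) * smooth_sum k - n%:R * (n%:R - 1) * Ps) =
   2 * (iN * UK) + iN * SC + 2 * (n%:R * iN) * smooth_sum k - 2 * iN * smooth_sum k - (n%:R * iN) * (n%:R - 1) * Ps by ring.
  have -> : 2 * (1 - 2 * iN) * (smooth_sum k - n%:R * Ps) =
    2 * smooth_sum k - 2 * n%:R * Ps - 4 * iN * smooth_sum k + 4 * (n%:R * iN) * Ps by ring.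
  by rewrite NiN; ring.
rewrite -/Ps E; move: kK' kC''; set z1 := iN * UK; set z2 := iN * (SC - _).
by rewrite !ler_norml => /andP[? ?] /andP[? ?]; apply/andP; split; lra.
Qed.

End OneKernel.

End LossAndCriterion.

(** * Comparison of the selected kernel with a reference kernel *)

(** On each bias, 9t comes from the loss and 8t from twice the linear difference, so 17t <= 1 allows
    N b to be dropped and N b1 to be doubled. On V and V1, 15t is 9t from the loss plus 6t from the
    criterion. The 29 errors are 13 for each kernel, 2 for the difference and 1 for the means [m],
    [m1]. *)
Lemma selection_arith (R : realFieldType) (N V V1 b b1 z z1 e Ups l l1 c c1 p p1 m m1 ch ch1 ns
    delta delta' w t : R) :
  0 <= V -> 0 <= V1 -> 0 <= N * b -> 0 <= N * b1 -> 0 < t -> 17 * t <= 1 -> 4 * Ups <= e ->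
  `|m| <= Ups -> `|m1| <= Ups ->
  `|N * l - (N * b + V)| <= 9 * t * (N * b + V) + 7 * e ->
  `|N * l1 - (N * b1 + V1)| <= 9 * t * (N * b1 + V1) + 7 * e ->
  `|N * c - (N * l - N * ns - 2 * ch - 2 * z + 2 * m)| <= 6 * (t * V + e) ->
  `|N * c1 - (N * l1 - N * ns - 2 * ch1 - 2 * z1 + 2 * m1)| <= 6 * (t * V1 + e) ->
  `|z - z1| <= 4 * t * (N * (b + b1)) + e ->
  N * (c + p) <= N * (c1 + p1) ->
  2 * ch - V - delta * V - w <= N * p ->
  N * p1 <= 2 * ch1 - V1 - delta' * V1 + w ->
  (delta' - 15 * t) * V1 - 2 * (N * b1) - 29 * e - 2 * w <= (delta + 15 * t) * V.
Proof.
move=> V0 V10 b0 b10 t0 t17 eU.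
have tb : 17 * t * (N * b) <= N * b by rewrite ler_piMl.
have tb1 : 17 * t * (N * b1) <= N * b1 by rewrite ler_piMl.
rewrite !mulrDr; set B := N * b; set B1 := N * b1; set l' := N * l; set l1' := N * l1.
set c' := N * c; set c1' := N * c1; set q := N * p; set q1 := N * p1; set ns' := N * ns.
move: tb tb1; rewrite -/B -/B1.
move=> tb tb1 /ler_normlP[? ?] /ler_normlP[? ?] /ler_normlP[? ?] /ler_normlP[? ?].
move=> /ler_normlP[? ?] /ler_normlP[? ?] /ler_normlP[? ?] ? ? ?.
lra.
Qed.

Section Selection.
Context d (X : measurableType d) (R : realType).
Variables (mu : {measure set X -> \bar R}) (P : probability X R) (s : X -> R).
Variables (n : nat) (Ups L : R) (u : nat -> X).
Hypothesis ms : measurable_fun setT s.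
Hypothesis s0 : forall x, 0 <= s x.
Hypothesis sS : forall x, s x <= Ups.
Hypothesis PE : forall B, measurable B -> P B = (\int[mu]_(x in B) (s x)%:E)%E.
Hypothesis n0 : (0 < n)%N.
Hypothesis U1 : 1 <= Ups.
Hypothesis L1 : 1 <= L.

Lemma selection_bound (k k1 : X * X -> R) (p p1 delta delta' w t : R) :
  good_kernel mu P s n Ups k -> good_kernel mu P s n Ups k1 ->
  0 < t <= 1 -> 17 * t <= 1 ->
  kernel_deviation mu P s n Ups L k k1 u t -> kernel_deviation mu P s n Ups L k1 k1 u t ->
  crit mu n u k + p <= crit mu n u k1 + p1 ->
  2 * \int[P]_x chi k x - mTheta mu P k - delta * mTheta mu P k - w <= n%:R * p ->
  n%:R * p1 <= 2 * \int[P]_x chi k1 x - mTheta mu P k1 - delta' * mTheta mu P k1 + w ->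
  (delta' - 15 * t) * mTheta mu P k1 - 2 * (n%:R * bias_sqr mu s k1)
    - 29 * dev_err Ups L t - 2 * w <= (delta + 15 * t) * mTheta mu P k.
Proof.
move=> gk gk1 tt t17; have /andP[t0 t1] := tt.
have N0 : (0 : R) < n%:R by rewrite ltr0n.
have U0 : 0 <= Ups by exact: le_trans U1.
have L0 : 0 <= L by exact: le_trans L1.
have e0 : 0 <= dev_err Ups L t by exact: dev_err_ge0.
have eU : 4 * Ups <= dev_err Ups L t.
  have := @dev_err_ge R Ups L t 4 0 0 U1 L1 tt isT isT (ler0n _ _).
  by rewrite !expr0 mulr1 divr1; lra.
(* This factor lies in [-1, 1], with -1 attained at n = 1; its absolute value is therefore what must
   be bounded. *)
pose r : R := 1 - 2 / n%:R.
have r1 : `|r| <= 1.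
  have iN0 : (0 : R) < n%:R^-1 by rewrite invr_gt0.
  have iN1 : n%:R^-1 <= (1 : R) by rewrite invf_le1// ler1n.
  by rewrite ler_norml /r; apply/andP; split; lra.
move=> kd kd1 ck pk pk1.
have ld := loss_deviation ms s0 sS PE n0 U1 L1 gk tt kd.
have ld1 := loss_deviation ms s0 sS PE n0 U1 L1 gk1 tt kd1.
have cd := crit_deviation ms s0 sS PE n0 gk tt kd.
have cd1 := crit_deviation ms s0 sS PE n0 gk1 tt kd1.
have sm := mean_smooth_abs ms s0 sS PE U1 gk.
have sm1 := mean_smooth_abs ms s0 sS PE U1 gk1.
have V0 : 0 <= mTheta mu P k := mTheta_ge0 gk.
have V10 : 0 <= mTheta mu P k1 := mTheta_ge0 gk1.
have b0 : 0 <= n%:R * bias_sqr mu s k by rewrite mulr_ge0 ?dotf_ge0// ltW.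
have b10 : 0 <= n%:R * bias_sqr mu s k1 by rewrite mulr_ge0 ?dotf_ge0// ltW.
have [_ _ _ _ _ kdd] := kd.
have bs := bdd_smooth ms s0 PE (gk_meas gk) (gk_sym gk) (gk_bound gk).
have bs1 := bdd_smooth ms s0 PE (gk_meas gk1) (gk_sym gk1) (gk_bound gk1).
have sd : \sum_(i < n) smooth_diff mu s k k1 (u i) = smooth_sum mu s n u k - smooth_sum mu s n u k1.
  by rewrite -sumrB.
have md : \int[P]_x smooth_diff mu s k k1 x = \int[P]_x smooth mu s k x - \int[P]_x smooth mu s k1 x.
  exact: bmeanB.
rewrite sd md -/(bias_sqr mu s k) -/(bias_sqr mu s k1) in kdd.
have Nc := ler_wpM2l (ltW N0) ck.
move: kdd cd cd1; rewrite -/r.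
pose y := smooth_sum mu s n u k - n%:R * \int[P]_x smooth mu s k x.
pose y1 := smooth_sum mu s n u k1 - n%:R * \int[P]_x smooth mu s k1 x.
rewrite -/y -/y1.
have -> : smooth_sum mu s n u k - smooth_sum mu s n u k1 -
   n%:R * (\int[P]_x smooth mu s k x - \int[P]_x smooth mu s k1 x) = y - y1 by rewrite /y /y1; ring.
move=> kdd cd cd1.
have ry : `|r * (y - y1)| <= 4 * t * (n%:R * (bias_sqr mu s k + bias_sqr mu s k1)) + dev_err Ups L t.
  by rewrite normrM; apply: le_trans kdd; rewrite ler_piMl.
rewrite -[2 * r * y]mulrA in cd; rewrite -[2 * r * y1]mulrA in cd1.
rewrite mulrBr in ry.
exact: (selection_arith V0 V10 b0 b10 t0 t17 eU sm sm1 ld ld1 cd cd1 ry Nc pk pk1).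
Qed.
End Selection.

(** * From the comparison to the ratio delta' / delta *)

Section FinalArithmetic.
Variables (R : realFieldType).

(** 32 = 15 + 2 + 15: the loss 15t on delta', the doubled bias of the reference kernel, and the
    replacement of delta + 15t by delta in the denominator. 29 and 2 are the factors of the error
    and of the penalty term in the selection bound. *)
Definition slope_Theta (delta K W : R) : R := (32 + 29 * K + 2 * W) / delta.
(** The addition is 19 + 7K, the relative excess of the reference loss over V1, plus 9 + 7K, the
    relative deficit of the selected loss. *)
Definition slope_loss (delta K W : R) : R := slope_Theta delta K W + 28 + 14 * K.

Lemma final_Theta (delta delta' K W t V V1 B1 e w : R) :
  0 < delta' -> delta' <= delta -> 0 <= K -> 0 <= W -> 0 < t -> 0 <= V1 ->
  B1 <= t * V1 -> e <= K * (t * V1) -> w <= W * (t * V1) ->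
  (delta' - 15 * t) * V1 - 2 * B1 - 29 * e - 2 * w <= (delta + 15 * t) * V ->
  (delta' / delta - slope_Theta delta K W * t) * V1 <= V.
Proof.
move=> d'0 dd K0 W0 t0 V10 B1t eK wW sel.
have d0 : 0 < delta by exact: lt_le_trans dd.
have t0' : 0 <= t := ltW t0.
have c0 : 0 < delta + 15 * t by lra.
rewrite -(ler_pM2l c0); apply: le_trans sel.
apply: le_trans (_ : (delta' - (17 + 29 * K + 2 * W) * t) * V1 <= _); last by lra.
rewrite mulrA ler_wpM2r//.
set y := delta' / delta; set H := slope_Theta delta K W.
have yd : delta * y = delta' by rewrite /y mulrC divfK// gt_eqF.
have Hd : delta * H = 32 + 29 * K + 2 * W by rewrite /H /slope_Theta mulrC divfK// gt_eqF.
have y1 : y <= 1 by rewrite ler_pdivrMr// mul1r.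
have H0 : 0 <= H by rewrite /H /slope_Theta divr_ge0//; lra.
have ty : t * y <= t by rewrite ler_piMr// ltW.
have Htt : 0 <= t * (H * t) := mulr_ge0 t0' (mulr_ge0 H0 t0').
have -> : (delta + 15 * t) * (y - H * t) =
  delta * y - (delta * H) * t + 15 * (t * y) - 15 * (t * (H * t)) by ring.
by rewrite yd Hd; lra.
Qed.

Lemma final_loss (delta delta' K W t V V1 B B1 l l1 e : R) :
  0 < delta' -> delta' <= delta -> 0 <= K -> 0 <= W -> 0 < t -> 17 * t <= 1 ->
  slope_loss delta K W * t <= 2^-1 * (delta' / delta) ->
  0 <= V1 -> 0 <= B -> B1 <= t * V1 -> e <= K * (t * V1) ->
  `|l - (B + V)| <= 9 * t * (B + V) + 7 * e ->
  `|l1 - (B1 + V1)| <= 9 * t * (B1 + V1) + 7 * e ->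
  (delta' / delta - slope_Theta delta K W * t) * V1 <= V ->
  (delta' / delta - slope_loss delta K W * t) * l1 <= l.
Proof.
move=> d'0 dd K0 W0 t0 t17 Ht V10 B0 B1t eK ld ld1 HV.
have d0 : 0 < delta by exact: lt_le_trans dd.
have t0' : 0 <= t := ltW t0.
set y := delta' / delta in Ht HV *; set H := slope_Theta delta K W in HV.
have y0 : 0 < y by exact: divr_gt0.
have y1 : y <= 1 by rewrite ler_pdivrMr// mul1r.
have H0 : 0 <= H by rewrite /H /slope_Theta divr_ge0//; lra.
have tV1 : 0 <= t * V1 by rewrite mulr_ge0// ltW.
have ttV1 : t * (t * V1) <= t * V1 by rewrite ler_piMl//; lra.
have l1_le : l1 <= (1 + (19 + 7 * K) * t) * V1.
  move: ld1 => /ler_normlP[_ ?].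
  have : t * B1 <= t * (t * V1) by rewrite ler_wpM2l// ltW.
  by lra.
have l_ge : (y - (H + 9 + 7 * K) * t) * V1 <= l.
  move: ld => /ler_normlP[? _].
  have c0 : 0 <= 1 - 9 * t by lra.
  have H1 := ler_wpM2l c0 HV.
  have H2 : (1 - 9 * t) * V <= (1 - 9 * t) * (B + V) by rewrite ler_wpM2l// lerDr.
  have ty : 9 * (t * V1 * y) <= 9 * (t * V1) by rewrite ler_wpM2l// ler_piMr.
  have th : 0 <= t * (H * (t * V1)) := mulr_ge0 t0' (mulr_ge0 H0 tV1).
  by lra.
set Hl := slope_loss delta K W in Ht *.
have HlE : Hl = H + 28 + 14 * K by [].
have Hl0 : 0 <= Hl by lra.
have p0 : 0 <= y - Hl * t by lra.
apply: le_trans (ler_wpM2l p0 l1_le) _; apply: le_trans l_ge.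
rewrite mulrA ler_wpM2r//.
have J0 : 0 <= (19 + 7 * K) * t by rewrite mulr_ge0 ?ltW//; lra.
have q1 : y * ((19 + 7 * K) * t) <= (19 + 7 * K) * t by rewrite ler_piMl.
have q2 : 0 <= Hl * t * ((19 + 7 * K) * t) := mulr_ge0 (mulr_ge0 Hl0 t0') J0.
rewrite HlE in q2 *; lra.
Qed.

Lemma final_oracle (y q K t B0 V1 B1 l0 l1 e : R) :
  0 < y -> 0 <= K -> 0 < t -> 17 * t <= 1 -> (18 + 14 * K) * t <= 1 ->
  2^-1 * y <= q ->
  0 <= V1 -> 0 <= B1 -> B0 <= t * V1 -> e <= K * (t * V1) ->
  `|l0 - B0| <= 9 * t * B0 + 7 * e ->
  `|l1 - (B1 + V1)| <= 9 * t * (B1 + V1) + 7 * e ->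
  l0 <= 4 * (10 + 7 * K) / y * t * q * l1.
Proof.
move=> y0 K0 t0 t17 t18 yq V10 B10 B0t eK ld0 ld1.
have t0' : 0 <= t := ltW t0.
have tV1 : 0 <= t * V1 by rewrite mulr_ge0// ltW.
have ttV1 : t * (t * V1) <= t * V1 by rewrite ler_piMl//; lra.
have l0_le : l0 <= (10 + 7 * K) * (t * V1).
  move: ld0 => /ler_normlP[_ ?].
  have : t * B0 <= t * (t * V1) by rewrite ler_wpM2l// ltW.
  have : 9 * (t * (t * V1)) <= 9 * (17^-1 * (t * V1)).
    by rewrite ler_wpM2l// ler_wpM2r//; lra.
  by lra.
have l1_ge : V1 <= 2 * l1.
  move: ld1 => /ler_normlP[? _].
  have H1 := ler_wpM2r V10 t18.
  have H2 : 0 <= (1 - 9 * t) * B1 by rewrite mulr_ge0//; lra.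
  by lra.
have l10 : 0 <= l1 by lra.
apply: le_trans l0_le _.
have K7 : 0 <= 10 + 7 * K by lra.
apply: le_trans (_ : (10 + 7 * K) * (t * (2 * l1)) <= _).
  by rewrite ler_wpM2l// ler_wpM2l// ltW.
have -> : (10 + 7 * K) * (t * (2 * l1)) = 4 * (10 + 7 * K) / y * t * (2^-1 * y) * l1.
  by field; rewrite gt_eqF.
rewrite ler_wpM2r// ler_wpM2l// !mulr_ge0 ?invr_ge0// ltW//.
Qed.

End FinalArithmetic.

(** Used with a shift by 2: the observations are the full family without X and Y. *)
Lemma independent_family_tail d (Omega : measurableType d) d' (X : measurableType d')
    (R : realType) (Pr : probability Omega R) (Z : nat -> Omega -> X) m :
  independent_family Pr Z -> independent_family Pr (fun i => Z (m + i)%N).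
Proof.
move=> indZ J B mB.
pose J' : {fset nat} := [fset (m + i)%N | i in J]%fset.
have := indZ J' (fun i => B (i - m)%N) _.
have -> : \bigcap_(i in [set` J']) Z i @^-1` B (i - m)%N = \bigcap_(i in [set` J]) Z (m + i)%N @^-1` B i.
  apply/seteqP; split => w H i /= iJ.
    have := H (m + i)%N; rewrite /= addKn; apply.
    by apply/imfsetP; exists i.
  by move/imfsetP : iJ => [j /= jJ ->]; rewrite addKn; exact: H.
rewrite big_imfset /=; last by move=> i j _ _ /addnI.
under eq_bigr do rewrite addKn.
by apply => i /imfsetP[j /= jJ ->]; rewrite addKn; exact: mB.
Qed.

(** * The vanishing rate and its fourth root *)

Section Rates.
Variable R : realType.

(** The summands are, relative to P Theta at k_(1,n), the rates of L^3, of n times the squared bias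
    of k_(1,n), and of n ||s - s_k||^2 + P Theta_k at k_(0,n). The last one keeps the total
    positive, since its fourth root is used as a divisor. *)
Definition rate (c cs cR : R) (eps1 eps2 eps3 : nat -> R) (n : nat) : R :=
  cR * eps2 n * (cs * eps1 n * (1 + c * eps3 n)) + c * eps3 n
  + cs * eps1 n * (1 + c * eps3 n) + n.+1%:R^-1.

Definition root4 (x : R) : R := Num.sqrt (Num.sqrt x).

Lemma root4_expr x : 0 <= x -> root4 x ^+ 4 = x.
Proof.
move=> x0; rewrite /root4 (exprM _ 2 2) sqr_sqrtr ?sqrtr_ge0//.
by rewrite sqr_sqrtr.
Qed.

Lemma cvg_root4 (f : nat -> R) : f n @[n --> \oo] --> (0 : R) ->
  root4 (f n) @[n --> \oo] --> (0 : R).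
Proof.
have sq0 : Num.sqrt x @[x --> (0 : R)] --> (0 : R).
  by have := @sqrt_continuous R 0; rewrite /continuous_at sqrtr0.
by move=> f0; apply: (cvg_comp _ _ _ sq0); exact: (cvg_comp _ _ f0 sq0).
Qed.

Lemma cvg_rate c cs cR (eps1 eps2 eps3 : nat -> R) :
  eps1 n @[n --> \oo] --> (0 : R) -> eps2 n @[n --> \oo] --> (0 : R) ->
  eps3 n @[n --> \oo] --> (0 : R) ->
  rate c cs cR eps1 eps2 eps3 n @[n --> \oo] --> (0 : R).
Proof.
move=> e1 e2 e3.
have h : n.+1%:R^-1 @[n --> \oo] --> (0 : R) by exact: cvg_harmonic.
have ce3 : c * eps3 n @[n --> \oo] --> c * (0 : R) by apply: cvgM => //; exact: cvg_cst.
have c13 : cs * eps1 n * (1 + c * eps3 n) @[n --> \oo] --> cs * (0 : R) * (1 + c * 0).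
  apply: cvgM; first by apply: cvgM => //; exact: cvg_cst.
  by apply: cvgD => //; exact: cvg_cst.
have c2 : cR * eps2 n @[n --> \oo] --> cR * (0 : R) by apply: cvgM => //; exact: cvg_cst.
have -> : (0 : R) = cR * 0 * (cs * 0 * (1 + c * 0)) + c * 0 + cs * 0 * (1 + c * 0) + 0.
  by rewrite !mulr0 !mul0r !addr0.
exact: (cvgD (cvgD (cvgD (cvgM c2 c13) ce3) c13) h).
Qed.

Lemma rate_bounds c cs cR (eps1 eps2 eps3 : nat -> R) n (B1 V1 B0 N L : R) :
  0 < c -> 0 < cs -> 0 < cR -> [/\ 0 <= eps1 n, 0 <= eps2 n & 0 <= eps3 n] ->
  0 < N -> 0 <= V1 ->
  B0 / N <= cs * eps1 n * ((B1 + V1) / N) -> L ^+ 3 / N <= cR * eps2 n * (B0 / N) ->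
  B1 / N <= c * eps3 n * (V1 / N) ->
  let q := rate c cs cR eps1 eps2 eps3 n in
  [/\ 0 < q, B1 <= q * V1, B0 <= q * V1 & L ^+ 3 <= q * V1].
Proof.
move=> c0 cs0 cR0 [e10 e20 e30] N0 V10.
rewrite !mulrA !ler_pM2r ?invr_gt0// => hB0 hL hB1 q.
have ce : 0 <= c * eps3 n by rewrite mulr_ge0// ltW.
have ce1 : 0 <= cs * eps1 n by rewrite mulr_ge0// ltW.
have ce2 : 0 <= cR * eps2 n by rewrite mulr_ge0// ltW.
have hh : (0 : R) < n.+1%:R^-1 by rewrite invr_gt0.
set z := cs * eps1 n * (1 + c * eps3 n).
have B0z : B0 <= z * V1.
  by apply: le_trans hB0 _; rewrite /z -[leRHS]mulrA ler_wpM2l// mulrDl mul1r; lra.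
have z0 : 0 <= z by rewrite mulr_ge0// addr_ge0.
have z2 : 0 <= cR * eps2 n * z by exact: mulr_ge0.
have qE : q = cR * eps2 n * z + c * eps3 n + z + n.+1%:R^-1 by [].
move: hh qE; set h := n.+1%:R^-1; move=> hh qE.
move: (c * eps3 n) (cR * eps2 n) ce ce2 z2 hL hB1 qE => a3 a2 ce ce2 z2 hL hB1 qE.
have q0 : 0 < q by rewrite qE; lra.
have lez a : a <= q -> a * V1 <= q * V1 by move=> ?; rewrite ler_wpM2r.
split => //.
- by apply: le_trans hB1 _; apply: lez; rewrite qE; lra.
- by apply: le_trans B0z _; apply: lez; rewrite qE; lra.
- apply: le_trans hL _; apply: le_trans (ler_wpM2l ce2 B0z) _.
  by rewrite mulrA; apply: lez; rewrite qE; lra.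
Qed.

End Rates.

Lemma mean_law d (Omega : measurableType d) d' (X : measurableType d') (R : realType)
    (Pr : probability Omega R) (P : probability X R) (Y : Omega -> X) (f : X -> R) :
  measurable_fun setT Y -> (forall B, measurable B -> Pr (Y @^-1` B) = P B) ->
  bdd_mfun f -> \int[Pr]_w f (Y w) = \int[P]_x f x.
Proof.
move=> mY lawY bf; have [mf _] := bf.
rewrite [RHS]/Rintegral (@eq_measure_integral _ _ _ _ (pushforward Pr Y)); last first.
  by move=> A mA _; first [exact: lawY|exact/esym/lawY].
rewrite integral_pushforward //=; first exact/measurable_EFinP.
by apply: bdd_integrable; exact: bdd_mfun_comp bf mY.
Qed.

(** * Translation of the assumptions on a kernel *)

Section GoodKernel.
Context dO (Omega : measurableType dO) d (X : measurableType d) (R : realType).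
Variables (mu : {measure set X -> \bar R}) (s : X -> R) (Pr : probability Omega R) (P : probability X R).
Variables (X0 Y0 : Omega -> X) (Xs : nat -> Omega -> X).
Hypothesis ms : measurable_fun setT s.
Hypothesis s0 : forall x, 0 <= s x.
Hypothesis PE : forall B, measurable B -> P B = (\int[mu]_(x in B) (s x)%:E)%E.
Hypothesis mF : forall i, measurable_fun setT (full_family X0 Y0 Xs i).
Hypothesis indF : independent_family Pr (full_family X0 Y0 Xs).
Hypothesis lawF : forall i B, measurable B -> Pr (full_family X0 Y0 Xs i @^-1` B) = P B.

(** X and Y are the members 0 and 1 of the full family: X is measurable for the history at level 1,
    and Y is the next variable. *)
Lemma expectation_pair (f : X * X -> R) : bdd_mfun f ->
  ('E_Pr[fun w => f (X0 w, Y0 w)])%E = (\int[P]_x \int[P]_y f (x, y))%:E.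
Proof.
move=> bf; have h01 : (0 < 1)%N by [].
have m0 := measurable_hist_obs (Z := full_family X0 Y0 Xs) h01.
pose F (z : Omega * X) := f (X0 z.1, z.2).
have bF : bdd_mfun (F : hist (full_family X0 Y0 Xs) 1 * X -> R).
  apply: (bdd_mfun_comp bf); apply: measurable_fun_pair; last exact: measurable_snd.
  exact: (measurableT_comp m0 measurable_fst).
have E := bmean_hist mF indF lawF bF.
have bF' := bdd_mfun_hist_pair mF bF.
rewrite unlock -(EFin_bmean Pr (bF' : bdd_mfun (fun w => f (X0 w, Y0 w)))) E.
congr (_%:E).
exact: (mean_law (mF 0) (lawF 0) (bdd_mfun_mean1 P bf)).
Qed.

Lemma expectation_section (f : X * X -> R) x : bdd_mfun f ->
  ('E_Pr[fun w => f (X0 w, x)])%E = (\int[P]_y f (y, x))%:E.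
Proof.
move=> bf; have bfx := bdd_mfun_sec2 x bf.
rewrite unlock -(EFin_bmean Pr (bdd_mfun_comp bfx (mF 0))).
by congr (_%:E); exact: (mean_law (mF 0) (lawF 0) bfx).
Qed.

Variables (n : nat) (Gam Ups : R) (k : X * X -> R).
Hypothesis kk : is_kernel mu k.
Hypothesis mA : measurable_fun setT (Aker mu k).
Hypothesis GU : Gam <= Ups.
Hypothesis kb : (kernel_bound mu k <= (Gam * n%:R)%:E)%E.
Hypothesis sm : ('N[mu]_2%:E[EFin \o smooth mu s k] ^+ 2 <= Ups%:E)%E.
Hypothesis kchi : Pint mu s (fun x => chi k x ^+ 2) <= Ups * n%:R * Pint mu s (Theta mu k).
Hypothesis kE : ('E_Pr[fun w => (Aker mu k (X0 w, Y0 w) ^+ 2)%R]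
  <= (Ups * Pint mu s (Theta mu k))%:E)%E.
Hypothesis kEs : (ereal_sup [set 'E_Pr[fun w => (Aker mu k (X0 w, x) ^+ 2)%R] | x in setT]
  <= (Ups * n%:R)%:E)%E.
Hypothesis kv : (vsq mu s k
  <= (Num.max Ups (Num.sqrt (Ups * Pint mu s (Theta mu k))))%:E)%E.

Lemma good_kernelP : good_kernel mu P s n Ups k.
Proof.
have [ksym mk _] := kk.
have GUn : Gam * n%:R <= Ups * n%:R by rewrite ler_wpM2r.
move: kb; rewrite /kernel_bound maxEle; set a1 := ereal_sup _; set a2 := ereal_sup _ => kb'.
have [ka1 ka2] : (a1 <= (Gam * n%:R)%:E)%E /\ (a2 <= (Gam * n%:R)%:E)%E.
  by move: kb'; case: (leP a1 a2) => [h12 ?|h21 ?]; split => //; apply: le_trans _ _; [exact: h12| |exact: ltW h21|].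
have kC2 x : (\int[mu]_y (k (x, y) ^+ 2)%:E <= (Ups * n%:R)%:E)%E.
  apply: (@le_trans _ _ (Gam * n%:R)%:E); last by rewrite lee_fin.
  by apply: le_trans ka1; apply: ereal_sup_ubound; exists x.
have kC z : `|k z| <= Ups * n%:R.
  rewrite -lee_fin; apply: (@le_trans _ _ (Gam * n%:R)%:E); last by rewrite lee_fin.
  by apply: le_trans ka2; apply: ereal_sup_ubound; exists z.
have bA := bdd_Aker mk ksym kC2 kC mA.
have bA2 := bdd_mfunX 2 bA.
have [mT _] := bdd_Theta mk ksym kC2 kC mA.
have [mchi _] := bdd_mfunX 2 (bdd_chi mk kC).
have [msm bsm] := bdd_smooth ms s0 PE mk ksym kC.
(* The assumption bounds an extended real, so it also yields finiteness; this excludes the value 0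
   that [l2norm] takes by default at an infinite norm. *)
have Nfin : ('N[mu]_2%:E[EFin \o smooth mu s k] < +oo)%E.
  rewrite ltey; apply/eqP => Ny; move: sm; rewrite Ny.
  by rewrite expe2 mulyy leye_eq.
have smi : sqint mu (smooth mu s k) by apply/in_L2P.
have kchi' := kchi; have kE' := kE; have kv' := kv.
rewrite (Pint_mean ms s0 PE mT) in kchi' kE' kv'.
rewrite (Pint_mean ms s0 PE mchi) in kchi'.
split => //.
- by rewrite -l2norm_sqr// -lee_fin /l2norm EFin_expe fineK// ge0_fin_numE// Lnorm_ge0.
- by rewrite -lee_fin -(expectation_pair bA2).
- move=> x; rewrite -lee_fin; apply: le_trans kEs; apply: ereal_sup_ubound.
  exists x => //; rewrite (expectation_section x bA2); congr (_%:E).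
  by apply: eq_Rintegral => y _; rewrite Aker_sym.
Qed.

End GoodKernel.

(** The reason for the level 4L: with m the maximum of |K_n| and n, the exponential is m^(-4), while
    |K_n| (6n + 12) <= 18 m^2, so at most 18 m^(-2) remains. *)
Lemma union_bound (R : realType) (T : choiceType) (A : {fset T}) n : (0 < n)%N ->
  #|` A|%:R * ((6 * n%:R + 12) * expR (- (4 * logcard R A n))) <= 18 / n%:R ^+ 2.
Proof.
move=> n0; set m : R := (maxn #|` A| n)%:R.
have n1 : (1 : R) <= n%:R by rewrite ler1n.
have nm : n%:R <= m by rewrite ler_nat leq_maxr.
have Am : #|` A|%:R <= m by rewrite ler_nat leq_maxl.
have m0 : 0 < m by apply: lt_le_trans nm; rewrite ltr0n.
have -> : expR (- (4 * logcard R A n)) = m ^- 4.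
  by rewrite expRN expRM_natl lnK// posrE.
rewrite mulrA ler_pdivrMr ?exprn_gt0//.
have n20 : 0 < n%:R ^+ 2 :> R by rewrite exprn_gt0//; lra.
have -> : 18 / n%:R ^+ 2 * m ^+ 4 = 18 * m ^+ 2 * (m ^+ 2 / n%:R ^+ 2).
  by rewrite -mulrA mulrCA [RHS]mulrA; field; rewrite gt_eqF//; lra.
apply: le_trans (_ : 18 * m ^+ 2 <= _).
  have -> : 18 * m ^+ 2 = m * (18 * m) by ring.
  by apply: ler_pM => //; lra.
rewrite ler_peMr ?mulr_ge0 ?sqr_ge0// ler_pdivlMr// mul1r.
by rewrite lerXn2r ?nnegrE//; lra.
Qed.

(** The reason for the fourth root: L^3 / t^3 <= t^4 V / t^3 = t V. *)
Lemma dev_err_le (R : realType) (Ups L t V : R) : 0 <= Ups -> 0 < t ->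
  L ^+ 3 <= t ^+ 4 * V -> dev_err Ups L t <= 330 * 330 * Ups * (t * V).
Proof.
move=> U0 t0 LV; rewrite /dev_err -mulrA.
have K0 : 0 <= 330 * 330 * Ups := mulr_ge0 (mulr_ge0 (ler0n _ 330) (ler0n _ 330)) U0.
apply: (ler_wpM2l K0); rewrite ler_pdivrMr ?exprn_gt0//; apply: le_trans LV _.
by rewrite le_eqVlt; apply/orP; left; apply/eqP; ring.
Qed.

Theorem theorem4p3 (R : realType) (c1 c2 : R) : 0 < c1 -> 0 < c2 ->
  exists c3 : R, 0 < c3 /\
  forall C1 : R -> R -> R -> R,
  exists C2 : R -> R -> R -> R -> R -> R -> R,
  (forall delta delta' Ups c cs cR, 0 < C2 delta delta' Ups c cs cR) /\
  forall (dX : measure_display) (X : measurableType dX)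
    (mu : {measure set X -> \bar R}) (s : X -> R)
    (dO : measure_display) (Omega : measurableType dO)
    (Pr : probability Omega R)
    (X0 Y0 : Omega -> X) (Xs : nat -> Omega -> X)
    (K : nat -> {fset X * X -> R}) (Gam Ups : R)
    (cs cR c : R) (eps1 eps2 eps3 : nat -> R) (k0 k1 : nat -> X * X -> R)
    (delta delta' : R) (r : nat -> R)
    (pen : nat -> (X * X -> R) -> Omega -> R)
    (khat : nat -> Omega -> X * X -> R),
  bounded_density mu s ->
  iid_density Pr mu s X0 Y0 Xs ->
  (forall n k, (0 < n)%N -> k \in K n -> is_kernel mu k) ->
  (forall n k, (0 < n)%N -> k \in K n -> measurable_fun setT (Aker mu k)) ->
  1 <= Gam -> 0 < Ups ->
  (forall n, (0 < n)%N -> forall k k', k \in K n -> k' \in K n ->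
    [/\ (kernel_bound mu k <= (Gam * n%:R)%:E)%E
      & (maxe (Gam%:E * (1 + supnorm s))
          (ereal_sup [set 'N[mu]_2%:E[EFin \o smooth mu s l] ^+ 2 | l in [set` K n]])
         <= Ups%:E)%E] /\
    [/\ Pint mu s (fun x => chi k x ^+ 2)
          <= Ups * n%:R * Pint mu s (Theta mu k),
        (supnorm (smooth mu s k \- smooth mu s k')%R <=
          (Num.max Ups (Num.sqrt (Ups * n%:R) *
             l2norm mu (smooth mu s k \- smooth mu s k')))%:E)%E,
        ('E_Pr[fun w => (Aker mu k (X0 w, Y0 w) ^+ 2)%R]
          <= (Ups * Pint mu s (Theta mu k))%:E)%E,
        (ereal_sup [set 'E_Pr[fun w => (Aker mu k (X0 w, x) ^+ 2)%R] | x in setT]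
          <= (Ups * n%:R)%:E)%E
      & (vsq mu s k
          <= (Num.max Ups (Num.sqrt (Ups * Pint mu s (Theta mu k))))%:E)%E]) ->
  0 < cs -> 0 < cR -> 0 < c ->
  (forall n, [/\ 0 <= eps1 n, 0 <= eps2 n & 0 <= eps3 n]) ->
  eps1 n @[n --> \oo] --> (0 : R) ->
  eps2 n @[n --> \oo] --> (0 : R) ->
  eps3 n @[n --> \oo] --> (0 : R) ->
  (forall n, (0 < n)%N -> k0 n \in K n /\ k1 n \in K n) ->
  (forall n, (0 < n)%N ->
    [/\ l2norm mu (s \- smooth mu s (k0 n)) ^+ 2
            + Pint mu s (Theta mu (k0 n)) / n%:R
          <= cs * eps1 n * (l2norm mu (s \- smooth mu s (k1 n)) ^+ 2
            + Pint mu s (Theta mu (k1 n)) / n%:R),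
        logcard R (K n) n ^+ 3 / n%:R
          <= cR * eps2 n * (l2norm mu (s \- smooth mu s (k0 n)) ^+ 2
            + Pint mu s (Theta mu (k0 n)) / n%:R)
      & l2norm mu (s \- smooth mu s (k1 n)) ^+ 2
          <= c * eps3 n * (Pint mu s (Theta mu (k1 n)) / n%:R)]) ->
  0 < delta' -> delta' <= delta -> 0 < C1 delta delta' Ups ->
  (forall n, (0 < n)%N -> 0 <= r n <= c1 * logcard R (K n) n) ->
  (forall n, (0 < n)%N ->
    with_prob_ge Pr (1 - c2 / n%:R ^+ 2) [set w |
      forall k, k \in K n ->
        let a := (2 * Pint mu s (chi k) - Pint mu s (Theta mu k)) / n%:R in
        let b := C1 delta delta' Ups * (r n * logcard R (K n) n ^+ 2 / n%:R) in
        a - delta * (Pint mu s (Theta mu k) / n%:R) - b <= pen n k w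
          <= a - delta' * (Pint mu s (Theta mu k) / n%:R) + b]) ->
  (forall n w, (0 < n)%N ->
    khat n w \in K n /\
    forall k, k \in K n ->
      Pn n (Xs^~ w) (contrast mu (shat n (Xs^~ w) (khat n w)))
        + pen n (khat n w) w
      <= Pn n (Xs^~ w) (contrast mu (shat n (Xs^~ w) k)) + pen n k w) ->
  exists eta eta' rho : nat -> R,
    [/\ eta n @[n --> \oo] --> (0 : R),
        eta' n @[n --> \oo] --> (0 : R),
        rho n @[n --> \oo] --> (0 : R)
      & forall n, 0 <= rho n] /\
    \forall n \near \oo,
      with_prob_ge Pr (1 - c3 / n%:R ^+ 2) [set w |
        let C := C2 delta delta' Ups c cs cR in
        let loss k := l2norm mu (s \- shat n (Xs^~ w) k) ^+ 2 in
        [/\ Pint mu s (Theta mu (khat n w))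
              >= (delta' / delta + C * eta n) * Pint mu s (Theta mu (k1 n)),
            loss (khat n w) >= (delta' / delta + C * eta' n) * loss (k1 n),
            inf [set loss k | k in [set` K n]] <= loss (k0 n)
          & loss (k0 n) <= rho n * (delta' / delta + C * eta' n) * loss (k1 n)]].
Proof.
move=> c1_gt0 c2_gt0.
have half_sub (a b : R) : a <= 2^-1 * b -> 2^-1 * b <= b - a by lra.
(* [c2] is for the event of the penalty, 18 for the deviations of all the kernels. *)
exists (c2 + 18); split; first by rewrite addr_gt0.
(* [C2] can be 1 because the sequences may depend on the constants: the slopes are put into [eta]
   and [eta']. *)
move=> C1; exists (fun _ _ _ _ _ _ => 1); split; first by move=> *; exact: ltr01.
move=> dX X mu s dO Omega Pr X0 Y0 Xs K Gam Ups cs cR c eps1 eps2 eps3 k0 k1 delta delta' r pen khat.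
move=> [ms s0 s1 sfin] [mF indF lawF] kK mA G1 U_gt0 hK cs0 cR0 c0 eps_ge0 cv1 cv2 cv3 k01 hr.
move=> d'0 dd C1_gt0 hrn hpen hhat.
pose Xmix := isMeasurableFun.Build _ _ _ _ _ (mF 0%N).
pose X0m : {mfun Omega >-> X} := HB.pack X0 Xmix.
pose P : probability X R := distribution Pr X0m.
have PE B : measurable B -> P B = (\int[mu]_(x in B) (s x)%:E)%E by exact: (lawF 0%N).
have lawFP i B : measurable B -> Pr (full_family X0 Y0 Xs i @^-1` B) = P B.
  by move=> mB; rewrite PE// (lawF i B mB).
have mXs i : measurable_fun setT (Xs i) := mF i.+2.
have indXs : independent_family Pr Xs := @independent_family_tail _ _ _ _ _ _ _ 2 indF.
have lawXs i B (mB : measurable B) : Pr (Xs i @^-1` B) = P B := lawFP i.+2 B mB.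
(* The bound on [Gam] and on the supremum of [s] is assumed only in the presence of kernels; k_(1,n)
   at n = 1 supplies one. *)
have [_ kK1] := k01 1%N isT.
have [[_ hU] _] := hK 1%N isT _ _ kK1 kK1.
have supU : (Gam%:E * (1 + supnorm s) <= Ups%:E)%E.
  by apply: le_trans hU; rewrite le_max lexx.
have sup0 : (0 <= supnorm s)%E.
  apply: le_trans (_ : (`|s point|)%:E <= _)%E; first by rewrite lee_fin.
  by apply: ereal_sup_ubound; exists point.
have supf : supnorm s \is a fin_num by rewrite ge0_fin_numE.
have supU' : Gam * (1 + fine (supnorm s)) <= Ups.
  by rewrite -lee_fin EFinM EFinD fineK.
have fs0 : 0 <= fine (supnorm s) by rewrite fine_ge0.
have GU : Gam <= Ups by apply: le_trans supU'; rewrite ler_peMr//; lra.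
have U1 : 1 <= Ups by exact: le_trans GU.
have sS x : s x <= Ups.
  apply: le_trans (_ : fine (supnorm s) <= _).
    rewrite -lee_fin fineK//; apply: le_trans (_ : (`|s x|)%:E <= _)%E.
      by rewrite lee_fin ler_norm.
    by apply: ereal_sup_ubound; exists x.
  by apply: le_trans supU'; nra.
have gK n k : (0 < n)%N -> k \in K n -> good_kernel mu P s n Ups k.
  move=> n0 kn; have [[kb kU] [h1 h2 h3 h4 h5]] := hK n n0 k k kn kn.
  apply: (good_kernelP ms s0 PE mF indF lawFP (kK _ _ n0 kn) (mA _ _ n0 kn) GU kb) => //.
  apply: le_trans kU; rewrite le_max; apply/orP; right.
  by apply: ereal_sup_ubound; exists k.
have PT n k : (0 < n)%N -> k \in K n -> Pint mu s (Theta mu k) = mTheta mu P k.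
  move=> n0 kn; have gk := gK n k n0 kn.
  have [mT _] := bdd_Theta (gk_meas gk) (gk_sym gk) (gk_sqr gk) (gk_bound gk) (gk_Aker gk).
  exact: (Pint_mean ms s0 PE mT).
have Pchi n k : (0 < n)%N -> k \in K n -> Pint mu s (chi k) = \int[P]_x chi k x.
  move=> n0 kn; have gk := gK n k n0 kn.
  have [mc _] := bdd_chi (gk_meas gk) (gk_bound gk).
  exact: (Pint_mean ms s0 PE mc).
have lb n k : (0 < n)%N -> k \in K n -> l2norm mu (s \- smooth mu s k) ^+ 2 = bias_sqr mu s k.
  move=> n0 kn; have gk := gK n k n0 kn.
  by rewrite l2norm_sqr//; apply: sqintB (gk_smooth gk); exact: sqint_density ms s0 sS PE.
pose q := rate c cs cR eps1 eps2 eps3.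
pose t n := root4 (q n).
pose Kc := 330 * 330 * Ups.
pose W := C1 delta delta' Ups * c1.
pose y := delta' / delta.
have q_cvg : q n @[n --> \oo] --> (0 : R) by exact: cvg_rate.
have t_cvg : t n @[n --> \oo] --> (0 : R) by exact: cvg_root4.
have d0 : 0 < delta by exact: lt_le_trans dd.
have y0 : 0 < y by exact: divr_gt0.
have U0 : 0 <= Ups by exact: ltW.
have Kc0 : 0 <= Kc := mulr_ge0 (mulr_ge0 (ler0n _ 330) (ler0n _ 330)) U0.
have W0 : 0 < W by exact: mulr_gt0.
have sl0 : 0 < slope_loss delta Kc W.
  have : 0 <= slope_Theta delta Kc W by rewrite /slope_Theta divr_ge0 ?(ltW d0)//; lra.
  by rewrite /slope_loss; lra.
have cvgZ0 (a : R) : a * t n @[n --> \oo] --> (0 : R).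
  by rewrite -[X in _ --> X](mulr0 a); apply: cvgM => //; exact: cvg_cst.
exists (fun n => - (slope_Theta delta Kc W * t n)), (fun n => - (slope_loss delta Kc W * t n)),
  (fun n => 4 * (10 + 7 * Kc) / y * t n); split.
  split=> [|||n].
  - by rewrite -[X in _ --> X]oppr0; apply: cvgN; exact: cvgZ0.
  - by rewrite -[X in _ --> X]oppr0; apply: cvgN; exact: cvgZ0.
  - exact: cvgZ0.
  - by rewrite mulr_ge0 ?sqrtr_ge0// divr_ge0 ?(ltW y0)//; lra.
have small (a e : R) : 0 < e -> \forall n \near \oo, a * t n < e.
  by move=> e0; exact: (cvgr_lt _ (cvgZ0 a)).
near=> n.
have n0 : (0 < n)%N by near: n; exact: nbhs_infty_gt.
have t1 : t n <= 1 by apply/ltW; rewrite -[t n]mul1r; near: n; exact: small.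
have t17 : 17 * t n <= 1 by apply/ltW; near: n; exact: small.
have t18 : (18 + 14 * Kc) * t n <= 1 by apply/ltW; near: n; exact: small.
have tsl : slope_loss delta Kc W * t n <= 2^-1 * y.
  by apply/ltW; near: n; apply: small; rewrite mulr_gt0.
(* This ensures L >= 1. *)
have ne : expR 1 <= n%:R :> R by near: n; exact: nbhs_infty_ger.
have N0 : (0 : R) < n%:R by rewrite ltr0n.
pose L := logcard R (K n) n.
have L1 : 1 <= L.
  rewrite -(expRK 1) /L /logcard ler_ln ?posrE ?expR_gt0//.
    by apply: le_trans ne _; rewrite ler_nat leq_maxr.
  by rewrite ltr0n leq_max n0 orbT.
have [k0n k1n] := k01 n n0.
have gk0 := gK n _ n0 k0n; have gk1 := gK n _ n0 k1n.
have devK : with_prob_ge Pr (1 - 18 / n%:R ^+ 2) [set w | forall k, k \in K n ->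
    forall t, 0 < t <= 1 -> kernel_deviation mu P s n Ups L k (k1 n) (Xs^~ w) t].
  have p0 : 0 <= (6 * n%:R + 12) * expR (- (4 * L)).
    by rewrite mulr_ge0 ?expR_ge0//; lra.
  have := @with_prob_ge_big _ _ _ Pr _ (enum_fset (K n)) _
    (fun k => [set w | forall t, 0 < t <= 1 -> kernel_deviation mu P s n Ups L k (k1 n) (Xs^~ w) t]) p0 _.
  have hev k : k \in enum_fset (K n) -> with_prob_ge Pr (1 - (6 * n%:R + 12) * expR (- (4 * L)))
     [set w | forall t, 0 < t <= 1 -> kernel_deviation mu P s n Ups L k (k1 n) (Xs^~ w) t].
    move=> kn; apply: (kernel_deviation_event mXs indXs lawXs ms s0 sS PE n0 U1 L1 (gK n k n0 kn) gk1).
    move=> x; have [_ [_ h2 _ _ _]] := hK n n0 k (k1 n) kn k1n.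
    rewrite -lee_fin; apply: le_trans h2; apply: ereal_sup_ubound; exists x => //.
  move=> /(_ hev); apply: with_prob_ge_sub => //.
  by rewrite lerD2l lerN2; exact: union_bound.
have := with_prob_geI (hpen n n0) devK.
apply: with_prob_ge_sub; first by rewrite mulrDl.
move=> w [/= hp hd]; rewrite !mul1r.
have [khn kmin] := hhat n w n0.
have gkh := gK n _ n0 khn.
have [h1 h2 h3] := hr n n0.
rewrite (lb n _ n0 k0n) (lb n _ n0 k1n) (PT n _ n0 k0n) (PT n _ n0 k1n) in h1.
rewrite (lb n _ n0 k0n) (PT n _ n0 k0n) in h2.
rewrite (lb n _ n0 k1n) (PT n _ n0 k1n) in h3.
set V1 := mTheta mu P (k1 n) in h1 h3; set V0 := mTheta mu P (k0 n) in h1 h2.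
have V10 : 0 <= V1 := mTheta_ge0 gk1.
have addN (b V : R) : b + V / n%:R = (n%:R * b + V) / n%:R.
  by rewrite mulrDl mulrAC divff ?mul1r// gt_eqF.
have mulN (b : R) : b = (n%:R * b) / n%:R by rewrite mulrAC divff ?mul1r// gt_eqF.
rewrite !addN in h1 h2; rewrite [bias_sqr mu s (k1 n)]mulN in h3.
have [q0 B1q B0q Lq] := rate_bounds c0 cs0 cR0 (eps_ge0 n) N0 V10 h1 h2 h3.
rewrite -/(q n) in q0 B1q B0q Lq.
have t0 : 0 < t n by rewrite /t /root4 !sqrtr_gt0.
have tt : 0 < t n <= 1 by rewrite t0.
have t4 : t n ^+ 4 = q n by rewrite root4_expr// ltW.
(* The biases and the penalty term need only q <= t; the full relation q = t^4 is spent on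
   [dev_err]. *)
have qt : q n <= t n by rewrite -t4 exprS ler_piMr ?(ltW t0)// exprn_ile1// ltW.
have qtV : q n * V1 <= t n * V1 by rewrite ler_wpM2r.
have B1t := le_trans B1q qtV; have B0t := le_trans B0q qtV.
have eK : dev_err Ups L (t n) <= Kc * (t n * V1).
  by apply: dev_err_le => //; rewrite t4.
pose wt := C1 delta delta' Ups * (r n * L ^+ 2).
have wW : wt <= W * (t n * V1).
  rewrite /wt /W -mulrA ler_wpM2l ?(ltW C1_gt0)//.
  have /andP[r0 rL] := hrn n n0.
  apply: le_trans (_ : c1 * L ^+ 3 <= _).
    by rewrite [L ^+ 3]exprS mulrA ler_wpM2r ?sqr_ge0.
  by rewrite ler_wpM2l ?(ltW c1_gt0)//; exact: le_trans Lq qtV.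
have penE k b : k \in K n -> n%:R * ((2 * Pint mu s (chi k) - Pint mu s (Theta mu k)) / n%:R
    - b * (Pint mu s (Theta mu k) / n%:R)) =
    2 * \int[P]_x chi k x - mTheta mu P k - b * mTheta mu P k.
  move=> kn; rewrite (PT n k n0 kn) (Pchi n k n0 kn).
  by field; rewrite gt_eqF.
have wtE : n%:R * (C1 delta delta' Ups * (r n * L ^+ 2 / n%:R)) = wt.
  by rewrite /wt; field; rewrite gt_eqF.
have /andP[hph _] := hp _ khn; have /andP[_ hp1] := hp _ k1n.
have hph' := ler_wpM2l (ltW N0) hph; have hp1' := ler_wpM2l (ltW N0) hp1.
rewrite mulrBr -/L wtE (penE _ _ khn) in hph'.
rewrite [leRHS]mulrDr -/L wtE (penE _ _ k1n) in hp1'.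
have kdh := hd _ khn _ tt; have kd1 := hd _ k1n _ tt; have kd0 := hd _ k0n _ tt.
have sel := selection_bound ms s0 sS PE n0 U1 L1 gkh gk1 tt t17 kdh kd1 (kmin _ k1n) hph' hp1'.
have ldh := loss_deviation ms s0 sS PE n0 U1 L1 gkh tt kdh.
have ld1 := loss_deviation ms s0 sS PE n0 U1 L1 gk1 tt kd1.
have ld0 := loss_deviation ms s0 sS PE n0 U1 L1 gk0 tt kd0.
have bias0 k : 0 <= n%:R * bias_sqr mu s k by rewrite mulr_ge0 ?dotf_ge0// ltW.
have R1 := final_Theta d'0 dd Kc0 (ltW W0) t0 V10 B1t eK wW sel.
have R2 := final_loss d'0 dd Kc0 (ltW W0) t0 t17 tsl V10 (bias0 _) B1t eK ldh ld1 R1.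
have yq : 2^-1 * y <= y - slope_loss delta Kc W * t n by exact: half_sub.
have R3 := final_oracle y0 Kc0 t0 t17 t18 yq V10 (bias0 _) B0t eK ld0 ld1.
split.
- by rewrite (PT n _ n0 khn) (PT n _ n0 k1n).
- by rewrite -(ler_pM2l N0) mulrCA.
- apply: ge_inf; last by exists (k0 n).
  by exists 0 => _ [k _ <-]; exact: sqr_ge0.
- by rewrite -(ler_pM2l N0) [leRHS]mulrCA.
Unshelve. all: by end_near.
Qed.
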